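(* Let $G$ be a circular-arc graph with $n\ge 3$ vertices, given by an intersection model $F$ with sorted endpoints (as described in the context), and assume $G$ has a paired-dominating set. Consider the following procedure (Algorithm 2). Let $W=\{w\in N_G[v_1] : a(w) \text{ is a maximal arc}\}$. For each $w\in W$: set $S^t_w=\{w,p_t(w)\}$ and $S^h_w=\{w,p_h(w)\}$; for each $X\in\{S^t_w,S^h_w\}$, as long as some vertex not in $X$ is not adjacent to any vertex of $X$, let $v$ be the next undominated vertex with respect to $X$ and, if $p_t(p_t(v))\in X$, replace $X$ by $X\cup\{v,p_t(v)\}$, otherwise replace $X$ by $X\cup\{p_t(v),p_t(p_t(v))\}$; then let $S_w=S^t_w$ if $|S^t_w|\le |S^h_w|$ and $S_w=S^h_w$ otherwise. Finally output a set $S_w$ ($w\in W$) of minimum cardinality. Then Algorithm 2 outputs a minimum paired-dominating set of $G$, and it can be implemented to run in $O(n)$ time.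
   Context: For a graph $G$, a set $S\subseteq V(G)$ is a dominating set if every vertex not in $S$ is adjacent to a vertex of $S$; it is a paired-dominating set if it is dominating and $G[S]$ has a perfect matching; a minimum one has smallest cardinality. $N_G(v)$ is the neighbourhood of $v$, $N_G[v]=N_G(v)\cup\{v\}$, and for $S\subseteq V(G)$, $N[S]=\bigcup_{u\in S}N_G[u]$. A circular-arc graph $G$ with $V(G)=\{v_1,\dots,v_n\}$ is given by an intersection model $F$: each vertex $v$ corresponds to an arc $a(v)=[h(v),t(v)]$ of a circle, where the head $h(v)$ precedes the tail $t(v)$ in the clockwise direction, and two vertices are adjacent iff their arcs intersect. All $2n$ endpoints are distinct, no arc covers the whole circle, and the endpoints are labelled $1,\dots,2n$ in clockwise order with $h(v_1)=1$; the arc $a(v_1)$ is arbitrary and $v_2,\dots,v_n$ are ordered so that $h(v_i)$ is met before $h(v_j)$ moving clockwise from $h(v_1)$ whenever $i<j$. An arc is maximal if it is not contained in any other arc of $F$. The tail partner $p_t(v)$ is the neighbour $u$ of $v$ with $t(v)\in a(u)$ whose tail $t(u)$ is the last one encountered moving clockwise from $t(v)$ among such neighbours; the head partner $p_h(v)$ is the neighbour $u$ of $v$ with $h(v)\in a(u)$ whose head $h(u)$ is the last one encountered moving counterclockwise from $h(v)$ among such neighbours. For $X\subseteq V(G)$, the next undominated vertex with respect to $X$ is the vertex $v\in V(G)\setminus N[X]$ whose tail $t(v)$ is the first tail encountered moving clockwise from $t(v_1)$.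
   Formalization: When no neighbour of v has an arc containing t(v) (resp. h(v)), the tail (resp. head) partner is undefined; there it is taken to be a neighbour of v: correctness is proved for every such choice, the O(n) bound for some such choice. *)

(* Defs.v *)
From mathcomp Require Import all_boot.
Set Implicit Arguments.
Unset Strict Implicit.
Unset Printing Implicit Defensive.

(* A graph on a finite type T is its (symmetric, irreflexive) adjacency
   relation; circular-arc graphs are the relations [adj F] below. *)
Section Domination.
Variables (T : finType) (e : rel T).

Definition nbhd (v : T) : {set T} := [set u | e v u].
Definition cl_nbhd (v : T) : {set T} := v |: nbhd v.
Definition cl_nbhd_set (S : {set T}) : {set T} := \bigcup_(u in S) cl_nbhd u.

Definition dominating (S : {set T}) : Prop :=
  forall v, v \notin S -> exists2 u, u \in S & e v u.

(* M is a perfect matching of the subgraph induced by S: edges of the graph,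
   as two-element sets, that partition S. *)
Definition perfect_matching (S : {set T}) (M : {set {set T}}) : Prop :=
  partition M S /\
  (forall B, B \in M -> exists x y, [/\ x != y, e x y & B = [set x; y]]).

Definition paired_dominating (S : {set T}) : Prop :=
  dominating S /\ exists M, perfect_matching S M.

Definition min_paired_dominating (S : {set T}) : Prop :=
  paired_dominating S /\
  forall S' : {set T}, paired_dominating S' -> #|S| <= #|S'|.

End Domination.

(* The clockwise distance from x to y on a circle of m equally spaced places
   numbered 0, ..., m - 1 clockwise (meant for x, y < m). *)
Definition cw (m x y : nat) : nat := (y + m - x) %% m.

(* The n vertices are 0, ..., n - 1 and the 2n endpoint labels are
   0, ..., 2n - 1, i.e. one less than in the 1-based numbering; [vfirst] is v_1
   and [hd v], [tl v] are the labels of h(v), t(v).  As labels are pairwise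
   distinct, every label is used and no arc covers the whole circle. *)
Record arc_model (n : nat) := ArcModel {
  hd : 'I_n -> 'I_n.*2;
  tl : 'I_n -> 'I_n.*2;
  hd_inj : injective hd;
  tl_inj : injective tl;
  hd_neq_tl : forall u v, hd u != tl v;
  vfirst : 'I_n;
  vfirst0 : vfirst = 0 :> nat;
  hd_vfirst : hd vfirst = 0 :> nat;
  hd_sorted : forall u v : 'I_n, u < v -> hd u < hd v
}.

(* The circle cut at the 2n endpoints has 4n pieces: piece 2k is the endpoint
   labelled k and piece 2k + 1 is the open gap between endpoint k and the next
   one.  Each closed arc is a union of pieces, so that two arcs meet, or one
   contains the other, exactly when their sets of pieces do.  (The gaps matter:
   two arcs covering the circle may well satisfy an inclusion between the sets
   of endpoints they contain.) *)
Definition endpoint n (p : 'I_n.*2) : 'I_n.*2.*2 :=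
  Ordinal (etrans (ltn_double p n.*2) (ltn_ord p)).

Section CircularArcGraph.
Variables (n : nat) (F : arc_model n).
Implicit Types (u v w : 'I_n) (X Y S : {set 'I_n}).

Definition arc v : {set 'I_n.*2.*2} :=
  [set x : 'I_n.*2.*2 | cw n.*2.*2 (endpoint (hd F v)) x
           <= cw n.*2.*2 (endpoint (hd F v)) (endpoint (tl F v))].

Definition adj : rel 'I_n := fun u v => (u != v) && (arc u :&: arc v != set0).

Definition maximal_arc v : bool := [forall u, (u != v) ==> ~~ (arc v \subset arc u)].

Definition tail_nbrs v : {set 'I_n} :=
  [set u in nbhd adj v | endpoint (tl F v) \in arc u].
Definition head_nbrs v : {set 'I_n} :=
  [set u in nbhd adj v | endpoint (hd F v) \in arc u].

(* When no neighbour of v contains t(v), for instance when a(v) contains all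
   the arcs it meets, the tail partner of v may be any neighbour of v; and
   likewise for the head partner. *)
Definition tail_partner v u : Prop :=
  if tail_nbrs v == set0 then is_true (u \in nbhd adj v) else
  u \in tail_nbrs v /\
  (forall u', u' \in tail_nbrs v ->
     cw n.*2 (tl F v) (tl F u') <= cw n.*2 (tl F v) (tl F u)).

Definition head_partner v u : Prop :=
  if head_nbrs v == set0 then is_true (u \in nbhd adj v) else
  u \in head_nbrs v /\
  (forall u', u' \in head_nbrs v ->
     cw n.*2 (hd F u') (hd F v) <= cw n.*2 (hd F u) (hd F v)).

Definition next_undominated X v : Prop :=
  v \notin cl_nbhd_set adj X /\
  (forall u, u \notin cl_nbhd_set adj X ->
     cw n.*2 (tl F (vfirst F)) (tl F v) <= cw n.*2 (tl F (vfirst F)) (tl F u)).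

Section Algorithm.
Variables pt ph : 'I_n -> 'I_n.

Definition start_vertices : {set 'I_n} :=
  [set w in cl_nbhd adj (vfirst F) | maximal_arc w].

(* [complete X Y]: the loop entered with X stops, with final value Y. *)
Inductive complete : {set 'I_n} -> {set 'I_n} -> Prop :=
| complete_stop X : dominating adj X -> complete X X
| complete_step X v Y :
    ~ dominating adj X -> next_undominated X v ->
    complete (if pt (pt v) \in X then X :|: [set v; pt v]
              else X :|: [set pt v; pt (pt v)]) Y ->
    complete X Y.

Definition candidate w S : Prop :=
  exists St Sh : {set 'I_n},
    [/\ complete [set w; pt w] St, complete [set w; ph w] Sh
      & S = if #|St| <= #|Sh| then St else Sh].

(* All the runs, one for each starting vertex, must stop.  The only freedom is
   the choice among the S_w of minimum cardinality. *)
Definition algorithm_output S : Prop :=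
  exists Sw : 'I_n -> {set 'I_n},
    (forall w, w \in start_vertices -> candidate w (Sw w)) /\
    exists w, [/\ w \in start_vertices, S = Sw w
      & forall w', w' \in start_vertices -> #|Sw w| <= #|Sw w'|].

End Algorithm.
End CircularArcGraph.

(* Time is measured on a unit-cost word RAM whose words hold the integers
   0, ..., B, programmed in a while-language.  The store consists of word
   variables and arrays of words, both named by integers (a program mentions
   finitely many of them).  An operation whose result exceeds B is stuck. *)
Inductive binop := OpAdd | OpSub | OpLt | OpEq.

Inductive expr :=
| Cst of nat
| Var of nat
| Get of nat & expr
| Op of binop & expr & expr.

Inductive cmd :=
| Skip
| SetVar of nat & expr
| SetArr of nat & expr & expr
| Seq of cmd & cmd
| If of expr & cmd & cmd
| While of expr & cmd.

Record store := Store { var : nat -> nat; arr : nat -> nat -> nat }.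

Definition set_var (s : store) (x v : nat) : store :=
  Store [eta var s with x |-> v] (arr s).

Definition set_arr (s : store) (a i v : nat) : store :=
  Store (var s) (fun b j => if (b == a) && (j == i) then v else arr s b j).

Definition eval_op (o : binop) (x y : nat) : nat :=
  match o with
  | OpAdd => x + y
  | OpSub => x - y
  | OpLt => x < y
  | OpEq => x == y
  end.

Definition word (B x : nat) : option nat := if x <= B then Some x else None.

Fixpoint eval (B : nat) (s : store) (e : expr) : option nat :=
  match e with
  | Cst k => word B k
  | Var x => word B (var s x)
  | Get a i => obind (fun k => word B (arr s a k)) (eval B s i)
  | Op o e1 e2 =>
      obind (fun x => obind (fun y => word B (eval_op o x y)) (eval B s e2))
            (eval B s e1)
  end.

Fixpoint expr_cost (e : expr) : nat :=
  match e with
  | Cst _ | Var _ => 1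
  | Get _ i => (expr_cost i).+1
  | Op _ e1 e2 => (expr_cost e1 + expr_cost e2).+1
  end.

(* [exec B c s k s']: started in s, the command c halts in s' after k units of
   time. *)
Inductive exec (B : nat) : cmd -> store -> nat -> store -> Prop :=
| exec_skip s : exec B Skip s 1 s
| exec_set_var s x e v :
    eval B s e = Some v ->
    exec B (SetVar x e) s (expr_cost e).+1 (set_var s x v)
| exec_set_arr s a e1 e2 i v :
    eval B s e1 = Some i -> eval B s e2 = Some v ->
    exec B (SetArr a e1 e2) s (expr_cost e1 + expr_cost e2).+1 (set_arr s a i v)
| exec_seq c1 c2 s1 s2 s3 k1 k2 :
    exec B c1 s1 k1 s2 -> exec B c2 s2 k2 s3 ->
    exec B (Seq c1 c2) s1 (k1 + k2) s3
| exec_if e c1 c2 s s' k v :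
    eval B s e = Some v ->
    exec B (if v != 0 then c1 else c2) s k s' ->
    exec B (If e c1 c2) s ((expr_cost e).+1 + k) s'
| exec_while_end e c s :
    eval B s e = Some 0 ->
    exec B (While e c) s (expr_cost e).+1 s
| exec_while_step e c s1 s2 s3 k1 k2 v :
    eval B s1 e = Some v -> v != 0 ->
    exec B c s1 k1 s2 -> exec B (While e c) s2 k2 s3 ->
    exec B (While e c) s1 ((expr_cost e).+1 + k1 + k2) s3.

(* Initially variable 0 holds n, arrays 0 and 1 hold the labels of the heads
   and of the tails, and everything else is 0. *)
Definition input_store n (F : arc_model n) : store :=
  let table (f : 'I_n -> 'I_n.*2) i := oapp (fun v => nat_of_ord (f v)) 0 (insub i) in
  Store (fun x => if x == 0 then n else 0)
        (fun a i => if a == 0 then table (hd F) i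
                    else if a == 1 then table (tl F) i else 0).

(* The output is the characteristic vector of S, in array 2. *)
Definition outputs n (s : store) (S : {set 'I_n}) : Prop :=
  forall v : 'I_n, arr s 2 v = (v \in S) :> nat.

(* Main.v *)
Require Import Defs.
From mathcomp Require Import all_boot.
From mathcomp Require Import zify.
Set Implicit Arguments.
Unset Strict Implicit.
Unset Printing Implicit Defensive.

(* Cut open and unrolled, the circle becomes a line on which the arc of u has
   the copies [P, P + len u], P = h(u) mod L with L = 2n.  From a frontier G the
   greedy pair of Algorithm 2 reaches f(G) = far (far (near G)): near G is the
   first tail of a copy starting after G, far G the last tail of a copy
   starting at or before G.  The function f is monotone and commutes with the
   shift by L.

   Lower bound: if k pairs of intersecting arcs dominate the graph and no fewer
   do, then f^k(B) >= B + L, where [A, B] is the union of one of the pairs.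
   Indeed a greedy step may be charged to a pair meeting the vertex it serves;
   if this pair met a further vertex the greedy step misses, the union of the
   pair would have to go round the circle the other way and contain [A, B], so
   that a pair could be saved.

   As f permutes a periodic orbit monotonically, G + L <= f^k(G) holds at every
   point of every periodic orbit, and any orbit is periodic after n steps.
   Follow such an orbit until it passes the tail of v_1: a vertex of the pair
   that gets there lies in a maximal arc w meeting v_1, and starting from
   {w, p_t(w)} or {w, p_h(w)} the frontier runs ahead of the orbit, hence closes
   up after at most k - 1 rounds.  So S_w is minimum for this particular w, and
   finding it takes O(n) steps of f.  As every S_w is a paired-dominating set,
   this proves the correctness of the procedure, and a linear-time program need
   only compute this w and simulate the two runs for it. *)

(** Which start wins depends on the arc that gets past the tail of v_1. If it is the first vertex of
    its greedy pair, the second one is still ahead and {w, p_t(w)} keeps up with the orbit; if it is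
    the second, the first one lies behind and {w, p_h(w)} recovers what it covered. A vertex whose
    tail lies in no neighbour may have any neighbour as tail partner. For the upper bound this is
    harmless: [v] is then the only arc over t(v), so [far] does not move there. The program,
    however, must reproduce genuine runs, so it takes as default the owner of the adjacent label,
    which never overshoots the frontier. Accordingly there are two loop invariants. Bounding a run
    only needs that undominated vertices fit into the gap left by the frontier ([confined]);
    reproducing it also needs that no chosen arc reaches into that gap ([inside]), and there the
    maximality of the arc of w is used again. The passage from one orbit to all periodic orbits
    compares rotation numbers: gaining a turn every k steps somewhere forces a mean speed of at
    least 1/k turn per step everywhere. *)

Local Notation arc := Defs.arc.

(* Congruences among the hypotheses would make [lia] very slow. *)
Ltac arith := repeat match goal with
  | H : ?T |- _ => lazymatch type of T with Prop => lazymatch T with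
      | context [modn] => clear H
      | context [cw] => clear H
      | is_true (leq _ _) => fail
      | is_true (leq _ _ && leq _ _) => fail
      | @eq nat _ _ => fail
      | not (@eq nat _ _) => fail
      | @eq bool (leq _ _) _ => fail
      | _ /\ _ => fail
      | _ => clear H
      end end
  end; lia.

(** * Arithmetic of clockwise distances *)

Lemma cw_lt m x y : 0 < m -> cw m x y < m.
Proof. by move=> m0; rewrite ltn_mod. Qed.

Lemma cw_mod m a b : 0 < m -> a <= b -> cw m (a %% m) (b %% m) = (b - a) %% m.
Proof.
move=> m0 ab; rewrite /cw; apply/eqP.
have am : a %% m < m by rewrite ltn_mod.
rewrite -(eqn_modDr (a %% m)) subnK; last by lia.
by rewrite addnC modnDl modn_mod modnDmr subnK.
Qed.

Lemma cw_sub m a b : a <= b -> b < a + m -> cw m (a %% m) (b %% m) = b - a.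
Proof. by move=> ab bam; rewrite cw_mod ?modn_small; lia. Qed.

Lemma cw_if m x y : x < m -> y < m -> cw m x y = if x <= y then y - x else y + m - x.
Proof.
move=> xm ym; rewrite /cw; case: leqP => xy; last by rewrite modn_small; lia.
by rewrite -addnBAC // modnDr modn_small; lia.
Qed.

Lemma cw_double m x y : cw m.*2 x.*2 y.*2 = (cw m x y).*2.
Proof. by rewrite /cw -doubleD -doubleB -!muln2 muln_modl. Qed.

(** * Arcs on the universal cover *)

Section Geometry.
Variables (n : nat) (F : arc_model n).
Local Notation L := n.*2.
Implicit Types (u v w x y : 'I_n) (P Q : nat).

Definition len u := cw L (hd F u) (tl F u).

(* [copy u P]: on the universal cover of the circle, the interval
   [P, P + len u] lies above the arc of u. *)
Definition copy u P := P %% L == hd F u.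

Lemma L_gt0 : 0 < L.
Proof. by have := ltn_ord (vfirst F); lia. Qed.

Lemma hd_lt u : hd F u < L. Proof. exact: ltn_ord. Qed.
Lemma tl_lt u : tl F u < L. Proof. exact: ltn_ord. Qed.

Lemma len_lt u : len u < L. Proof. exact: cw_lt L_gt0. Qed.

Lemma hd_len u : (hd F u + len u) %% L = tl F u.
Proof.
rewrite /len cw_if ?hd_lt ?tl_lt //.
case: (leqP (hd F u) (tl F u)) (hd_lt u) (tl_lt u) => ? ? ?.
  by rewrite subnKC // modn_small.
by rewrite addnBCA ?subnn ?addn0 ?modnDr ?modn_small //; lia.
Qed.

Lemma len_gt0 u : 0 < len u.
Proof.
rewrite lt0n; apply: contraNneq (hd_neq_tl F u u) => l0.
by rewrite -val_eqE /= -(hd_len u) l0 addn0 modn_small ?hd_lt.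
Qed.

Lemma copyS u P : copy u P -> copy u (P + L).
Proof. by rewrite /copy modnDr. Qed.

Lemma copyB u P : copy u P -> L <= P -> copy u (P - L).
Proof. by move=> c LP; rewrite /copy -(modnDr (P - L)) subnK. Qed.

Lemma copy_tl u P : copy u P -> (P + len u) %% L = tl F u.
Proof. by move/eqP=> c; rewrite -modnDml c hd_len. Qed.

Lemma mod_pos (q a : nat) : q < L -> exists2 P, a <= P < a + L & P %% L = q.
Proof.
move=> qL; have L0 := L_gt0.
exists (a + cw L (a %% L) q); first by have := cw_lt (a %% L) q L0; lia.
have am : a %% L < L by rewrite ltn_mod.
rewrite /cw modnDmr -modnDml.
by rewrite addnBCA ?subnn ?addn0 ?modnDr ?(@modn_small q) //; lia.
Qed.

Lemma copy_in u (a : nat) : exists2 P, a <= P < a + L & copy u P.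
Proof. by have [P ? /eqP] := mod_pos a (hd_lt u); exists P. Qed.

Lemma tail_in u (a : nat) :
  exists2 P, copy u P & a + L <= P + len u < a + L + L.
Proof.
have [P aP cP] := copy_in u (a + L - len u); have := len_lt u.
by exists P => //; lia.
Qed.

Lemma modB0 P Q : Q %% L = P %% L -> P <= Q -> (Q - P) %% L = 0.
Proof. by move=> /eqP e PQ; apply/eqP; move: e; rewrite eqn_mod_dvd. Qed.

Lemma mod_gap P Q : P %% L = Q %% L -> P < Q -> P + L <= Q.
Proof.
move=> e PQ; rewrite leqNgt; apply/negP => lt.
by have := modB0 (esym e) (ltnW PQ); rewrite modn_small; lia.
Qed.

Lemma copy_gap u P Q : copy u P -> copy u Q -> P < Q -> P + L <= Q.
Proof. by move=> /eqP cP /eqP cQ; apply: mod_gap; rewrite cP. Qed.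

Lemma copy_inj u v P : copy u P -> copy v P -> u = v.
Proof. by move=> /eqP cu /eqP cv; apply/(@hd_inj _ F)/val_inj; rewrite /= -cu -cv. Qed.

Lemma tail_inj u v P Q : copy u P -> copy v Q ->
  (P + len u) %% L = (Q + len v) %% L -> u = v.
Proof.
by move=> /copy_tl cu /copy_tl cv e; apply/(@tl_inj _ F)/val_inj; rewrite /= -cu -cv.
Qed.

Lemma head_tail u v P Q : copy u P -> copy v Q -> P <> Q + len v.
Proof.
move=> cu cv e; have := hd_neq_tl F u v.
by rewrite -val_eqE /= -(copy_tl cv) -e (eqP cu) eqxx.
Qed.

Lemma tail_copy u c : c %% L = tl F u -> L <= c ->
  exists2 P, copy u P & P + len u = c.
Proof.
move=> cu Lc; have [P /andP[P1 P2] cP] := copy_in u (c - len u).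
have lu := len_lt u; exists P => //; apply/eqP; rewrite eqn_leq.
have e : c %% L = (P + len u) %% L by rewrite cu (copy_tl cP).
by apply/andP; split; rewrite leqNgt; apply/negP => /(mod_gap _); rewrite e; lia.
Qed.

(* All copies of two arcs with a common piece differ by a common shift, so it
   is enough to know where one pair of copies meets. *)
Lemma copy_shift u v P Q P' : copy u P -> copy v Q -> Q < P + L -> P < Q + L ->
  copy u P' -> L <= P' -> exists2 Q', copy v Q' & P + Q' = P' + Q.
Proof.
move=> cP cQ QP PQ cP' LP'; case: (leqP P P') => h.
  exists (Q + (P' - P)); last by lia.
  rewrite /copy -modnDmr.
  by rewrite modB0 ?addn0 // (eqP cP) (eqP cP').
exists (Q - (P - P')); last by lia.
move/eqP: (cQ) => eQ; rewrite /copy -eQ -[X in _ == X %% _](@subnK (P - P') Q); last by lia.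
by rewrite -[X in _ == X]modnDmr (@modB0 P' P) ?addn0 ?(eqP cP) ?(eqP cP') //; lia.
Qed.

Definition touch u v := arc F u :&: arc F v != set0.

Lemma in_arc u (x : 'I_n.*2.*2) :
  (x \in arc F u) = (cw L.*2 (hd F u).*2 x <= (len u).*2).
Proof. by rewrite inE /= cw_double. Qed.

Lemma endpoint_in u P Q (q : 'I_L) : copy u P -> Q %% L = q ->
  P <= Q < P + L -> (endpoint q \in arc F u) = (Q <= P + len u).
Proof.
move=> /eqP cP Qv /andP[PQ QP]; rewrite in_arc /= cw_double leq_double.
by rewrite -cP -Qv cw_sub //; lia.
Qed.

Lemma cw_copy u v P Q : copy u P -> copy v Q -> P <= Q -> Q < P + L ->
  cw L (hd F u) (hd F v) = Q - P.
Proof. by move=> /eqP <- /eqP <-; exact: cw_sub. Qed.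

Lemma touchC u v : touch u v = touch v u.
Proof. by rewrite /touch setIC. Qed.

Lemma touchxx u : touch u u.
Proof.
apply/set0Pn; exists (endpoint (hd F u)).
by rewrite setIid in_arc /cw addnC addnK modnn.
Qed.

Lemma touch_in u v P Q : copy u P -> copy v Q -> P <= Q -> Q <= P + len u ->
  touch u v.
Proof.
move=> cP cQ PQ QP; have lu := len_lt u; have lv := len_gt0 v.
apply/set0Pn; exists (endpoint (hd F v)).
rewrite inE (endpoint_in cP (eqP cQ)) ?QP //=; last by lia.
by rewrite (endpoint_in cQ (eqP cQ)) //; lia.
Qed.

Lemma touch_of u v P Q : copy u P -> copy v Q ->
  P <= Q + len v -> Q <= P + len u -> touch u v.
Proof.
move=> cP cQ PQ QP; case: (leqP P Q) => h; first exact: (touch_in cP cQ).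
by rewrite touchC; apply: (touch_in cQ cP) => //; lia.
Qed.

(** The common piece, endpoint or gap, is lifted to one place of the line, high enough that an arc
    crossing the cut still has a copy around it. *)
Lemma touchE u v : touch u v -> exists P Q,
  [/\ copy u P, copy v Q, P <= Q + len v & Q <= P + len u].
Proof.
case/set0Pn => x; rewrite inE !in_arc => /andP[].
have pre w : cw L.*2 (hd F w).*2 x <= (len w).*2 -> exists2 P, copy w P &
    P.*2 <= x + L.*2 + L.*2 <= P.*2 + (len w).*2.
  have hw := hd_lt w; have lw := len_lt w.
  set d := cw _ _ _ => dl.
  have xlt : x < L.*2 by [].
  have [k ek] : exists k, x + L.*2 + L.*2 - d = k.*2 + (hd F w).*2 /\ k %% L = 0.
    move: dl; rewrite /d cw_if; [|lia..].
    case: (leqP (hd F w).*2 x) => h dl; first by exists (L + L); rewrite modnDl modnn; split=> //; lia.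
    by exists L; rewrite modnn; split=> //; lia.
  exists (k + hd F w); last by lia.
  by rewrite /copy -modnDml ek.2 add0n modn_small ?hd_lt.
by move=> /pre[P cP hP] /pre[Q cQ hQ]; exists P, Q; split => //; lia.
Qed.

Lemma touch_at u v P : touch u v -> copy u P -> L <= P ->
  exists Q, [/\ copy v Q, P <= Q + len v & Q <= P + len u].
Proof.
case/touchE=> P0 [Q0] [cP0 cQ0 h1 h2] cP LP.
have lu := len_lt u; have lv := len_lt v.
have [Q0P P0Q] : Q0 < P0 + L /\ P0 < Q0 + L by lia.
have [Q cQ e] := copy_shift cP0 cQ0 Q0P P0Q cP LP.
by exists Q; split=> //; lia.
Qed.

Lemma adjE u v : adj F u v = (u != v) && touch u v.
Proof. by []. Qed.

Lemma adjC u v : adj F u v = adj F v u.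
Proof. by rewrite !adjE touchC eq_sym. Qed.

Lemma sub_arcP u w : arc F w \subset arc F u ->
  cw L (hd F u) (hd F w) + len w <= len u.
Proof.
move=> /subsetP sub; rewrite leqNgt; apply/negP => lt.
set d := cw _ _ _ in lt; have L0 := L_gt0.
have [d_lt lu lw] : [/\ d < L, len u < L & len w < L] by rewrite !len_lt cw_lt.
have [P _ cP] := copy_in u 0.
have [Q PQ cQ] := copy_in w P.
have eQ : Q = P + d by rewrite /d (cw_copy cP cQ) //; lia.
(* The witness is the gap just after the tail of [u]. Endpoints alone would not do when the two arcs
   together cover the circle. *)
have xlt : (P.*2 + (len u).*2).+1 %% L.*2 < L.*2 by rewrite ltn_mod double_gt0.
have in_ v (R : nat) : copy v R -> forall a, R.*2 <= a < R.*2 + L.*2 -> forall alt,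
    (Ordinal (alt : a %% L.*2 < L.*2) \in arc F v) = (a <= R.*2 + (len v).*2).
  move=> /eqP cR a /andP[Ra aR] alt; rewrite in_arc -cR -[(R %% L).*2]muln2 muln_modl muln2.
  by rewrite /= muln2 cw_sub //; lia.
case: (leqP d (len u)) => du.
  have := sub (Ordinal xlt).
  rewrite [(_ \in arc F w)](in_ _ _ cQ); last by lia.
  by rewrite [(_ \in arc F u)](in_ _ _ cP); lia.
have alt : Q.*2 %% L.*2 < L.*2 by rewrite ltn_mod double_gt0.
have := sub (Ordinal alt).
rewrite [(_ \in arc F w)](in_ _ _ cQ); last by lia.
by rewrite [(_ \in arc F u)](in_ _ _ cP); lia.
Qed.
End Geometry.

(** * The greedy sweep *)

Section Sweep.
Variables (n : nat) (F : arc_model n).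
Local Notation L := n.*2.
Local Notation copy := (copy F).
Local Notation len := (len F).
Implicit Types (u v w x y : 'I_n) (P Q G : nat).

Definition last_copy u G := G - cw L (hd F u) (G %% L).
Definition next_copy u G := G.+1 + cw L (G.+1 %% L) (hd F u).

Lemma last_copyP u G : L <= G ->
  copy u (last_copy u G) /\ last_copy u G <= G < last_copy u G + L.
Proof.
move=> LG; have L0 := L_gt0 F.
have cl : cw L (hd F u) (G %% L) < L by rewrite cw_lt.
split; last by rewrite /last_copy; lia.
have [P /andP[GP PG] cP] := copy_in F u (G.+1 - L).
suff -> : last_copy u G = P by [].
by rewrite /last_copy -(eqP cP) cw_sub; lia.
Qed.

Lemma next_copyP u G :
  copy u (next_copy u G) /\ G < next_copy u G <= G + L.
Proof.
have L0 := L_gt0 F.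
have [P /andP[GP PG] cP] := copy_in F u G.+1.
suff -> : next_copy u G = P by split=> //; lia.
by rewrite /next_copy -(eqP cP) cw_sub; lia.
Qed.

Definition far_vertex G := [arg max_(u > vfirst F) (last_copy u G + len u)].
Definition near_vertex G := [arg min_(u < vfirst F) (next_copy u G + len u)].

(* The farthest tail among the copies that start at or before [G], and the
   nearest tail among those that start after [G]. *)
Definition far G := last_copy (far_vertex G) G + len (far_vertex G).
Definition near G := next_copy (near_vertex G) G + len (near_vertex G).

Lemma far_max G u P : L <= G -> copy u P -> P <= G -> P + len u <= far G.
Proof.
move=> LG cP PG; rewrite /far /far_vertex; case: arg_maxnP => // v _ vmax.
have [cu /andP[_ h]] := last_copyP u LG.
apply: leq_trans (vmax u isT); rewrite leq_add2r leqNgt; apply/negP => lt.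
by have := copy_gap cu cP lt; lia.
Qed.

Lemma near_min G u P : copy u P -> G < P -> near G <= P + len u.
Proof.
move=> cP GP; rewrite /near /near_vertex; case: arg_minnP => // v _ vmin.
have [cu /andP[h h']] := next_copyP u G.
apply: leq_trans (vmin u isT) _; rewrite leq_add2r leqNgt; apply/negP => lt.
by have := copy_gap cP cu lt; lia.
Qed.

Lemma far_attained G : L <= G ->
  exists u P, [/\ copy u P, P <= G < P + L & P + len u = far G].
Proof.
move=> LG; exists (far_vertex G), (last_copy (far_vertex G) G).
by have [? ?] := last_copyP (far_vertex G) LG.
Qed.

Lemma near_attained G :
  exists u P, [/\ copy u P, G < P <= G + L & P + len u = near G].
Proof.
exists (near_vertex G), (next_copy (near_vertex G) G).
by have [? ?] := next_copyP (near_vertex G) G.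
Qed.

Lemma far_uniq G u P : L <= G -> copy u P -> P <= G ->
  (forall v Q, copy v Q -> Q <= G -> Q + len v <= P + len u) ->
  far G = P + len u.
Proof.
move=> LG cP PG h; apply/eqP; rewrite eqn_leq (far_max LG cP PG) andbT.
by have [v [Q [cQ /andP[QG _] <-]]] := far_attained LG; exact: h.
Qed.

Lemma near_uniq G u P : copy u P -> G < P ->
  (forall v Q, copy v Q -> G < Q -> P + len u <= Q + len v) ->
  near G = P + len u.
Proof.
move=> cP PG h; apply/eqP; rewrite eqn_leq (near_min cP PG) /=.
by have [v [Q [cQ /andP[QG _] <-]]] := near_attained G; exact: h.
Qed.

Opaque far near.

Lemma far_mono G G' : L <= G -> G <= G' -> far G <= far G'.
Proof.
move=> LG GG'; have [u [P [cP /andP[PG _] <-]]] := far_attained LG.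
by apply: far_max => //; lia.
Qed.

Lemma near_mono G G' : G <= G' -> near G <= near G'.
Proof.
move=> GG'; have [u [P [cP /andP[PG _] <-]]] := near_attained G'.
by apply: near_min => //; lia.
Qed.

(** Tails are distinct labels, so a copy ending at [far G] is the very copy that attains the
    maximum. *)
Lemma far_copy_le G u P : L <= G -> copy u P -> P + len u = far G -> P <= G.
Proof.
move=> LG cP; have [v [Q [cQ /andP[QG _] <-]]] := far_attained LG => e.
by have := tail_inj cP cQ; rewrite e => /(_ erefl) uv; move: e; rewrite uv; lia.
Qed.

Lemma farS G : L <= G -> far (G + L) = far G + L.
Proof.
move=> LG; have [u [P [cP /andP[PG GP] e]]] := far_attained LG.
rewrite -e addnAC; apply: far_uniq; [lia|exact: copyS|lia|] => v Q cQ QG.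
case: (leqP L Q) => LQ.
  by have := far_max LG (copyB cQ LQ); lia.
by have := far_max LG cQ; lia.
Qed.

Lemma nearS G : near (G + L) = near G + L.
Proof.
have [u [P [cP /andP[GP PG] e]]] := near_attained G.
rewrite -e addnAC; apply: near_uniq; [exact: copyS|lia|] => v Q cQ GQ.
have LQ : L <= Q by lia.
by have := near_min (G := G) (copyB cQ LQ); lia.
Qed.

(** A head comes after [G] and its tail at least one place later. The resulting two units of slack
    absorb two default partners in [exact_step]. *)
Lemma near_gt G : G.+1 < near G.
Proof.
have [u [P [cP /andP[PG _] <-]]] := near_attained G.
by have := len_gt0 F u; lia.
Qed.

Definition is_tail G := exists u P, copy u P /\ P + len u = G.

Lemma far_tail G : L <= G -> is_tail (far G).
Proof. by move=> LG; have [u [P [cP _ e]]] := far_attained LG; exists u, P. Qed.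

Lemma near_tail G : is_tail (near G).
Proof. by have [u [P [cP _ e]]] := near_attained G; exists u, P. Qed.

Lemma far_ge G : L <= G -> is_tail G -> G <= far G.
Proof. by move=> LG [u [P [cP e]]]; rewrite -e; apply: far_max; lia. Qed.

(* The frontier reached from the frontier [G] by adding the pair of Algorithm 2
   for the next undominated vertex. *)
Definition advance G := far (far (near G)).

Lemma near_ge G : L <= G -> L <= near G.
Proof. by have := near_gt G; lia. Qed.

Lemma near_far G : L <= G -> near G <= far (near G).
Proof. by move=> LG; apply: far_ge (near_tail G); apply: near_ge. Qed.

Lemma far_advance G : L <= G -> far (near G) <= advance G.
Proof.
by move=> LG; have h := near_far LG; have h' := near_ge LG;
  apply: far_ge; [lia|apply: far_tail].
Qed.

Lemma advance_gt G : L <= G -> G < advance G.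
Proof.
by move=> LG; have := near_gt G; have := near_far LG; have := far_advance LG; lia.
Qed.

Lemma advance_ge G : L <= G -> L <= advance G.
Proof. by move=> LG; have := advance_gt LG; lia. Qed.

Lemma advance_mono G G' : L <= G -> G <= G' -> advance G <= advance G'.
Proof.
move=> LG h; have h1 := near_far LG; have h2 := near_ge LG.
by apply: far_mono; [lia|apply: far_mono => //; apply: near_mono].
Qed.

Lemma advanceS G : L <= G -> advance (G + L) = advance G + L.
Proof.
move=> LG; have h1 := near_far LG; have h2 := near_ge LG.
by rewrite /advance nearS farS // farS //; lia.
Qed.

Lemma advance_tail G : L <= G -> is_tail (advance G).
Proof. by move=> LG; apply: far_tail; have := near_far LG; have := near_ge LG; lia. Qed.

Opaque advance.

Lemma iter_advance_ge k G : L <= G -> G <= iter k advance G.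
Proof.
move=> LG; elim: k => //= k IH.
by have := @advance_gt (iter k advance G); lia.
Qed.

Lemma iter_advance_mono k G G' : L <= G -> G <= G' ->
  iter k advance G <= iter k advance G'.
Proof.
move=> LG h; elim: k => [|k IH]; first exact: h.
by rewrite !iterS; apply: advance_mono IH; have := iter_advance_ge k LG; lia.
Qed.

Lemma iter_advanceS k G : L <= G -> iter k advance (G + L) = iter k advance G + L.
Proof.
move=> LG; elim: k => //= k ->; rewrite advanceS //.
by have := iter_advance_ge k LG; lia.
Qed.

Lemma iter_advanceSn k m G : L <= G ->
  iter k advance (G + m * L) = iter k advance G + m * L.
Proof.
move=> LG; elim: m => [|m IH]; first by rewrite !addn0.
by rewrite mulSnr !addnA iter_advanceS ?IH //; lia.
Qed.

Lemma iter_advance_tail k G : L <= G -> is_tail G -> is_tail (iter k advance G).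
Proof.
move=> LG tG; case: k => //= k; apply: advance_tail.
by have := iter_advance_ge k LG; lia.
Qed.

Lemma iter_advance_leq j k G : L <= G -> j <= k -> iter j advance G <= iter k advance G.
Proof.
move=> LG /subnK <-; rewrite iterD; apply: iter_advance_ge.
by have := iter_advance_ge j LG; lia.
Qed.
End Sweep.
Global Opaque far near advance.

(** * Lower bound *)

Section LowerBound.
Variables (n : nat) (F : arc_model n).
Local Notation L := n.*2.
Local Notation copy := (copy F).
Local Notation len := (len F).
Local Notation touch := (touch F).
Local Notation far := (far F).
Local Notation near := (near F).
Local Notation advance := (advance F).
Implicit Types (u v w x y : 'I_n) (P Q G : nat) (p q : 'I_n * 'I_n).

(* The arc of [x] contains the head of [y]; the union of the two arcs is then
   the image of [P, P + span x y] for every copy [P] of [x]. *)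
Definition linked x y := cw L (hd F x) (hd F y) <= len x.
Definition span x y := maxn (len x) (cw L (hd F x) (hd F y) + len y).

Lemma span_lt x y : span x y < 2 * L.
Proof.
have := len_lt F x; have := len_lt F y; have := cw_lt (hd F x) (hd F y) (L_gt0 F).
by rewrite /span; arith.
Qed.

Lemma copy_linked x y P : copy x P -> copy y (P + cw L (hd F x) (hd F y)).
Proof.
move=> cP; have L0 := L_gt0 F; have [Q /andP[PQ QP] cQ] := copy_in F y P.
by rewrite (cw_copy cP cQ) // subnKC.
Qed.

Lemma touch_linked x y : touch x y -> linked x y || linked y x.
Proof.
case/touchE=> P [Q] [cP cQ h1 h2]; have := len_lt F x; have := len_lt F y => ly lx.
rewrite /linked; case: (leqP P Q) => h.
  by rewrite (cw_copy cP cQ) //; arith.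
by rewrite orbC (cw_copy cQ cP); arith.
Qed.

Definition hits p u := touch u p.1 || touch u p.2.

Lemma hull_hits x y u P Q : linked x y -> copy x P -> copy u Q ->
  Q <= P + span x y -> P <= Q + len u -> hits (x, y) u.
Proof.
move=> l cP cQ h1 h2; have cy := copy_linked y cP; rewrite /hits /=.
move: l h1 cy; rewrite /linked /span; set d := cw _ _ _ => l h1 cy.
case: (leqP Q (P + len x)) => h3; first by rewrite (touch_of cQ cP).
by rewrite orbC (touch_of cQ cy) //; arith.
Qed.

Lemma hits_at x y u P : linked x y -> hits (x, y) u -> copy x P -> L <= P ->
  exists Q, [/\ copy u Q, Q <= P + span x y & P <= Q + len u].
Proof.
move=> l h cP LP; have cy := copy_linked y cP.
move: l cy; rewrite /linked /span; set d := cw _ _ _ => l cy.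
case/orP: h => /= t; rewrite touchC in t.
  by have [Q [cQ h1 h2]] := touch_at t cP LP; exists Q; split=> //; arith.
have LPd : L <= P + d by arith.
by have [Q [cQ h1 h2]] := touch_at t cy LPd; exists Q; split=> //; arith.
Qed.

Lemma hits_hull x y u Q : linked x y -> hits (x, y) u -> copy u Q -> 2 * L <= Q ->
  exists P, [/\ copy x P, Q <= P + span x y & P <= Q + len u].
Proof.
move=> l h cQ LQ; have lx := len_lt F x; have ly := len_lt F y; have L0 := L_gt0 F.
have LQ' : L <= Q by arith.
case/orP: h => /= t; have [P [cP h1 h2]] := touch_at t cQ LQ'.
  by exists P; split=> //; rewrite /span; arith.
have [P' /andP[hP1 hP2] cP'] := copy_in F x (P.+1 - L).
have ed : cw L (hd F x) (hd F y) = P - P' by rewrite (cw_copy cP' cP) //; arith.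
by move: l; rewrite /linked /span ed => l; exists P'; split=> //; arith.
Qed.

(** The first [far] passes the tail of [x], hence the head of [y], so the second passes the tail of
    [y]. Two applications overtake any linked pair that starts by [G]. *)
Lemma far_far_span x y P G : linked x y -> copy x P -> L <= P -> P <= G ->
  P + span x y <= far (far G).
Proof.
move=> l cP LP PG; have LG := leq_trans LP PG.
have h := far_max LG cP PG; have cy := copy_linked y cP.
move: l cy; rewrite /linked /span; set d := cw _ _ _ => l cy.
have LG' : L <= far G by arith.
have h1 : P + d + len y <= far (far G) by apply: far_max => //; arith.
by have := far_ge LG' (far_tail F LG); arith.
Qed.

Section Remaining.
Variables (x0 y0 : 'I_n) (A : nat).
Hypothesis LA : 3 * L <= A.
Local Notation B := (A + span x0 y0).

(** The bounded range of [a] makes this decidable, so that a list of pairs can be searched for an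
    enclosing one. *)
Definition encloses p := [exists a : 'I_A.+1, copy p.1 a && (B <= a + span p.1 p.2)].

Lemma enclosesP p a : copy p.1 a -> a <= A -> B <= a + span p.1 p.2 -> encloses p.
Proof.
move=> ca aA Ba; have aA1 : a < A.+1 by [].
by apply/existsP; exists (Ordinal aA1); rewrite /= ca Ba.
Qed.

Lemma sweep_step p G v P u Q : linked p.1 p.2 -> ~~ encloses p -> B <= G ->
  copy v P -> G < P -> P + len v = near G -> near G < A + L -> hits p v ->
  copy u Q -> advance G < Q -> Q + len u < A + L -> ~~ hits p u.
Proof.
case: p => x y /= l nenc BG cP GP eN NA hv cQ GQ QA; apply/negP => hu.
have L0 := L_gt0 F; have LG : L <= G by arith.
have GaG := advance_gt F LG.
have [|a [ca a1 a2]] := hits_hull l hv cP; first by arith.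
have [|a' [ca' a1' a2']] := hits_hull l hu cQ; first by arith.
have enc b : copy x b -> b <= A -> B <= b + span x y -> False.
  by move=> cb bA Bb; case/negP: nenc; apply: (enclosesP (a := b)).
(* Distinct copies of the hull are a turn apart: the earlier one starts before [A] and still reaches
   past [B], so it encloses. A common copy starts by [near G] and is overtaken by [advance G]. *)
case: (ltngtP a a') => h.
- by have h' := copy_gap ca ca' h; apply: (enc a) => //; arith.
- by have h' := copy_gap ca' ca h; apply: (enc a') => //; arith.
have La : L <= a by have := span_lt x y; arith.
have : a + span x y <= advance G by apply: far_far_span => //; arith.
by arith.
Qed.

(** Each greedy step spends a pair hitting the vertex served at [near G]. By [sweep_step] that pair
    hits nothing that remains, so it is removed from [D]; with no pair left, no tail can remain
    before [A + L]. *)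
Lemma sweep_pairs (D : seq ('I_n * 'I_n)) G :
  all (fun p => linked p.1 p.2) D -> all (fun p => ~~ encloses p) D -> B <= G ->
  (forall u P, copy u P -> G < P -> P + len u < A + L -> has (hits^~ u) D) ->
  A + L <= near (iter (size D) advance G).
Proof.
have [m] := ubnP (size D); elim: m => // m IH in D G *.
rewrite ltnS => szD lD eD BG inv; have LG : L <= G by arith.
have Ga := advance_gt F LG.
case: (leqP (A + L) (near G)) => [h|NA].
  by apply: leq_trans h (near_mono _ _); apply: iter_advance_ge.
have [v [P [cP /andP[GP _] eN]]] := near_attained F G.
have /hasP[p pD hp] : has (hits^~ v) D by apply: (inv v P cP GP); rewrite eN.
have szr := size_rem pD; have D0 : 0 < size D by case: (D) pD.
have eszD : size D = (size (rem p D)).+1 by rewrite szr prednK.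
rewrite eszD.
have lp := allP lD p pD; have ep := allP eD p pD.
rewrite iterSr; apply: IH.
- by rewrite -ltnS -eszD.
- by apply/allP => q /mem_rem; apply: (allP lD).
- by apply/allP => q /mem_rem; apply: (allP eD).
- by arith.
move=> u Q cQ GQ QA; have /hasP[q qD hq] : has (hits^~ u) D by apply: (inv u Q cQ _ QA); arith.
have [eqp|neq] := eqVneq q p.
  by have := sweep_step lp ep BG cP GP eN NA hp cQ GQ QA; rewrite -eqp hq.
by apply/hasP; exists q => //; move: qD; rewrite (perm_mem (perm_to_rem pD)) inE (negPf neq).
Qed.
End Remaining.

Lemma advance_turn (D : seq ('I_n * 'I_n)) :
  D != [::] -> all (fun p => linked p.1 p.2) D -> (forall u, has (hits^~ u) D) ->
  exists2 G, L <= G & G + L <= iter (size D) advance G.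
Proof.
have [m] := ubnP (size D); elim: m => // m IH in D *.
case: D => //= -[x0 y0] D szD _ /= /andP[l0 lD] dom; have L0 := L_gt0 F.
have [A /andP[hA _] cA] := copy_in F x0 (3 * L).
have LA : L <= A by arith.
have [/hasP[p pD /existsP[a /andP[ca Ba]]]|nenc] := boolP (has (encloses x0 y0 A) D).
  have domD u : has (hits^~ u) D.
    case/orP: (dom u) => // /(hits_at l0)/(_ cA LA)[Q [cQ h1 h2]].
    apply/hasP; exists p => //; case: p pD ca Ba => x y pD /= ca Ba.
    apply: (hull_hits _ ca cQ); [exact: (allP lD _ pD)|arith|].
    by have := ltn_ord a; arith.
  have [//||//|//|G LG hG] := IH D; first by case: (D) pD.
  exists G => //=; apply: leq_trans hG _.
  by rewrite -iterS; apply: iter_advance_leq.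
exists (A + span x0 y0) => /=; first by arith.
have aN : A + L <= near (iter (size D) advance (A + span x0 y0)).
  apply: (sweep_pairs (y0 := y0) hA) => //; first by rewrite all_predC.
  move=> u P cP GP PA; case/orP: (dom u) => //.
  move/(hits_hull l0)/(_ cP) => [|a [ca h1 h2]]; first by arith.
  case: (ltngtP a A) => h.
  - by have := copy_gap ca cA h; arith.
  - by have := copy_gap cA ca h; arith.
  by arith.
(* The pair [(x0, y0)] pays for the last step: its next copy starts at [A + L], and one more
   [advance] passes its end, a full turn beyond the starting frontier. *)
rewrite -addnA (addnC _ L) addnA.
by apply: far_far_span l0 (copyS cA) _ aN; arith.
Qed.

Lemma paired_dominating_list (S : {set 'I_n}) : paired_dominating (adj F) S ->
  exists D : seq ('I_n * 'I_n), [/\ (size D).*2 = #|S|,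
    all (fun p => linked p.1 p.2) D & forall u, has (hits^~ u) D].
Proof.
case=> dom [M [part edges]].
have /fin_all_exists[g gP] (B : {set 'I_n}) : exists p, B \in M ->
    [/\ linked p.1 p.2, B = [set p.1; p.2] & #|B| = 2].
  have [BM|] := boolP (B \in M); last first.
    by exists (vfirst F, vfirst F).
  have [x [y [xy exy ->]]] := edges B BM.
  have c2 : #|[set x; y]| = 2 by rewrite cards2 xy.
  case/orP: (touch_linked (andP exy).2) => l; [by exists (x, y)|exists (y, x)].
  by split=> //=; rewrite setUC.
exists [seq g B | B <- enum M]; split.
- rewrite size_map -cardE (card_uniform_partition _ part (n := 2)) ?muln2 //.
  by move=> B /gP[].
- by apply/allP => p /mapP[B]; rewrite mem_enum => /gP[l _ _] ->.
move=> u; have [x xS t] : exists2 x, x \in S & touch u x.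
  have [uS|/dom[x xS /andP[_ t]]] := boolP (u \in S); last by exists x.
  by exists u => //; exact: touchxx.
have : x \in cover M by rewrite (cover_partition part).
case/bigcupP => B BM; have [_ eB _] := gP B BM; rewrite eB => xB.
apply/hasP; exists (g B); first by apply: map_f; rewrite mem_enum.
by rewrite /hits; case/set2P: xB => <-; rewrite t ?orbT.
Qed.
End LowerBound.

(** * Periodic orbits and the choice of the starting arc *)

Section Orbit.
Variables (n : nat) (F : arc_model n).
Local Notation L := n.*2.
Local Notation copy := (copy F).
Local Notation len := (len F).
Local Notation touch := (touch F).
Local Notation far := (far F).
Local Notation near := (near F).
Local Notation advance := (advance F).
Implicit Types (u v w x y : 'I_n) (P Q G T : nat).

Lemma tail_label T : is_tail F T -> exists u, T %% L == tl F u.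
Proof. by case=> u [P [cP <-]]; exists u; rewrite (copy_tl cP). Qed.

(** Pigeonhole: the first [n + 1] frontiers are tails, there are only [n] tail labels, and positions
    with the same label differ by whole turns. *)
Lemma orbit_repeats T : L <= T -> is_tail F T ->
  exists i a b, [/\ i <= n, 0 < a &
    iter a advance (iter i advance T) = iter i advance T + b * L].
Proof.
move=> LT tT.
have /fin_all_exists[g gP] (i : 'I_n.+1) :
    exists u, iter i advance T %% L == tl F u.
  exact/tail_label/iter_advance_tail.
have /injectivePn[i [j ij eg]] : ~~ injectiveb g.
  apply/negP => /injectiveP /leq_card; rewrite !card_ord ltnn //.
wlog lt : i j ij eg / i < j => [th|].
  case: (ltngtP i j) => h; [exact: (th i j)|by apply: (th j i)=> //; rewrite eq_sym|].
  by case/eqP: ij; apply: val_inj.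
set Ti := iter i advance T; set Tj := iter j advance T.
have LTi : L <= Ti by apply: leq_trans LT (iter_advance_ge _ _ LT).
have TiTj : Ti <= Tj by apply: iter_advance_leq => //; exact: ltnW.
have m0 : (Tj - Ti) %% L = 0.
  by apply: modB0 => //; rewrite (eqP (gP i)) (eqP (gP j)) eg.
exists i, (j - i), ((Tj - Ti) %/ L); split; [by rewrite -ltnS|by rewrite subn_gt0|].
rewrite -iterD subnK; last exact: ltnW.
by have := divn_eq (Tj - Ti) L; rewrite m0 addn0 => <-; rewrite subnKC.
Qed.

(* [fun x => iter k advance x - L] is monotone and, being bounded below along
   any orbit by the hypothesis on [G], cannot decrease at a periodic point. *)
Lemma orbit_turn k G T l : L <= G -> G + L <= iter k advance G ->
  L <= T -> is_tail F T -> n <= l ->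
  iter l advance T + L <= iter k advance (iter l advance T).
Proof.
move=> LG hG LT tT nl; have L0 := L_gt0 F.
have [i [a [b [ile a0 per]]]] := orbit_repeats LT tT.
have Li : L <= iter i advance T by apply: leq_trans LT (iter_advance_ge _ _ LT).
set x := iter l advance T.
have Lx : L <= x by apply: leq_trans LT (iter_advance_ge _ _ LT).
have perx : iter a advance x = x + b * L.
  rewrite /x -(@subnK i l) ?iterD; last exact: leq_trans ile nl.
  by rewrite -iterD addnC iterD per iter_advanceSn.
have pern m : iter (m * a) advance x = x + m * b * L.
  elim: m => [|m IH]; first by rewrite mul0n addn0.
  by rewrite mulSn iterD IH iter_advanceSn // perx mulSn mulnDl addnA.
rewrite leqNgt; apply/negP => lt.
(* A failure at [x] repeats itself, [k] steps always gaining less than a turn per round. With [a]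
   rounds this puts the mean speed [b / a] of the periodic orbit below [1 / k]. *)
have dec j : iter (j.+1 * k) advance x < x + j.+1 * L.
  elim: j => [|j IH]; first by rewrite !mul1n.
  rewrite mulSn iterD.
  have h : L <= iter (j.+1 * k) advance x by apply: leq_trans Lx (iter_advance_ge _ _ Lx).
  have := iter_advance_mono F k h (ltnW IH); rewrite iter_advanceSn // [j.+2 * L]mulSn.
  by arith.
have inc j : G + j * L <= iter (j * k) advance G.
  elim: j => [|j IH]; first by rewrite addn0.
  rewrite [j.+1 * k]mulSn [j.+1 * L]mulSn iterD.
  have h : L <= G + j * L by apply: leq_trans LG (leq_addr _ _).
  by have := iter_advance_mono F k h IH; rewrite iter_advanceSn //; arith.
have kba : k * b < a.
  have := dec a.-1; rewrite prednK // mulnC pern ltn_add2l ltn_mul2r.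
  by case/andP.
have Gx : G <= x + G * L.
  by apply: leq_trans (leq_addl _ _); apply: leq_pmulr.
(* The orbit of [G] has speed at least [1 / k] and starts behind [x + G * L]. After [t * a * k]
   steps the latter has lost at least [t] turns, more than its initial lead. *)
pose t := (x + G).+1.
have := leq_trans (inc (t * a)) (iter_advance_mono F (t * a * k) LG Gx).
rewrite iter_advanceSn // (_ : t * a * k = t * k * a) ?pern; last by rewrite mulnAC.
apply/negP; rewrite -ltnNge.
have h : t * k * b * L + t * L <= t * a * L.
  by rewrite -mulnDl leq_mul2r -mulnA -mulnSr leq_mul2l kba !orbT.
have h2 : t <= t * L by apply: leq_pmulr.
have h3 : t * L = x * L + G * L + L by rewrite /t mulSn mulnDl; arith.
have h4 : x <= x * L by apply: leq_pmulr.
by arith.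
Qed.
End Orbit.

Section Selection.
Variables (n : nat) (F : arc_model n).
Local Notation L := n.*2.
Local Notation copy := (copy F).
Local Notation len := (len F).
Local Notation touch := (touch F).
Local Notation far := (far F).
Local Notation near := (near F).
Local Notation advance := (advance F).
Implicit Types (u v w x y : 'I_n) (P Q G T : nat).

(** If [c < near T], the arc ending at [c] starts by [T], so the arc ending at [T] already meets it:
    the previous greedy pair is the one to use. *)
Definition crossing_tail T c :=
  if c < near T then T else if c <= far (near T) then far (near T) else advance T.

(* Whichever of the pairs of the sweep gets past the tail [c] of the first
   vertex, one of its vertices is contained in a maximal arc meeting the first
   one. *)
Lemma crossing k G c x P w R : 2 * L <= G ->
  let T := advance G in
  c %% L = tl F (vfirst F) -> T < c <= advance T -> 0 < k ->
  G + L <= iter k advance G -> T + L <= iter k advance T ->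
  copy x P -> P + len x = crossing_tail T c ->
  copy w R -> R <= P -> R + len w = far P ->
  [/\ w \in start_vertices F, R <= c <= far (R + len w), c < near (R + len w) &
    R + L <= near (iter k.-1 advance (far (R + len w))) \/
    forall a, a <= R ->
      (forall u Q, copy u Q -> Q <= R <= Q + len u -> a <= Q) ->
      a + L <= near (iter k.-1 advance (R + len w))].
Proof.
move=> LG T cmod /andP[Tc cT] k0 hG hT cP eP cR RP eR.
have L0 := L_gt0 F; have lx := len_lt F x; have lw := len_lt F w.
have LG1 : L <= G by arith.
have GT := advance_gt F LG1; have LT : L <= T by rewrite /T; arith.
have nT := near_gt F T; have nG := near_gt F G.
have nfT := near_far F LT; have nfG := near_far F LG1.
have faT := far_advance F LT; have faG := far_advance F LG1.
have TtP : T <= P + len x by rewrite eP /crossing_tail; case: ifP => _; [|case: ifP]; arith.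
have LP : L <= P by rewrite -/T in GT; arith.
have tw : P + len x <= R + len w by rewrite eR; exact: far_max.
have LR : L <= R + len w by arith.
have ltw : R + len w < near (R + len w) by have := near_gt F (R + len w); arith.
have tail_w : is_tail F (R + len w) by exists w, R.
have ffw := far_ge LR tail_w.
have turn T0 A B : L <= T0 -> T0 + L <= iter k advance T0 -> A <= near T0 ->
    advance T0 <= B -> A + L <= near (iter k.-1 advance B).
  move=> LT0 h AT0 TB; apply: (@leq_trans (near T0 + L)); first by rewrite leq_add2r.
  rewrite -nearS; apply: near_mono; apply: leq_trans h _.
  rewrite -(prednK k0) iterSr.
  exact: iter_advance_mono (advance_ge F LT0) TB.
(* Here [x] ends the pair added from [T0], and [a] is a left end as far back as all heads of arcs
   over [R]. If [R] is beyond [near T0], the first arc of the pair starts by [near T0] and lies over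
   [R], which puts [a] at or before [near T0]. *)
have headside T0 : L <= T0 -> T0 + L <= iter k advance T0 ->
    P + len x = advance T0 -> forall a, a <= R ->
    (forall u Q, copy u Q -> Q <= R <= Q + len u -> a <= Q) ->
    a + L <= near (iter k.-1 advance (R + len w)).
  move=> LT0 h eT0 a aR ha; apply: (turn T0) => //; last by rewrite -eT0.
  case: (leqP R (near T0)) => hR; first exact: leq_trans hR.
  have LfT : L <= far (near T0) by have := near_far F LT0; have := near_gt F T0; arith.
  have [u [Q [cQ /andP[Q1 _] eQ]]] := far_attained F (near_ge F LT0).
  apply: leq_trans (Q1); apply: ha cQ _; rewrite eQ.
  have PfT := far_copy_le LfT cP eT0.
  by apply/andP; split; [exact: ltnW (leq_ltn_trans Q1 hR)|exact: leq_trans RP PfT].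
have Lc : L <= c by arith.
have [S cS eS] := tail_copy cmod Lc.
(* An arc containing that of [w] starts by [P], so it cannot end after [far P]; the tails agree and
   the arcs are equal. *)
have finish : R <= c -> S <= R + len w -> w \in start_vertices F.
  move=> Rc Sw; have t : touch (vfirst F) w by apply: (touch_of cS cR); arith.
  rewrite !inE eq_sym; apply/andP; split.
    by rewrite adjE t andbT; case: eqP.
  apply/forallP => u; apply/implyP => uw; apply/negP => /sub_arcP.
  have [Q /andP[Q1 Q2] cQ] := copy_in F u (R.+1 - L).
  have [QR RQ] : Q <= R /\ R < Q + L by arith.
  rewrite (cw_copy cQ cR QR RQ) => sub; case/eqP: uw.
  have h : Q + len u <= far P by apply: far_max => //; arith.
  by apply: (tail_inj cQ cR); congr modn; arith.
move: (eP); rewrite /crossing_tail; case: (ltnP c (near T)) => h1.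
  move=> eT; have ST : S <= T.
    by rewrite leqNgt; apply/negP => /(near_min cS); arith.
  have cR2 : R <= c by arith.
  have Sw : S <= R + len w by arith.
  have cf := far_max LR cS Sw; rewrite eS in cf.
  split; [exact: finish|by rewrite cR2| |by right; apply: (headside G)].
  by apply: leq_trans h1 (near_mono _ _); arith.
have LnT : L <= near T by arith.
case: (leqP c (far (near T))) => h2 eT.
  (* Now [x] is the first vertex of its pair: [far] from the tail of [w] already reaches
     [advance T], so the tail start keeps up. *)
  have Pn := far_copy_le LnT cP eT.
  split; [by apply: finish; arith|by apply/andP; split; arith|by arith|left].
  apply: (turn T) => //; first by arith.
  by have : far (far (near T)) <= far (R + len w) by apply: far_mono; arith.
have LfT : L <= far (near T) by arith.
have Pn := far_copy_le LfT cP eT.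
by split; [by apply: finish; arith|by apply/andP; split; arith|by arith|
  by right; apply: (headside T)].
Qed.
End Selection.

(** * Runs of Algorithm 2 *)

Section Run.
Variables (n : nat) (F : arc_model n).
Local Notation L := n.*2.
Local Notation copy := (copy F).
Local Notation len := (len F).
Local Notation touch := (touch F).
Local Notation far := (far F).
Local Notation near := (near F).
Local Notation advance := (advance F).
Local Notation reached := (cl_nbhd_set (adj F)).
Implicit Types (u v w x y : 'I_n) (P Q G T A : nat) (X Y : {set 'I_n}).

Lemma reachedP X u : reflect (exists2 x, x \in X & touch u x) (u \in reached X).
Proof.
apply: (iffP bigcupP) => -[x xX h]; exists x => //.
  by move: h; rewrite !inE adjC adjE; case: eqP => [-> _|//]; exact: touchxx.
by rewrite !inE adjC adjE h andbT; case: eqP.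
Qed.

Lemma reachedS X Y u : X \subset Y -> u \in reached X -> u \in reached Y.
Proof.
by move=> /subsetP XY /reachedP[x xX t]; apply/reachedP; exists x => //; exact: XY.
Qed.

Lemma dominatingP X : dominating (adj F) X <-> forall u, u \in reached X.
Proof.
split=> [d u|h u uX].
  apply/reachedP; have [uX|/d[x xX /andP[_ t]]] := boolP (u \in X); last by exists x.
  by exists u => //; exact: touchxx.
have /reachedP[x xX t] := h u; exists x => //.
by rewrite adjE t andbT; apply: contraNneq uX => ->.
Qed.

Lemma dominating_dec X :
  dominating (adj F) X \/ exists2 u, u \notin reached X & ~ dominating (adj F) X.
Proof.
have [/forallP h|] := boolP [forall u, u \in reached X]; first by left; apply/dominatingP.
rewrite negb_forall => /existsP[u uX]; right; exists u => //.
by move/dominatingP/(_ u) => h; rewrite h in uX.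
Qed.

Lemma next_exists X u : u \notin reached X -> exists v, next_undominated F X v.
Proof.
move=> uX.
have [v vX vmin] := arg_minnP (P := [pred v | v \notin reached X])
  (fun v => cw L (tl F (vfirst F)) (tl F v)) uX.
by exists v; split.
Qed.

Lemma in_tail_nbrs v u :
  (u \in tail_nbrs F v) = adj F v u && (endpoint (tl F v) \in arc F u).
Proof. by rewrite in_set; congr andb; rewrite in_set. Qed.

Lemma in_head_nbrs v u :
  (u \in head_nbrs F v) = adj F v u && (endpoint (hd F v) \in arc F u).
Proof. by rewrite in_set; congr andb; rewrite in_set. Qed.

(** Every other arc over t(v) is a neighbour of [v], so the cyclic maximum over neighbours is [far]
    on the line. In the default case [v] alone lies over t(v), and [far] stands still. *)
Lemma tail_partner_far v z P : tail_partner F v z -> copy v P -> L <= P ->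
  adj F v z /\
  ((exists Q, [/\ copy z Q, Q <= P + len v & Q + len z = far (P + len v)]) \/
   far (P + len v) = P + len v /\
   forall u Q, copy u Q -> Q <= P + len v <= Q + len u -> u = v).
Proof.
move=> tp cP LP; have [t tE] : exists t, t = P + len v by exists (P + len v).
rewrite -tE; have Lt : L <= t by arith.
have L0 := L_gt0 F; have lv := len_lt F v.
have tmod := copy_tl cP; rewrite -tE in tmod.
have contains u Q : copy u Q -> Q <= t <= Q + len u -> u != v -> u \in tail_nbrs F v.
  move=> cQ /andP[Qt tQ] uv; have lu := len_lt F u.
  rewrite in_tail_nbrs adjE eq_sym uv /= (endpoint_in cQ tmod) ?tQ ?andbT; last by arith.
  by apply: (touch_of cP cQ); arith.
move: tp; rewrite /tail_partner; have [n0|[y yN]] := set_0Vmem (tail_nbrs F v).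
  rewrite n0 eqxx inE => azv; split=> //; right.
  have only u Q : copy u Q -> Q <= t <= Q + len u -> u = v.
    by move=> cQ h; apply/eqP; apply/negP => /negP/(contains _ _ cQ h); rewrite n0 inE.
  split=> //; have [u [Q [cQ /andP[Q1 Q2] eQ]]] := far_attained F Lt.
  have tf : t <= far t by apply: far_ge => //; exists v, P.
  have uv : u = v by apply: only cQ _; rewrite eQ Q1.
  rewrite uv in cQ eQ; rewrite -eQ; case: (ltngtP P Q) => h.
  - by have := copy_gap cP cQ h; arith.
  - by have := copy_gap cQ cP h; arith.
  by rewrite tE h.
case: eqP => [e|_]; first by rewrite e inE in yN.
case=> zN zmax; have /andP[azv zt] : adj F v z && (endpoint (tl F v) \in arc F z).
  by move: zN; rewrite in_tail_nbrs.
split=> //; left; have [cQ /andP[Q1 Q2]] := last_copyP F z Lt.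
move: (last_copy _ _ _) cQ Q1 Q2 => Q cQ Q1 Q2.
have tQ : t <= Q + len z by rewrite -(endpoint_in cQ tmod) // Q1.
exists Q; split=> //; apply/eqP; rewrite eqn_leq far_max //=.
have [u [R [cR /andP[R1 R2] eR]]] := far_attained F Lt.
have [uv|uv] := eqVneq u v.
  suff : far t <= t by arith.
  rewrite -eR uv; rewrite uv in cR; rewrite tE leq_add2r leqNgt; apply/negP => h.
  by have := copy_gap cP cR h; arith.
have tf : t <= far t by apply: leq_trans tQ _; apply: far_max.
have lu := len_lt F u; have lz := len_lt F z.
have uN : u \in tail_nbrs F v by apply: (contains u R) => //; rewrite R1 eR.
have e1 : cw L (tl F v) (tl F u) = far t - t.
  by rewrite -tmod -(copy_tl cR) eR cw_sub //; arith.
have e2 : cw L (tl F v) (tl F z) = Q + len z - t.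
  by rewrite -tmod -(copy_tl cQ) cw_sub //; arith.
by have := zmax u uN; rewrite e1 e2; arith.
Qed.

(** [A] is the leftmost head among the arcs over h(v). If [v] is the only such arc then [A = P],
    whichever neighbour serves as head partner. *)
Lemma head_partner_near v z P : head_partner F v z -> copy v P -> L <= P ->
  adj F v z /\
  exists A, [/\ A <= P, forall u Q, copy u Q -> Q <= P <= Q + len u -> A <= Q &
    A = P \/ copy z A /\ P <= A + len z].
Proof.
move=> hp cP LP; have L0 := L_gt0 F; have lv := len_lt F v.
have Pmod := eqP cP.
have contains u Q : copy u Q -> Q <= P <= Q + len u -> u != v -> u \in head_nbrs F v.
  move=> cQ /andP[Qt tQ] uv; have lu := len_lt F u.
  rewrite in_head_nbrs adjE eq_sym uv /= (endpoint_in cQ Pmod) ?tQ ?andbT; last by arith.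
  by apply: (touch_of cP cQ); arith.
have self Q : copy v Q -> Q <= P <= Q + len v -> Q = P.
  move=> cQ /andP[Q1 Q2]; case: (ltngtP P Q) => h //; first by arith.
  by have := copy_gap cQ cP h; arith.
move: hp; rewrite /head_partner; have [n0|[y yN]] := set_0Vmem (head_nbrs F v).
  rewrite n0 eqxx inE => azv; split=> //; exists P; split=> //; last by left.
  move=> u Q cQ h; have [uv|/(contains _ _ cQ h)] := eqVneq u v; last by rewrite n0 inE.
  by rewrite uv in cQ h; rewrite (self Q).
case: eqP => [e|_]; first by rewrite e inE in yN.
case=> zN zmax; have /andP[azv zt] : adj F v z && (endpoint (hd F v) \in arc F z).
  by move: zN; rewrite in_head_nbrs.
split=> //; have [cQ /andP[Q1 Q2]] := last_copyP F z LP.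
move: (last_copy _ _ _) cQ Q1 Q2 => Q cQ Q1 Q2.
have tQ : P <= Q + len z by rewrite -(endpoint_in cQ Pmod) // Q1.
exists Q; split=> //; last by right.
move=> u R cR h; have [uv|uv] := eqVneq u v.
  by rewrite uv in cR h; rewrite (self R).
have lu := len_lt F u.
case/andP: (h) => h1 h2; have RL : P < R + L by arith.
have := zmax u (contains u R cR h uv).
by rewrite (cw_copy cR cP) // (cw_copy cQ cP) //; arith.
Qed.

(** The invariant for upper bounds: [[A, G]] is taken care of, so an undominated arc fits into the
    gap before the next copy of [A]. *)
Definition confined X A G := forall u, u \notin reached X ->
  exists P, [/\ copy u P, G < P & P + len u < A + L].

Lemma cover_confined X A G : L <= A -> A <= G ->
  (forall u P, copy u P -> P <= G -> A <= P + len u -> u \in reached X) ->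
  confined X A G.
Proof.
move=> LA AG h u uX; have L0 := L_gt0 F.
have [P /andP[P1 P2] cP] := copy_in F u A.
have GP : G < P.
  by rewrite ltnNge; apply/negP => PG; case/negP: uX; apply: (h _ _ cP); arith.
exists P; split=> //; rewrite ltnNge; apply/negP => AP.
have LP : L <= P by arith.
by case/negP: uX; apply: (h _ _ (copyB cP LP)); arith.
Qed.

Section Step.
Variables (A G c : nat).
Hypotheses (LG : 2 * L <= G) (cmod : c %% L = tl F (vfirst F)).
Hypotheses (Ac : A <= c) (cN : c <= near G).

(** Since [A <= c <= near G], the tails of undominated vertices lie in one turn starting at [c],
    where the cyclic order from t(v_1) is the order of the line. *)
Lemma next_undominated_copy X v : confined X A G -> next_undominated F X v ->
  exists P, [/\ copy v P, G < P, P + len v < A + L &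
    forall u Q, u \notin reached X -> copy u Q -> G < Q -> P + len v <= Q + len u].
Proof.
move=> conf [vX vmin]; have [P [cP GP PA]] := conf v vX; exists P; split=> //.
move=> u Q uX cQ GQ; have [R [cR GR RA]] := conf u uX.
have nP := near_min cP GP; have nR := near_min cR GR.
have RQ : R <= Q.
  by rewrite leqNgt; apply/negP => /(copy_gap cQ cR); have := near_min cQ GQ; arith.
have := vmin u uX; rewrite -cmod -(copy_tl cP) -(copy_tl cR) !cw_sub; arith.
Qed.

(** Both branches of the loop put [pt v] and [pt (pt v)] into the new set. The tail served is at
    [near G] or later, so by monotonicity these two reach at least [advance G]. *)
Lemma confined_step X X' v a b : confined X A G -> next_undominated F X v ->
  tail_partner F v a -> tail_partner F a b ->
  X \subset X' -> a \in X' -> b \in X' -> confined X' A (advance G).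
Proof.
move=> conf nv va ab sX aX bX u uX'.
have uX : u \notin reached X by apply: contra uX'; exact: reachedS.
have [P [cP GP PA]] := conf u uX; exists P; split=> //.
have [R [cR GR RA min]] := next_undominated_copy conf nv.
have RP := min _ _ uX cP GP; have Rn := near_min cR GR.
have nG := near_gt F G.
rewrite ltnNge; apply/negP => Pad; case/negP: uX'.
have LR : L <= R by arith.
have LG1 : L <= G by arith.
have [/andP[_ tva] hva] := tail_partner_far va cR LR.
have rv : v \in reached X' by apply/reachedP; exists a.
have Lf : L <= far (near G) by have := near_far F LG1; arith.
have fR : far (near G) <= far (R + len v) by apply: far_mono => //; arith.
have adv : advance G = far (far (near G)) by [].
case: hva => [[Q [cQ QR eQ]]|[fe only]].
  have [QP|PQ] := leqP P (Q + len a).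
    by apply/reachedP; exists a => //; apply: (touch_of cP cQ); arith.
  have LQ : L <= Q by have := len_lt F a; have := near_far F LG1; arith.
  have [_ hab] := tail_partner_far ab cQ LQ.
  have fQ : far (far (near G)) <= far (Q + len a) by apply: far_mono => //; arith.
  case: hab => [[S [cS SQ eS]]|[fe2 _]]; last by arith.
  by apply/reachedP; exists b => //; apply: (touch_of cP cS); arith.
(* Default partner: [far] does not move from t(v), so a vertex starting by [advance G] lies over
   t(v) and must be [v], which [a] dominates. *)
have [PR|RP'] := leqP P (R + len v).
  by rewrite (only u P cP) // PR RP.
have : far (far (near G)) <= far (far (R + len v)) by apply: far_mono => //; arith.
by rewrite fe fe; arith.
Qed.

End Step.
End Run.

(** * Size and validity of the sets built from one start *)

Section Optimality.
Variables (n : nat) (F : arc_model n) (pt ph : 'I_n -> 'I_n).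
Hypotheses (ptP : forall v, tail_partner F v (pt v))
  (phP : forall v, head_partner F v (ph v)).
Local Notation L := n.*2.
Local Notation copy := (copy F).
Local Notation len := (len F).
Local Notation touch := (touch F).
Local Notation far := (far F).
Local Notation near := (near F).
Local Notation advance := (advance F).
Local Notation reached := (cl_nbhd_set (adj F)).
Local Notation confined := (confined F).
Implicit Types (u v w x y : 'I_n) (P Q R G T A : nat) (X Y : {set 'I_n}).

Lemma pt_adj v : adj F v (pt v).
Proof.
have [P /andP[LP _] cP] := copy_in F v L.
by have [] := tail_partner_far (ptP v) cP LP.
Qed.

Lemma ph_adj v : adj F v (ph v).
Proof.
have [P /andP[LP _] cP] := copy_in F v L.
by have [] := head_partner_near (phP v) cP LP.
Qed.

Definition matched X := exists M, perfect_matching (adj F) X M.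

Lemma matched_pair u v : adj F u v -> matched [set u; v].
Proof.
move=> e; have uv : u != v by case/andP: e.
exists [set [set u; v]]; split; last by move=> B /set1P ->; exists u, v.
rewrite /partition /cover big_set1 eqxx /= trivIset1 /= in_set1.
by apply/eqP => /setP/(_ u); rewrite !inE eqxx.
Qed.

Lemma matchedU X u v : matched X -> adj F u v -> u \notin X -> v \notin X ->
  matched (X :|: [set u; v]).
Proof.
case=> M [pM eM] e uX vX; have uv : u != v by case/andP: e.
exists ([set u; v] |: M); split.
  rewrite (setUC X); apply: partitionU1 pM _ _.
    by apply/set0Pn; exists u; rewrite !inE eqxx.
  rewrite -setI_eq0; apply/eqP/setP => z; rewrite !inE.
  by case: eqP => [->|_] /=; [exact: negPf|case: eqP => [->|_] //; exact: negPf].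
by move=> B /setU1P[->|/eM //]; exists u, v.
Qed.

Lemma setU_pair X u v : u != v -> u \notin X -> v \notin X ->
  #|X :|: [set u; v]| = #|X| + 2.
Proof.
move=> uv uX vX; rewrite cardsU cards2 uv (_ : X :&: _ = set0) ?cards0 ?subn0 //.
apply/setP => z; rewrite !inE andbC.
by case: eqP => [->|_] /=; [exact: negPf|case: eqP => [->|_] //; exact: negPf].
Qed.

Definition step X v : {set 'I_n} :=
  if pt (pt v) \in X then X :|: [set v; pt v] else X :|: [set pt v; pt (pt v)].

(** The case distinction of the loop serves the matching: [v] and [pt v] are new because [v] is
    undominated, and [pt (pt v)] is used only when it is new, so a disjoint edge is added each
    time. *)
Lemma stepP X v : v \notin reached X ->
  [/\ X \subset step X v, pt v \in step X v, pt (pt v) \in step X v,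
      #|step X v| = #|X| + 2 & matched X -> matched (step X v)].
Proof.
move=> vX; have e1 := pt_adj v; have e2 := pt_adj (pt v).
have [n1 t1] := andP e1; have [n2 t2] := andP e2.
have vnX : v \notin X.
  by apply: contra vX => h; apply/reachedP; exists v => //; exact: touchxx.
have aX : pt v \notin X.
  by apply: contra vX => h; apply/reachedP; exists (pt v).
rewrite /step; case: ifPn => bX.
  by split; rewrite ?subsetUl ?inE ?bX ?eqxx ?orbT ?setU_pair //; move/matchedU; apply.
by split; rewrite ?subsetUl ?inE ?eqxx ?orbT ?setU_pair //; move/matchedU; apply.
Qed.

Lemma complete_paired X Y : complete F pt X Y -> matched X ->
  paired_dominating (adj F) Y.
Proof.
elim=> {X Y} [X d m //|X v Y _ [vX _] _ IH m]; apply: IH.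
by have [_ _ _ _] := stepP vX; apply.
Qed.

Lemma complete_exists X : exists Y, complete F pt X Y.
Proof.
have [m] := ubnP #|~: X|; elim: m X => // m IH X; rewrite ltnS => Xm.
have [d|[u uX nd]] := dominating_dec F X; first by exists X; apply: complete_stop.
have [v vX] := next_exists uX; have [sX _ _ cX _] := stepP vX.1.
have [Y cY] : exists Y, complete F pt (step X v) Y.
  apply: IH; have := cardsC X; have := cardsC (step X v); arith.
by exists Y; apply: complete_step vX cY.
Qed.

(** Each round adds two vertices and moves the frontier by [advance]. Once [near] of the frontier
    passes [A + L], no arc fits into the gap, so [i] bounds the rounds left. *)
Lemma complete_bound A c X Y : c %% L = tl F (vfirst F) -> A <= c ->
  complete F pt X Y -> forall G i, 2 * L <= G -> c <= near G -> confined X A G ->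
  A + L <= near (iter i advance G) -> #|Y| <= #|X| + i.*2.
Proof.
move=> cmod Ac; elim=> {X Y} [X _ G i *|X v Y _ nv _ IH G i LG cG conf hi].
  exact: leq_addr.
have [P [cP GP PA _]] := next_undominated_copy LG cmod Ac cG conf nv.
have [sX aX bX cX _] := stepP nv.1.
case: i hi => [|i]; first by have /= := near_min cP GP; arith.
rewrite iterSr => hi; have LG1 : L <= G by arith.
have aG := advance_gt F LG1.
have := IH (advance G) i; rewrite -/(step X v) cX => h.
suff : #|Y| <= #|X| + 2 + i.*2 by arith.
apply: h => //; first by arith.
  by apply: leq_trans cG (near_mono _ _); arith.
exact: (confined_step LG cmod Ac cG conf nv (ptP v) (ptP (pt v))).
Qed.

Lemma tail_start_confined w R : 2 * L <= R -> copy w R ->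
  confined [set w; pt w] R (far (R + len w)).
Proof.
move=> LR cR; have L0 := L_gt0 F; have LR1 : L <= R by arith.
have LRw : L <= R + len w by arith.
have tf : R + len w <= far (R + len w) by apply: far_ge => //; exists w, R.
apply: cover_confined => //; first by arith.
move=> u P cP h1 h2; have [h|h] := leqP P (R + len w).
  by apply/reachedP; exists w; rewrite ?inE ?eqxx //; apply: (touch_of cP cR); arith.
have [_ [[Q [cQ h3 h4]]|[h3 _]]] := tail_partner_far (ptP w) cR LR1; last by arith.
by apply/reachedP; exists (pt w); rewrite ?inE ?eqxx ?orbT //; apply: (touch_of cP cQ); arith.
Qed.

Lemma head_start_confined w R : 2 * L <= R -> copy w R -> exists A,
  [/\ R < A + L, A <= R, forall u Q, copy u Q -> Q <= R <= Q + len u -> A <= Q &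
      confined [set w; ph w] A (R + len w)].
Proof.
move=> LR cR; have L0 := L_gt0 F; have LR1 : L <= R by arith.
have [_ [A [AR minA hA]]] := head_partner_near (phP w) cR LR1.
have RA : R < A + L by case: hA => [|[_]]; have := len_lt F (ph w); arith.
exists A; split=> //; apply: cover_confined; [arith|arith|].
move=> u P cP h1 h2; have [h|h] := leqP R (P + len u).
  by apply/reachedP; exists w; rewrite ?inE ?eqxx //; apply: (touch_of cP cR); arith.
case: hA => [|[cA h3]]; first by arith.
by apply/reachedP; exists (ph w); rewrite ?inE ?eqxx ?orbT //; apply: (touch_of cP cA); arith.
Qed.

Lemma crossing_optimal k G c x P w R St Sh : 4 * L <= G ->
  let T := advance G in
  c %% L = tl F (vfirst F) -> T < c <= advance T -> 0 < k ->
  G + L <= iter k advance G -> T + L <= iter k advance T ->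
  copy x P -> P + len x = crossing_tail F T c ->
  copy w R -> R <= P -> R + len w = far P ->
  complete F pt [set w; pt w] St -> complete F pt [set w; ph w] Sh ->
  (#|St| <= k.*2) || (#|Sh| <= k.*2).
Proof.
move=> LG T cmod cT k0 hG hT cP eP cR RP eR cSt cSh.
have LG2 : 2 * L <= G by arith.
have [_ /andP[Rc cf] cN hk] := crossing LG2 cmod cT k0 hG hT cP eP cR RP eR.
have LG1 : L <= G by arith.
have GT : G < T := advance_gt F LG1.
have LT : L <= T by arith.
have TtP : T <= P + len x.
  rewrite eP /crossing_tail.
  have := near_gt F T; have := near_far F LT; have := far_advance F LT.
  by case: ifP => _; [|case: ifP => _]; arith.
have LR : 2 * L <= R.
  have lx := len_lt F x; have lw := len_lt F w.
  have LP : L <= P by arith.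
  by have := far_max LP cP (leqnn P); arith.
have cardp u v : #|[set u; v]| <= 2 by rewrite cards2; case: eqP.
have fin i (X Y : {set 'I_n}) : #|X| <= 2 -> #|Y| <= #|X| + i.*2 -> i = k.-1 -> #|Y| <= k.*2.
  by arith.
have LR1 : L <= R by arith.
have tf : R + len w <= far (R + len w) by apply: far_ge; [arith|exists w, R].
case: hk => [h|h]; apply/orP; [left|right].
  apply: (fin k.-1 _ _ (cardp w (pt w))) => //.
  apply: (complete_bound cmod Rc cSt _ _ (tail_start_confined LR cR)) => //.
    by arith.
  by apply: ltnW; apply: leq_trans cN (near_mono _ _).
have [A [AR1 AR minA conf]] := head_start_confined LR cR.
apply: (fin k.-1 _ _ (cardp w (ph w))) => //.
apply: (complete_bound cmod _ cSh _ _ conf) => //; [arith|arith|exact: ltnW|].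
exact: h.
Qed.
End Optimality.

(** * Minimality and existence of the output *)

Section Correctness.
Variables (n : nat) (F : arc_model n).
Local Notation L := n.*2.
Local Notation copy := (copy F).
Local Notation len := (len F).
Local Notation far := (far F).
Local Notation near := (near F).
Local Notation advance := (advance F).
Implicit Types (u v w x y : 'I_n) (P Q R G T : nat) (S X Y : {set 'I_n}).

Lemma paired_turn S T l : paired_dominating (adj F) S -> L <= T -> is_tail F T ->
  n <= l -> 0 < #|S|./2 /\
  iter l advance T + L <= iter #|S|./2 advance (iter l advance T).
Proof.
move=> /paired_dominating_list[D [<- lD dom]] LT tT nl; rewrite doubleK.
have D0 : D != [::] by apply: contraTneq (dom (vfirst F)) => ->.
split; first by case: (D) D0.
have [G LG hG] := advance_turn D0 lD dom.
exact: orbit_turn hG LT tT nl.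
Qed.

Lemma iter_advance_addn m T : L <= T -> T + m <= iter m advance T.
Proof.
move=> LT; elim: m => [|m IH] /=; first by rewrite addn0.
have h : L <= iter m advance T by arith.
by have := advance_gt F h; arith.
Qed.

Lemma paired_even S : paired_dominating (adj F) S -> #|S| = #|S|./2.*2.
Proof. by case/paired_dominating_list=> D [<- _ _]; rewrite doubleK. Qed.

Section Partners.
Variables pt ph : 'I_n -> 'I_n.
Hypotheses (ptP : forall v, tail_partner F v (pt v))
  (phP : forall v, head_partner F v (ph v)).

Lemma candidate_paired w S : candidate F pt ph w S -> paired_dominating (adj F) S.
Proof.
case=> St [Sh [cSt cSh ->]]; case: ifP => _.
  exact: (complete_paired ptP cSt (matched_pair (pt_adj ptP w))).
exact: (complete_paired ptP cSh (matched_pair (ph_adj phP w))).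
Qed.

Lemma candidate_exists w : exists S, candidate F pt ph w S.
Proof.
have [St cSt] := complete_exists ptP [set w; pt w].
have [Sh cSh] := complete_exists ptP [set w; ph w].
by exists (if #|St| <= #|Sh| then St else Sh), St, Sh.
Qed.

Lemma crossing_candidate S l T c x P w R : 4 * L <= T -> is_tail F T -> n <= l ->
  let Tl := iter l.+1 advance T in
  c %% L = tl F (vfirst F) -> Tl < c <= advance Tl ->
  copy x P -> P + len x = crossing_tail F Tl c ->
  copy w R -> R <= P -> R + len w = far P ->
  paired_dominating (adj F) S ->
  w \in start_vertices F /\
  forall Z, candidate F pt ph w Z -> #|Z| <= #|S|.
Proof.
move=> LT tT nl Tl cmod cT cP eP cR RP eR pS; have L0 := L_gt0 F.
have LT1 : L <= T by arith.
have LG : T <= iter l advance T by apply: iter_advance_ge.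
have [k0 hG] := paired_turn pS LT1 tT nl.
have [_ hT] := paired_turn pS LT1 tT (leqW nl).
split.
  have LG2 : 2 * L <= iter l advance T by arith.
  by have [] := crossing LG2 cmod cT k0 hG hT cP eP cR RP eR.
move=> Z [St [Sh [cSt cSh ->]]]; rewrite [X in _ <= X](paired_even pS).
have LG4 : 4 * L <= iter l advance T by arith.
have := crossing_optimal ptP phP LG4 cmod cT k0 hG hT cP eP cR RP eR cSt cSh.
by case: ifP => h; arith.
Qed.

Lemma optimal_start S : paired_dominating (adj F) S ->
  exists2 w, w \in start_vertices F &
    forall Z, candidate F pt ph w Z -> #|Z| <= #|S|.
Proof.
move=> pS; have L0 := L_gt0 F.
have [P0 cP0 hP0] := tail_in F (vfirst F) (4 * L).
set T := P0 + len (vfirst F) in hP0.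
have tT : is_tail F T by exists (vfirst F), P0.
have LT : L <= T by arith.
set Tn := iter n.+1 advance T.
(* Placing [c] beyond [n + 1] steps ensures that the step crossing it and the step before both start
   where [orbit_turn] applies; [crossing] may need either of them. *)
have [c /andP[Tc _] cmod] := mod_pos F Tn.+1 (tl_lt F (vfirst F)).
have ex : exists m, c <= iter m advance T.
  by exists c; apply: leq_trans (iter_advance_addn c LT); apply: leq_addl.
case: (ex_minnP ex) => m cm mmin.
have nm : n.+1 < m.
  rewrite ltnNge; apply/negP => mn.
  by have := iter_advance_leq F LT mn; rewrite -/Tn; arith.
case: m => [|[|l]] in nm cm mmin *; [by []|by []|].
have cT : iter l.+1 advance T < c <= advance (iter l.+1 advance T).
  rewrite cm andbT ltnNge; apply/negP => /mmin; arith.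
have tx : is_tail F (crossing_tail F (iter l.+1 advance T) c).
  have LTl : L <= iter l.+1 advance T by apply: leq_trans LT (iter_advance_ge _ _ LT).
  rewrite /crossing_tail; case: ifP => _; first exact: iter_advance_tail.
  case: ifP => _; last exact: advance_tail.
  by apply: far_tail; apply: near_ge.
have [x [P [cP eP]]] := tx.
have LP : L <= P.
  have Gl := iter_advance_ge F l.+1 LT; have LTl := leq_trans LT Gl.
  have h1 := near_far F LTl; have h2 := near_gt F (iter l.+1 advance T).
  have h3 := far_advance F LTl; have lx := len_lt F x.
  by move: eP; rewrite /crossing_tail; case: ifP => _; [|case: ifP => _]; arith.
have [w [R [cR /andP[RP _] eR]]] := far_attained F LP.
have LT4 : 4 * L <= T by arith.
have nl : n <= l by arith.
have [wW h] := crossing_candidate LT4 tT nl cmod cT cP eP cR RP eR pS.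
by exists w.
Qed.

Lemma output_optimal S : algorithm_output F pt ph S ->
  min_paired_dominating (adj F) S.
Proof.
case=> Sw [cand [w [wW -> wmin]]]; split; first exact: candidate_paired (cand w wW).
move=> S' pS'; have [w' w'W h] := optimal_start pS'.
by apply: leq_trans (wmin w' w'W) (h _ (cand w' w'W)).
Qed.

(** The sets of the other starts need not be known: those runs halt, and their results, being
    paired-dominating, are no smaller than [S]. *)
Lemma candidate_output w S : w \in start_vertices F -> candidate F pt ph w S ->
  (forall S', paired_dominating (adj F) S' -> #|S| <= #|S'|) ->
  algorithm_output F pt ph S.
Proof.
move=> wW cS Smin.
have [Sw SwP] := fin_all_exists candidate_exists.
exists (fun v => if v == w then S else Sw v); split=> [v _|].
  by case: eqP => [->|_].
exists w; rewrite eqxx; split=> // w' _; apply: Smin.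
by case: eqP => [_|_]; [exact: candidate_paired cS|exact: candidate_paired (SwP w')].
Qed.

Lemma output_exists S : paired_dominating (adj F) S ->
  exists Z, algorithm_output F pt ph Z.
Proof.
move=> pS; have [Sw SwP] := fin_all_exists candidate_exists.
have [w0 w0W _] := optimal_start pS.
have [w wW wmin] := arg_minnP (P := mem (start_vertices F)) (fun w => #|Sw w|) w0W.
by exists (Sw w), Sw; split=> [v _|]; [exact: SwP|exists w].
Qed.
End Partners.
End Correctness.

(** * Exact simulation of a run *)

Section ExactRun.
Variables (n : nat) (F : arc_model n) (pt : 'I_n -> 'I_n).
Local Notation L := n.*2.
Local Notation copy := (copy F).
Local Notation len := (len F).
Local Notation touch := (touch F).
Local Notation far := (far F).
Local Notation near := (near F).
Local Notation advance := (advance F).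
Local Notation reached := (cl_nbhd_set (adj F)).
Local Notation confined := (confined F).
Local Notation step := (step pt).
Implicit Types (u v w x y q : 'I_n) (P Q R G T A : nat) (X Y : {set 'I_n}).

(** The invariant for exactness: with all chosen arcs within [[A, G]], nothing in the gap is
    dominated by accident. *)
Definition inside X A G := forall x, x \in X ->
  exists Q, [/\ copy x Q, A <= Q & Q + len x <= G].

(** Whichever partner [q] is, it may lie over both ends of [w] by going round the circle, so both
    ends are extended. [A + L <= B] is the case where the pair covers the circle. *)
Lemma start_exact w q R A B : L <= A -> copy w R -> R < A + L ->
  (forall u P, copy u P -> P <= R -> R + len w <= P + len u -> u = w) ->
  adj F w q ->
  A = R - (if cw L (hd F q) (hd F w) <= len q then cw L (hd F q) (hd F w) else 0) ->
  B = R + len w +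
    (if cw L (hd F q) (tl F w) <= len q then cw L (tl F w) (tl F q) else 0) ->
  confined [set w; q] A B /\ (A + L <= B \/ inside [set w; q] A B).
Proof.
move=> LA cR RA maxw /andP[wq tq] eA eB; have L0 := L_gt0 F.
have lq := len_lt F q; have lq0 := len_gt0 F q; have lw := len_lt F w.
have AR : A <= R by rewrite eA leq_subr.
have LR : L <= R by arith.
have [Qa /andP[Qa1 Qa2] cQa] := copy_in F q (R.+1 - L).
have QaR : Qa <= R by arith.
have RQa : R < Qa + L by arith.
have eqa : cw L (hd F q) (hd F w) = R - Qa by rewrite (cw_copy cQa cR).
have [Qb /andP[Qb1 Qb2] cQb] := copy_in F q ((R + len w).+1 - L).
have Qbt : Qb <= R + len w by arith.
have tQb : R + len w < Qb + L by arith.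
have eqb : cw L (hd F q) (tl F w) = R + len w - Qb.
  by rewrite -(eqP cQb) -(copy_tl cR) cw_sub.
have noencl Q : copy q Q -> Q <= R -> R + len w <= Q + len q -> False.
  by move=> cQ h1 h2; case/eqP: wq; rewrite (maxw _ _ cQ h1 h2).
have eB' : B = if R + len w <= Qb + len q then Qb + len q else R + len w.
  rewrite eB eqb; have -> : (R + len w - Qb <= len q) = (R + len w <= Qb + len q) by arith.
  case: leqP => h; last by rewrite addn0.
  by rewrite -(copy_tl cR) -(copy_tl cQb) cw_sub; arith.
have eA' : A = if R <= Qa + len q then Qa else R.
  rewrite eA eqa; have -> : (R - Qa <= len q) = (R <= Qa + len q) by arith.
  by case: leqP => h; arith.
move=> {eA eB eqa eqb Qa1 Qb1}.
have wB : R + len w <= B by rewrite eB'; case: ifP; arith.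
split.
  apply: cover_confined => //; first by arith.
  move=> u P cP h1 h2; have [h3|h3] := boolP ((P <= R + len w) && (R <= P + len u)).
    apply/reachedP; exists w; rewrite ?inE ?eqxx //.
    by case/andP: h3 => h3 h4; apply: (touch_of cP cR); arith.
  apply/reachedP; exists q; rewrite ?inE ?eqxx ?orbT //.
  have [h|h] := leqP P (R + len w).
    have h6 : P + len u < R by move: h3; rewrite h /= -ltnNge.
    have [h4 h4'] : P + len u < R /\ R <= Qa + len q.
      by move: h2; rewrite eA'; case: ifP => h5; arith.
    by apply: (touch_of cP cQa); move: h2; rewrite eA' h4'; arith.
  have h4 : R + len w <= Qb + len q by move: h1; rewrite eB'; case: ifP => h5; arith.
  by apply: (touch_of cP cQb); move: h1; rewrite eB' h4; arith.
have [hAB|hAB] := leqP (A + L) B; [by left|right].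
have inq Q : copy q Q -> R <= Q + len q -> Q <= R + len w ->
    exists Q, [/\ copy q Q, A <= Q & Q + len q <= B].
  move=> cQ h1 h2; exists Q; split=> //; case: (leqP Q R) => h3.
  - have eQ : Q = Qa.
      case: (ltngtP Q Qa) => // h; [have := copy_gap cQ cQa h|have := copy_gap cQa cQ h]; arith.
    by rewrite eA' -eQ h1.
  - by rewrite eA'; case: ifP; arith.
  - have h4 := noencl Q cQ h3; case: (leqP (R + len w) (Q + len q)) => h5; first by case: h4.
    by arith.
  have [h5|h5] := leqP (Q + len q) (R + len w); first by arith.
  have eQ : Q = Qb.
    case: (ltngtP Q Qb) => // h; [have := copy_gap cQ cQb h|have := copy_gap cQb cQ h]; arith.
  by rewrite eB' -eQ (ltnW h5).
move=> x; rewrite !inE => /orP[] /eqP ->; first by exists R.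
by have [Q [cQ h1 h2]] := touch_at tq cR LR; apply: (inq Q).
Qed.

Hypothesis ptP : forall v, tail_partner F v (pt v).
(** The default choice made by the program: a neighbour ending one label before t(v), hence never
    past the frontier. *)
Hypothesis ptI : forall v P, copy v P -> L <= P -> far (P + len v) = P + len v ->
  exists2 Q, copy (pt v) Q & (Q + len (pt v)).+1 = P + len v.

Lemma partner_tail v P : copy v P -> L <= P ->
  exists Q, [/\ copy (pt v) Q, P + len v <= (Q + len (pt v)).+1,
    Q + len (pt v) <= far (P + len v) &
    far (Q + len (pt v)) <= far (far (P + len v))].
Proof.
move=> cP LP; have tf : P + len v <= far (P + len v).
  by apply: far_ge; [arith|exists v, P].
have [_ [[Q [cQ Qt eQ]]|[e _]]] := tail_partner_far (ptP v) cP LP.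
  by exists Q; rewrite eQ; split=> //; arith.
have [Q cQ eQ] := ptI cP LP e; exists Q; split=> //; [by rewrite eQ|arith|].
by rewrite e; have lv := len_gt0 F v; apply: far_mono; arith.
Qed.

Lemma exact_stop A X G : confined X A G -> A + L <= near G -> dominating (adj F) X.
Proof.
move=> conf AN; apply/dominatingP => u; case: (boolP (u \in reached X)) => // uX.
by have [P [cP GP PA]] := conf u uX; have := near_min cP GP; arith.
Qed.

Section Loop.
Variables (w : 'I_n) (R A c : nat).
Hypotheses (LA : 2 * L <= A) (AR : A <= R).
Hypothesis maxw :
  forall u P, copy u P -> P <= R -> R + len w <= P + len u -> u = w.
Hypotheses (cmod : c %% L = tl F (vfirst F)) (Ac : A <= c).

Lemma exact_step X G v P : confined X A G -> inside X A G -> R + len w <= G ->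
  c <= near G -> copy v P -> G < P -> P + len v = near G -> near G < A + L ->
  [/\ next_undominated F X v, ~ dominating (adj F) X,
      confined (step X v) A (advance G) & inside (step X v) A (advance G)].
Proof.
move=> conf ins wG cN cP GP eP NA; have L0 := L_gt0 F; have LG : 2 * L <= G by arith.
have LG1 : L <= G by arith.
have LP : L <= P by arith.
have vX : v \notin reached X.
  apply/negP => /reachedP[x xX t]; have [Q [cQ h1 h2]] := touch_at t cP LP.
  have [Q' [cQ' h3 h4]] := ins x xX; have lx := len_gt0 F x.
  by case: (ltngtP Q Q') => h; [have := copy_gap cQ cQ' h|have := copy_gap cQ' cQ h|]; arith.
have nv : next_undominated F X v.
  split=> // u uX; have [Q [cQ GQ QA]] := conf u uX; have := near_min cQ GQ => h.
  have e1 : cw L (tl F (vfirst F)) (tl F v) = P + len v - c.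
    by rewrite -cmod -(copy_tl cP) cw_sub; arith.
  have e2 : cw L (tl F (vfirst F)) (tl F u) = Q + len u - c.
    by rewrite -cmod -(copy_tl cQ) cw_sub; arith.
  by rewrite e1 e2; arith.
have [sX aX bX _ _] := stepP ptP vX.
have conf' := confined_step LG cmod Ac cN conf nv (ptP v) (ptP (pt v)) sX aX bX.
split=> //; first by move/dominatingP/(_ v) => h; rewrite h in vX.
have adv : advance G = far (far (near G)) by [].
have aG := advance_gt F LG1; have nG := near_gt F G.
have h1 := near_far F LG1; have h2 := far_advance F LG1.
(* An arc ending at or after the tail of [w] but starting before [A] would contain the arc of [w],
   hence be [w]. So new partners cannot stick out behind [A]. *)
have late x Q : copy x Q -> R + len w <= Q + len x -> A <= Q.
  move=> cQ h; rewrite leqNgt; apply/negP => QA.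
  have xw : x = w by apply: (maxw cQ) => //; arith.
  by rewrite xw in h; arith.
(* A default partner ends one label short. Two in a row still end at [G] or later, as [near G] is at
   least [G + 2], so [late] applies to both. *)
have [Qa [cQa a1 a2 a3]] := partner_tail cP LP.
have LQa : L <= Qa by have := late _ _ cQa; arith.
have [Qb [cQb b1 b2 b3]] := partner_tail cQa LQa.
have := len_gt0 F v => lv.
rewrite eP -adv in a1 a2 a3.
have ia : exists Q, [/\ copy (pt v) Q, A <= Q & Q + len (pt v) <= advance G].
  by exists Qa; split=> //; [apply: (late _ _ cQa)|]; arith.
have ib : exists Q, [/\ copy (pt (pt v)) Q, A <= Q & Q + len (pt (pt v)) <= advance G].
  by exists Qb; split=> //; [apply: (late _ _ cQb)|]; arith.
have iv : exists Q, [/\ copy v Q, A <= Q & Q + len v <= advance G].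
  by exists P; split=> //; arith.
move=> x; rewrite /step.
by case: ifP => _; rewrite !inE => /orP[xX|/orP[] /eqP-> //];
  have [Q [cQ q1 q2]] := ins x xX; exists Q; split=> //; arith.
Qed.
End Loop.
End ExactRun.

(** * Extremal arcs and partners described by labels on the circle *)

Section Labels.
Variables (n : nat) (F : arc_model n).
Local Notation L := n.*2.
Local Notation copy := (copy F).
Local Notation len := (len F).
Local Notation touch := (touch F).
Local Notation far := (far F).
Local Notation near := (near F).
Implicit Types (u v w x y b : 'I_n) (P Q R G T j e : nat).

(** The last copy of [i] starting by [j] ends at [j - cw L (hd F i) j + len i]; two such ends are
    compared, with the terms moved so that nothing is subtracted. *)
Definition far_label j b := forall i : 'I_n,
  len i + cw L (hd F b) j <= len b + cw L (hd F i) j.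
Definition near_label j b := forall i : 'I_n,
  len b + cw L j (hd F b) <= len i + cw L j (hd F i).
(** Here each arc is represented by its first copy ending at or after [j], and [b] is the one that
    starts first. *)
Definition back_label j b := forall i : 'I_n,
  len i + cw L j (tl F b) <= len b + cw L j (tl F i).
Definition owns e u := hd F u = e :> nat \/ tl F u = e :> nat.
Definition pred_label j := if j == 0 then L.-1 else j.-1.
Definition succ_label j := if j.+1 == L then 0 else j.+1.

Lemma succ_mod s : 1 < L -> s.+1 %% L = succ_label (s %% L).
Proof.
move=> L1; rewrite /succ_label -addn1 -modnDml addn1.
have sL : s %% L < L by rewrite ltn_mod; lia.
have [e|h] := eqVneq (s %% L).+1 L; first by rewrite e modnn.
by rewrite modn_small // ltn_neqAle h sL.
Qed.

Lemma pred_succ j : j < L -> pred_label (succ_label j) = j.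
Proof. by rewrite /pred_label /succ_label; have [<-|_] := eqVneq j.+1 L. Qed.

Lemma far_labelP b G : L <= G -> far_label (G %% L) b ->
  exists P, [/\ copy b P, P <= G < P + L & P + len b = far G].
Proof.
move=> LG h; have [cP hP] := last_copyP F b LG; set P := last_copy F b G in cP hP.
exists P; split=> //; apply/esym/far_uniq => //; first by case/andP: hP.
move=> v Q cQ QG; have [cR hR] := last_copyP F v LG.
move: cR hR; set R := last_copy F v G => cR hR.
have QR : Q <= R by rewrite leqNgt; apply/negP => /(copy_gap cR cQ); arith.
have := h v; rewrite -(eqP cP) -(eqP cR) !cw_sub; arith.
Qed.

Lemma far_tail_label b G : L <= G -> is_tail F G -> far_label (G %% L) b ->
  far G = G + cw L (G %% L) (tl F b).
Proof.
move=> LG tG /(far_labelP LG)[P [cP hP eP]].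
have := far_ge LG tG; have := len_lt F b => lb h.
by rewrite -(copy_tl cP) cw_sub; arith.
Qed.

Lemma near_labelP b G : is_tail F G -> near_label (G %% L) b ->
  (exists P, [/\ copy b P, G < P & P + len b = near G]) /\
  near G = G + (cw L (G %% L) (hd F b) + len b).
Proof.
move=> [z [Z [cZ eZ]]] h; have L0 := L_gt0 F.
(* [G] is a tail, so no head sits there: the clockwise distance from [G] to a head is never 0 and
   measures the first head strictly after [G]. *)
have hdG v P : copy v P -> G <> P by move=> cP e; apply: (head_tail cP cZ); rewrite eZ e.
have [cP hP] := next_copyP F b G; set P := next_copy F b G in cP hP.
have PG : P < G + L.
  have : P <> G + L by move=> e; apply: (hdG b (P - L) (copyB cP _)); arith.
  by arith.
have e : near G = P + len b.
  apply: near_uniq => //; first by arith.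
  move=> v Q cQ GQ; have [cR hR] := next_copyP F v G.
  move: cR hR; set R := next_copy F v G => cR hR.
  have RQ : R <= Q by rewrite leqNgt; apply/negP => /(copy_gap cQ cR); arith.
  have RG : R < G + L.
    have : R <> G + L by move=> e; apply: (hdG v (R - L) (copyB cR _)); arith.
    by arith.
  have := h v; rewrite -(eqP cP) -(eqP cR) !cw_sub; arith.
split; first by exists P; split=> //; arith.
by rewrite -(eqP cP) cw_sub; arith.
Qed.

Lemma paired_neighbour S v : paired_dominating (adj F) S -> exists u, adj F v u.
Proof.
case=> dom [M [pM eM]]; have [vS|/dom[u uS e]] := boolP (v \in S); last by exists u.
have : v \in cover M by rewrite (cover_partition pM).
case/bigcupP => B /eM[x [y [xy exy ->]]] /set2P[]->; [by exists y|exists x].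
by rewrite adjC.
Qed.

Lemma measure G (bn : 'I_n) (bf : nat -> 'I_n) : L <= G -> is_tail F G ->
  near_label (G %% L) bn -> (forall j, j < L -> far_label j (bf j)) ->
  let a := bf (tl F bn) in let b := bf (tl F a) in
  [/\ exists P, [/\ copy bn P, G < P & P + len bn = near G],
      near G = G + (cw L (G %% L) (hd F bn) + len bn),
      exists2 P, copy a P & P + len a = far (near G),
      far (near G) = near G + cw L (tl F bn) (tl F a) &
      (exists2 P, copy b P & P + len b = advance F G) /\
      advance F G = far (near G) + cw L (tl F a) (tl F b)].
Proof.
move=> LG tG hn hf a b; have [ex eN] := near_labelP tG hn.
have [P [cP GP eP]] := ex.
have LN := near_ge F LG; have tN := near_tail F G.
have mN : near G %% L = tl F bn by rewrite -eP (copy_tl cP).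
have LfN : L <= far (near G) by apply: leq_trans LN (near_far F LG).
have tfN := far_tail F LN.
have ha : far_label (near G %% L) a by rewrite mN; apply: hf; exact: tl_lt.
have [Q [cQ _ eQ]] := far_labelP LN ha.
have mfN : far (near G) %% L = tl F a by rewrite -eQ (copy_tl cQ).
have hb : far_label (far (near G) %% L) b by rewrite mfN; apply: hf; exact: tl_lt.
have [S [cS _ eS]] := far_labelP LfN hb.
split=> //.
- by exists Q.
- by rewrite {1}(far_tail_label LN tN ha) mN.
split; first by exists S.
by have := far_tail_label LfN tfN hb; rewrite mfN.
Qed.

Hypothesis neighbour : forall v, exists u, adj F v u.

(** If [b = v], no other arc lies over t(v) and any neighbour is allowed; the owner of the preceding
    label is one. If that label is a tail, its arc ends inside that of [v]. It is not a head:
    another arc starting there would lie over t(v), and if it were h(v), every neighbour of [v]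
    would. *)
Lemma far_partner v b e u : far_label (tl F v) b -> owns e u ->
  e = pred_label (tl F v) -> let z := if b == v then u else b in
  tail_partner F v z /\
  forall P, copy v P -> L <= P -> far (P + len v) = P + len v ->
    exists2 Q, copy z Q & (Q + len z).+1 = P + len v.
Proof.
move=> hb ou ee z; have L0 := L_gt0 F.
suff main P : copy v P -> L <= P -> tail_partner F v z /\
    (far (P + len v) = P + len v ->
     exists2 Q, copy z Q & (Q + len z).+1 = P + len v).
  split; last by move=> P cP LP; have [] := main P cP LP.
  by have [P /andP[LP _] cP] := copy_in F v L; have [] := main P cP LP.
move=> cP LP; have [t tE] : exists t, t = P + len v by exists (P + len v).
rewrite -tE; have Lt : L <= t by arith.
have tmod := copy_tl cP; rewrite -tE in tmod.
have lv := len_lt F v; have lv0 := len_gt0 F v.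
have nbrs y Q : copy y Q -> Q <= t < Q + L -> y != v ->
    (y \in tail_nbrs F v) = (t <= Q + len y).
  move=> cQ h yv; rewrite in_tail_nbrs (endpoint_in cQ tmod) //.
  case: leqP => h2; rewrite ?andbF // andbT adjE eq_sym yv /=.
  by apply: (touch_of cP cQ); arith.
have nbrsE y : y \in tail_nbrs F v -> exists Q,
    [/\ copy y Q, Q <= t < Q + L, t <= Q + len y & y != v].
  move=> yN; have yv : y != v by move: yN; rewrite in_tail_nbrs adjE eq_sym; case/andP=> /andP[].
  have [cQ hQ] := last_copyP F y Lt; exists (last_copy F y t); split=> //.
  by rewrite -nbrs.
rewrite -tmod in hb; have [Q [cQ hQ eQ]] := far_labelP Lt hb.
have tf : t <= far t by apply: far_ge => //; exists v, P.
rewrite /z; case: eqP => [bv|/eqP bv]; last first.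
  have bN : b \in tail_nbrs F v by rewrite (nbrs b Q) // eQ.
  split; last first.
    move=> ft; case/eqP: bv; apply: (tail_inj cQ cP); rewrite -tE eQ ft //.
  rewrite /tail_partner; case: eqP => [e0|_]; first by rewrite e0 inE in bN.
  split=> // y /nbrsE[R [cR hR tR yv]]; have ly := len_lt F y; have lb := len_lt F b.
  have RF : R + len y <= far t by apply: far_max => //; case/andP: hR.
  rewrite -tmod -(copy_tl cR) -(copy_tl cQ) !cw_sub; arith.
have ft : far t = t.
  rewrite -eQ; rewrite bv in cQ eQ *; case: (ltngtP P Q) => h.
  - by have := copy_gap cP cQ h; arith.
  - by have := copy_gap cQ cP h; arith.
  by rewrite tE h.
have n0 : tail_nbrs F v = set0.
  apply/setP => y; rewrite in_set0; apply/negP => /nbrsE[R [cR hR tR yv]].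
  have RF : R + len y <= far t by apply: far_max => //; case/andP: hR.
  by case/eqP: yv; apply: (tail_inj cR cP); rewrite -tE; congr modn; arith.
have et : t.-1 %% L = e.
  have L1 : 1 < L by arith.
  have sL : t.-1 %% L < L by rewrite ltn_mod.
  rewrite ee -tmod -[X in pred_label (X %% L)]prednK; last by arith.
  by rewrite succ_mod // pred_succ.
have Lt1 : L <= t.-1 by arith.
suff [Q' cQ' eQ'] : exists2 Q', copy u Q' & (Q' + len u).+1 = t.
  split; last by exists Q'.
  rewrite /tail_partner n0 eqxx inE adjE; apply/andP; split.
    apply/eqP => vu; rewrite -vu in cQ' eQ'.
    case: (ltngtP P Q') => h; [have := copy_gap cP cQ' h|have := copy_gap cQ' cP h|];
      arith.
  by apply: (touch_of cP cQ'); arith.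
case: ou => hu; last first.
  by have [Q' cQ' eQ'] := tail_copy (etrans et (esym hu)) Lt1; exists Q' => //; arith.
have cu : copy u t.-1 by apply/eqP; rewrite et hu.
have lu := len_lt F u; have lu0 := len_gt0 F u.
have uv : u = v.
  apply/eqP; apply/negPn/negP => uv.
  by have := nbrs u t.-1 cu; rewrite n0 in_set0 uv => /(_ _ isT); arith.
have [y /andP[vy ty]] := neighbour v.
have [Y [cY y1 y2]] := touch_at ty cP LP; rewrite eq_sym in vy.
have Pt : P = t.-1.
  rewrite uv in cu; case: (ltngtP P t.-1) => // h;
   [have := copy_gap cP cu h|have := copy_gap cu cP h]; arith.
have n1 := head_tail cP cY; have n2 := head_tail cY cP; have ly := len_lt F y.
have := nbrs y Y cY; rewrite n0 in_set0 vy => /(_ _ isT); arith.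
Qed.

(** The mirror image of [far_partner]: the default is the owner of the label just after h(v). *)
Lemma back_partner v b e u : back_label (hd F v) b -> owns e u ->
  e = succ_label (hd F v) -> head_partner F v (if b == v then u else b).
Proof.
move=> hb ou ee; have L0 := L_gt0 F.
have [R /andP[LR _] cR] := copy_in F v L.
have Rmod := eqP cR; have lv := len_lt F v; have lv0 := len_gt0 F v.
have nbrs y Q : copy y Q -> Q <= R < Q + L -> y != v ->
    (y \in head_nbrs F v) = (R <= Q + len y).
  move=> cQ h yv; rewrite in_head_nbrs (endpoint_in cQ Rmod) //.
  case: leqP => h2; rewrite ?andbF // andbT adjE eq_sym yv /=.
  by apply: (touch_of cR cQ); arith.
have nbrsE y : y \in head_nbrs F v -> exists Q,
    [/\ copy y Q, Q <= R < Q + L, R <= Q + len y & y != v].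
  move=> yN; have yv : y != v by move: yN; rewrite in_head_nbrs adjE eq_sym; case/andP=> /andP[].
  have [cQ hQ] := last_copyP F y LR; exists (last_copy F y R); split=> //.
  by rewrite -nbrs.
have tail_dist y Q : copy y Q -> Q <= R <= Q + len y ->
    cw L (hd F v) (tl F y) = Q + len y - R.
  by move=> cQ h; have ly := len_lt F y; rewrite -Rmod -(copy_tl cQ) cw_sub; arith.
have selfd := tail_dist v R cR; rewrite leqnn leq_addr addKn in selfd.
have [Z cZ hZ] := tail_in F b (R - L).
have lb := len_lt F b.
have eZ : cw L (hd F v) (tl F b) = Z + len b - R.
  by rewrite -Rmod -(copy_tl cZ) cw_sub; arith.
have ZR : Z <= R.
  by have := hb v; rewrite selfd // eZ; arith.
have best y Q : copy y Q -> Q <= R <= Q + len y -> Z <= Q.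
  by move=> cQ h; have := hb y; rewrite (tail_dist y Q cQ h) eZ; arith.
have Zb : Z <= R <= Z + len b by arith.
case: eqP => [bv|/eqP bv]; last first.
  have bN : b \in head_nbrs F v by rewrite (nbrs b Z) //; arith.
  rewrite /head_partner; case: eqP => [e0|_]; first by rewrite e0 inE in bN.
  split=> // y /nbrsE[Q [cQ hQ RQ yv]]; have ly := len_lt F y.
  have ZQ : Z <= Q by apply: best cQ _; arith.
  by rewrite (cw_copy cQ cR) ?(cw_copy cZ cR); arith.
have ZR' : Z = R.
  rewrite bv in cZ Zb; case: (ltngtP Z R) => // h; last by arith.
  by have := copy_gap cZ cR h; arith.
have n0 : head_nbrs F v = set0.
  apply/setP => y; rewrite in_set0; apply/negP => /nbrsE[Q [cQ hQ RQ yv]].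
  have ZQ : Z <= Q by apply: best cQ _; arith.
  have QR : Q = R by arith.
  by case/eqP: yv; apply: (copy_inj cQ); rewrite QR.
have et : R.+1 %% L = e by rewrite ee -Rmod succ_mod //; arith.
suff [uv tu] : u != v /\ touch v u.
  by rewrite /head_partner n0 eqxx inE adjE eq_sym uv.
case: ou => hu.
  have cu : copy u R.+1 by apply/eqP; rewrite et hu.
  split; last by apply: (touch_of cR cu); arith.
  by apply/eqP => uv; rewrite uv in cu; have := copy_gap cR cu (ltnSn R); arith.
have LR1 : L <= R.+1 by arith.
have [Q cQ eQ] := tail_copy (etrans et (esym hu)) LR1.
have lu := len_lt F u; have lu0 := len_gt0 F u.
have uv : u = v.
  by apply/eqP; apply/negPn/negP => uv; have := nbrs u Q cQ; rewrite n0 in_set0 uv => /(_ _ isT); arith.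
have [y /andP[vy ty]] := neighbour v.
have [Y [cY y1 y2]] := touch_at ty cR LR; rewrite eq_sym in vy.
have QR : Q = R.
  rewrite uv in cQ; case: (ltngtP Q R) => // h; [have := copy_gap cQ cR h|]; arith.
have YR : Y <> R by move=> e'; case/eqP: vy; apply: (copy_inj cY); rewrite e'.
have n1 := head_tail cY cQ; have ly := len_lt F y.
have YleR : Y <= R.
  rewrite -uv in y2; have e1 : len u = 1 by arith.
  by rewrite e1 in y2 eQ; arith.
have hY : Y <= R < Y + L by arith.
by have := nbrs y Y cY hY vy; rewrite n0 in_set0 y1.
Qed.
End Labels.

Lemma label_owner n (F : arc_model n) e : e < n.*2 -> exists u, owns F e u.
Proof.
move=> eL; pose A := [set hd F u | u in 'I_n] :|: [set tl F u | u in 'I_n].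
have cA : #|A| = #|'I_(n.*2)|.
  rewrite cardsU !card_imset; [|exact: tl_inj|exact: hd_inj].
  rewrite (_ : _ :&: _ = set0) ?cards0; last first.
    apply/setP => z; rewrite !inE; apply/negP => /andP[/imsetP[u _ ->] /imsetP[v _ e']].
    by have := hd_neq_tl F u v; rewrite e' eqxx.
  by rewrite !card_ord; lia.
have /subset_cardP : #|A| = #|'I_(n.*2)| by [].
move=> /(_ (subset_predT _))/(_ (Ordinal eL)); rewrite !inE => /orP[] /imsetP[u _ h]; exists u.
  by left; rewrite -h.
by right; rewrite -h.
Qed.

(** * Program logic *)

Section ProgramLogic.
Variable B : nat.
Implicit Types (e : expr) (c : cmd) (s : store) (Q : store -> Prop).

(** Values are computed without a bound, and [fits] separately records that no intermediate result
    exceeds [B]. *)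
Fixpoint den s e : nat :=
  match e with
  | Cst k => k
  | Var x => var s x
  | Get a i => arr s a (den s i)
  | Op o e1 e2 => eval_op o (den s e1) (den s e2)
  end.

Fixpoint fits s e : Prop :=
  match e with
  | Cst k => k <= B
  | Var x => var s x <= B
  | Get a i => fits s i /\ arr s a (den s i) <= B
  | Op o e1 e2 => [/\ fits s e1, fits s e2 & eval_op o (den s e1) (den s e2) <= B]
  end.

Lemma eval_den s e : fits s e -> eval B s e = Some (den s e).
Proof.
have w x : x <= B -> word B x = Some x by rewrite /word => ->.
elim: e => [k|x|a i IH|o e1 IH1 e2 IH2] /=; [exact: w|exact: w| |].
  by case=> /IH -> h /=; exact: w.
by case=> /IH1 -> /IH2 -> h /=; exact: w.
Qed.

Definition run_ok c s K Q := exists k s', [/\ exec B c s k s', k <= K & Q s'].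

Lemma run_weaken c s K K' Q Q' : K <= K' -> (forall s', Q s' -> Q' s') ->
  run_ok c s K Q -> run_ok c s K' Q'.
Proof.
move=> KK' QQ' [k [s' [ex kK q]]]; exists k, s'; split=> //; last exact: QQ'.
exact: leq_trans KK'.
Qed.

Lemma run_seq c1 c2 s K1 K2 Q1 Q2 : run_ok c1 s K1 Q1 ->
  (forall s', Q1 s' -> run_ok c2 s' K2 Q2) -> run_ok (Seq c1 c2) s (K1 + K2) Q2.
Proof.
case=> k1 [s1 [ex1 h1 q1]] /(_ s1 q1)[k2 [s2 [ex2 h2 q2]]].
by exists (k1 + k2), s2; split; [exact: exec_seq ex1 ex2|exact: leq_add|].
Qed.

Lemma run_post c s K K' Q Q' : run_ok c s K Q -> K <= K' ->
  (forall s', Q s' -> Q' s') -> run_ok c s K' Q'.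
Proof. by move=> r KK' QQ'; exact: run_weaken KK' QQ' r. Qed.

(** The strictly decreasing index of the invariant bounds the number of iterations and thereby the
    time. *)
Lemma run_while e c K (I : nat -> store -> Prop) Q :
  (forall m s, I m s -> fits s e /\
    if den s e == 0 then Q s else
    run_ok c s K (fun s' => exists2 m', m' < m & I m' s')) ->
  forall m s, I m s ->
    run_ok (While e c) s (m.+1 * ((expr_cost e).+1 + K)) Q.
Proof.
move=> h m; elim/ltn_ind: m => m IH s Is; have [fe] := h m s Is.
have ev := eval_den fe; case: eqP => [d0 Qs|/eqP d0].
  exists (expr_cost e).+1, s; split=> //; first by apply: exec_while_end; rewrite ev d0.
  by rewrite mulSn -addnA leq_addr.
case=> k1 [s1 [ex1 h1 [m' m'm I1]]]; have [k2 [s2 [ex2 h2 q2]]] := IH m' m'm s1 I1.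
exists ((expr_cost e).+1 + k1 + k2), s2; split=> //.
  exact: exec_while_step ev d0 ex1 ex2.
rewrite mulSn leq_add ?leq_add2l //; apply: leq_trans h2 _.
by rewrite leq_mul2r m'm orbT.
Qed.

(** Meant for loop-free code: a loop gets [False], so it has to go through [run_while]. *)
Fixpoint wp c Q s : Prop :=
  match c with
  | Skip => Q s
  | SetVar x e => fits s e /\ Q (set_var s x (den s e))
  | SetArr a e1 e2 => [/\ fits s e1, fits s e2 & Q (set_arr s a (den s e1) (den s e2))]
  | Seq c1 c2 => wp c1 (wp c2 Q) s
  | If e c1 c2 => fits s e /\ if den s e != 0 then wp c1 Q s else wp c2 Q s
  | While _ _ => False
  end.

Fixpoint cost c : nat :=
  match c with
  | Skip => 1
  | SetVar _ e => (expr_cost e).+1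
  | SetArr _ e1 e2 => (expr_cost e1 + expr_cost e2).+1
  | Seq c1 c2 => cost c1 + cost c2
  | If e c1 c2 => (expr_cost e).+1 + maxn (cost c1) (cost c2)
  | While _ _ => 0
  end.

Lemma run_wp c Q s : wp c Q s -> run_ok c s (cost c) Q.
Proof.
elim: c Q s => [|x e|a e1 e2|c1 IH1 c2 IH2|e c1 IH1 c2 IH2|//] Q s /=.
- by move=> q; exists 1, s; split=> //; exact: exec_skip.
- case=> /eval_den ev q; exists (expr_cost e).+1, (set_var s x (den s e)).
  by split=> //; exact: exec_set_var.
- case=> /eval_den ev1 /eval_den ev2 q.
  exists (expr_cost e1 + expr_cost e2).+1, (set_arr s a (den s e1) (den s e2)).
  by split=> //; exact: exec_set_arr.
- move/IH1 => r; apply: run_seq r _ => s'; exact: IH2.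
case=> /eval_den ev h.
have [k [s' [ex kK q]]] : run_ok (if den s e != 0 then c1 else c2) s
    (maxn (cost c1) (cost c2)) Q.
  case: ifP h => _ => [/IH1|/IH2]; apply: run_weaken => //.
    exact: leq_maxl.
  exact: leq_maxr.
exists ((expr_cost e).+1 + k), s'; split=> //; last by rewrite leq_add2l.
exact: exec_if ev ex.
Qed.

Lemma run_wp_le c K Q s : cost c <= K -> wp c Q s -> run_ok c s K Q.
Proof. by move=> cK /run_wp; apply: run_weaken. Qed.

Lemma wp_mono c (Q Q' : store -> Prop) s :
  (forall s', Q s' -> Q' s') -> wp c Q s -> wp c Q' s.
Proof.
move=> h; elim: c Q Q' h s => [|x e|a e1 e2|c1 IH1 c2 IH2|e c1 IH1 c2 IH2|//]
  Q Q' h s /=; first exact: h.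
- by case=> ? /h.
- by case=> ? ? /h.
- by apply: IH1 => s'; apply: IH2.
by case=> fe; case: ifP => _ q; split=> //; [apply: IH1 q|apply: IH2 q].
Qed.
End ProgramLogic.

Lemma var_set_var s x v y : var (set_var s x v) y = if y == x then v else var s y.
Proof. by []. Qed.

Lemma arr_set_var s x v : arr (set_var s x v) = arr s.
Proof. by []. Qed.

Lemma var_set_arr s a i v : var (set_arr s a i v) = var s.
Proof. by []. Qed.

Lemma arr_set_arr s a i v b j :
  arr (set_arr s a i v) b j = if (b == a) && (j == i) then v else arr s b j.
Proof. by []. Qed.

Definition store_simp := (var_set_var, arr_set_var, var_set_arr, arr_set_arr).

(* Variable 0 holds [n] and variable 1 holds [2 * n] throughout. *)
Definition inc x := SetVar x (Op OpAdd (Var x) (Cst 1)).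
Definition mirror e := Op OpSub (Op OpSub (Var 1) (Cst 1)) e.
Definition put_cw x e1 e2 :=
  If (Op OpLt e2 e1) (SetVar x (Op OpSub (Op OpAdd e2 (Var 1)) e1))
     (SetVar x (Op OpSub e2 e1)).

Lemma wp_put_cw B x e1 e2 Q s : fits B s e1 -> fits B s e2 ->
  4 * var s 1 <= B -> den s e1 < var s 1 -> den s e2 < var s 1 ->
  Q (set_var s x (cw (var s 1) (den s e1) (den s e2))) -> wp B (put_cw x e1 e2) Q s.
Proof.
move=> f1 f2 LB l1 l2; rewrite /put_cw /= cw_if //.
by case: (ltnP (den s e2) (den s e1)) => h q; do ![split=> //]; lia.
Qed.

Arguments put_cw : simpl never.
Global Opaque put_cw.

Definition for_ x e c := While (Op OpLt (Var x) e) (Seq c (inc x)).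

Lemma run_for B x e c N K (I : nat -> store -> Prop) s : N <= B ->
  (forall i s, I i s -> [/\ fits B s e, den s e = N & var s x = i]) ->
  (forall i s, i < N -> I i s ->
    run_ok B c s K (fun s' => var s' x = i /\ I i.+1 (set_var s' x i.+1))) ->
  I 0 s -> run_ok B (for_ x e c) s (N.+1 * (expr_cost e + K + 7)) (I N).
Proof.
move=> NB guard body I0.
pose J m s' := exists i, [/\ m = N - i, i <= N & I i s'].
have J0 : J N s by exists 0; rewrite subn0.
apply: (run_weaken _ _ (run_while (I := J) (K := K + 4) (Q := I N) _ J0)); last first.
- move=> m s' [i [-> iN Ii]]; have [fe eN ei] := guard i s' Ii.
  split; first by rewrite /= ei eN; do ![split=> //]; case: ltnP => ?; lia.
  rewrite /= ei eN; case: (ltnP i N) => [lt|le] /=; last first.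
    by have -> : N = i by lia.
  apply: run_seq (body i s' lt Ii) _ => s1 [e1 I1].
  apply: run_wp_le => //=; rewrite e1; split; first by split=> //; lia.
  by exists (N - i.+1); [lia|exists i.+1; rewrite addn1; split].
- by move=> s' q; exact: q.
by rewrite /=; lia.
Qed.

Local Notation "c1 ;; c2" := (Seq c1 c2) (at level 60, right associativity).

(** * The linear-time program *)

Definition mirror_table src dst :=
  SetVar 2 (Cst 0) ;;
  for_ 2 (Var 0) (SetArr dst (Var 2) (mirror (Get src (Var 2)))).

Definition scan_label H T own best :=
  If (Get own (Var 4))
    (SetVar 8 (Op OpSub (Get own (Var 4)) (Cst 1)) ;;
     put_cw 9 (Get H (Var 8)) (Get T (Var 8)) ;;
     If (Op OpLt (Var 5) (Op OpAdd (Var 3) (Var 9)))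
       (SetVar 5 (Op OpAdd (Var 3) (Var 9)) ;; SetVar 6 (Var 8)) Skip)
    Skip ;;
  SetArr best (Var 4) (Var 6) ;;
  inc 4 ;;
  If (Op OpEq (Var 4) (Var 1)) (SetVar 4 (Cst 0)) Skip.

(* [own] receives the owner, plus one, of each label of the table [H]; [best]
   receives, for each label, the vertex whose arc, among those of the arcs
   from [H i] to [T i] that start at or before this label, ends last.  The
   sweep goes twice round the circle. *)
Definition scan H T own best :=
  SetVar 2 (Cst 0) ;;
  for_ 2 (Var 0) (SetArr own (Get H (Var 2)) (Op OpAdd (Var 2) (Cst 1))) ;;
  (SetVar 3 (Cst 0) ;; SetVar 4 (Cst 0) ;; SetVar 5 (Cst 0) ;; SetVar 6 (Cst 0)) ;;
  for_ 3 (Op OpAdd (Var 1) (Var 1)) (scan_label H T own best).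

Section Scan.
Variables (n B : nat) (h t : nat -> nat).
Local Notation L := n.*2.
Hypotheses (n0 : 0 < n) (LB : 8 * L <= B).

Definition base s := var s 0 = n /\ var s 1 = L.

Lemma mirror_table_ok (src dst : nat) s : dst != src -> base s ->
  (forall i, i < n -> arr s src i < L) ->
  run_ok B (mirror_table src dst) s (20 * n + 20) (fun s' =>
    [/\ base s', forall (a : nat) i, a != dst -> arr s' a i = arr s a i &
        forall i, i < n -> arr s' dst i = L.-1 - arr s src i]).
Proof.
move=> ds [v0 v1] srcL; rewrite /mirror_table.
pose I i s' := [/\ var s' 2 = i, base s', forall (a : nat) j, a != dst -> arr s' a j = arr s a j &
  forall j, j < i -> arr s' dst j = L.-1 - arr s src j].
suff r : run_ok B (mirror_table src dst) s (2 + n.+1 * 16) (I n).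
  by apply: run_post r _ _ => [|s' [_ b keep val]]; [lia|split].
apply: (run_seq (Q1 := I 0)).
  by apply: run_wp_le => //=; rewrite ?store_simp /=; split=> //; split.
move=> s1; apply: (run_for (K := 8)); first by lia.
  by move=> i s' [-> [e0 e1] _ _]; rewrite /= e0; split=> //; lia.
move=> i s' ilt [e2 [e0 e1] keep val]; apply: run_wp_le => //.
rewrite /= !e2 e1 keep ?(eq_sym src) //; have := srcL i ilt => sl.
split; [by lia|do ![split=> //]; lia|rewrite ?store_simp; split=> //].
split=> // [a j ad|j]; rewrite ?store_simp.
  by rewrite (negPf ad) /= keep.
rewrite ltnS eqxx /=; case: eqP => [-> _|ne le]; first by lia.
by apply: val; lia.
Qed.

Definition arc_len i := cw L (h i) (t i).
Definition good b q := b < n /\ exists2 P, P %% L = h b /\ P <= q &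
  forall i P', i < n -> P' %% L = h i -> P' <= q -> P' + arc_len i <= P + arc_len b.
Definition owner_table s own :=
  (forall i, i < n -> arr s own (h i) = i.+1) /\
  (forall j, j < L -> arr s own j = 0 \/ exists i, [/\ i < n, h i = j & arr s own j = i.+1]).

Variables H T own best : nat.
Hypotheses (hH : own != H) (hT : own != T) (bH : best != H) (bT : best != T)
  (ob : own != best).
Hypotheses (hL : forall i, i < n -> h i < L) (tL : forall i, i < n -> t i < L).
Hypotheses (h_inj : forall i j, i < n -> j < n -> h i = h j -> i = j).
Hypothesis ht : forall i, i < n -> h i != t i.

Lemma arc_len_lt i : arc_len i < L.
Proof. by apply: cw_lt; lia. Qed.

Lemma arc_len_gt0 i : i < n -> 0 < arc_len i.
Proof.
move=> ilt; have := hL ilt; have := tL ilt; have := ht ilt.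
by rewrite /arc_len => ne h1 h2; rewrite cw_if //; case: (leqP (h i) (t i)); lia.
Qed.

Lemma owners_ok s : base s -> var s 2 = 0 ->
  (forall i, i < n -> arr s H i = h i) -> (forall j, j < L -> arr s own j = 0) ->
  run_ok B (for_ 2 (Var 0) (SetArr own (Get H (Var 2)) (Op OpAdd (Var 2) (Cst 1)))) s
    (n.+1 * 14) (fun s' => [/\ base s', owner_table s' own &
      forall (a : nat) i, a != own -> arr s' a i = arr s a i]).
Proof.
move=> [v0 v1] v2 sH sown.
pose I i s' := [/\ var s' 2 = i, base s', forall (a : nat) j, a != own -> arr s' a j = arr s a j,
  forall j, j < i -> arr s' own (h j) = j.+1 &
  forall j, j < L -> arr s' own j = 0 \/
    exists k, [/\ k < i, h k = j & arr s' own j = k.+1]].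
suff r : run_ok B (for_ 2 (Var 0) (SetArr own (Get H (Var 2)) (Op OpAdd (Var 2) (Cst 1)))) s
    (n.+1 * 14) (I n).
  by apply: run_post r _ _ => [|s' [_ b keep o1 o2]]; [lia|split].
apply: (run_for (K := 6)).
- by lia.
- by move=> i s' [-> [e0 e1] _ _ _]; rewrite /= e0; split=> //; lia.
- move=> i s' ilt [e2 [e0 e1] keep o1 o2]; apply: run_wp_le => //.
  have hi := hL ilt; rewrite /= !e2 keep 1?eq_sym // sH // ?store_simp /=.
  split; [by do ![split=> //]; lia|by do ![split=> //]; lia|split=> //].
  split=> // [a j ad|j|]; rewrite ?store_simp.
  - by rewrite (negPf ad) /= keep.
  - rewrite ltnS => jle; rewrite eqxx /=.
    case: eqP => [e|ne]; first by rewrite (h_inj _ ilt e) ?addn1 //; lia.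
    by apply: o1; have : j <> i by [move=> e; case: ne; rewrite e]; lia.
  move=> j jL; rewrite !arr_set_arr eqxx /=; case: eqP => [->|ne].
    by right; exists i; rewrite addn1.
  case: (o2 j jL) => [->|[k [kl hk ->]]]; first by left.
  by right; exists k; split=> //; lia.
by split=> // j jL; left; exact: sown.
Qed.

Lemma good_step b q P : b < n -> P %% L = h b -> P <= q -> 
  (forall i P', i < n -> P' %% L = h i -> P' < q.+1 -> P' + arc_len i <= P + arc_len b) ->
  good b q.
Proof. by move=> bn mP Pq hP; split=> //; exists P. Qed.

(** At the place [L + j] of the second turn every arc has already had a copy start, so the best
    among the starts seen so far is the cyclic optimum. *)
Lemma good_best b j : j < L -> good b (L + j) ->
  forall i, i < n -> arc_len i + cw L (h b) j <= arc_len b + cw L (h i) j.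
Proof.
move=> jL [bn [P [mP PL] hP]] i ilt; have L0 : 0 < L by lia.
have last k : k < n -> exists Q, [/\ Q %% L = h k, Q <= L + j < Q + L &
    cw L (h k) j = L + j - Q].
  move=> kn; have hk := hL kn; have := cw_lt (h k) j L0.
  exists (L + j - cw L (h k) j); split; try lia.
  move: H0; rewrite cw_if //; case: (leqP (h k) j) => hkj _.
    have -> : L + j - (j - h k) = h k + L by lia.
    by rewrite modnDr modn_small.
  have -> : L + j - (j + L - h k) = h k by lia.
  by rewrite modn_small.
have [Q [mQ hQ ->]] := last i ilt; have [R [mR hR ->]] := last b bn.
have PR : P <= R.
  rewrite leqNgt; apply/negP => RP.
  by have h' := mod_gap (etrans mR (esym mP)) RP; arith.
have QL : Q <= L + j by arith.
by have h' := hP i Q ilt mQ QL; arith.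
Qed.

Lemma scan_ok s : base s ->
  (forall i, i < n -> arr s H i = h i) -> (forall i, i < n -> arr s T i = t i) ->
  (forall j, j < L -> arr s own j = 0) ->
  run_ok B (scan H T own best) s (500 * n + 500) (fun s' =>
    [/\ base s', owner_table s' own,
        forall (a : nat) i, a != own -> a != best -> arr s' a i = arr s a i &
        forall j, j < L -> arr s' best j < n /\ forall i, i < n ->
          arc_len i + cw L (h (arr s' best j)) j <= arc_len (arr s' best j) + cw L (h i) j]).
Proof.
move=> [v0 v1] sH sT sown; rewrite /scan.
(* Entries of [best] written during the first turn are provisional; a claim is made only about those
   with [L + j < q], rewritten in the second turn. *)
pose I q s' := [/\ [/\ var s' 3 = q, var s' 4 = q %% L, var s' 6 < n & var s' 5 < 3 * L],
  base s', owner_table s' own /\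
    (forall (a : nat) j, a != own -> a != best -> arr s' a j = arr s a j),
  (var s' 5 = 0 \/ exists P, [/\ P %% L = h (var s' 6), P < q &
     P + arc_len (var s' 6) = var s' 5]) /\
  (forall i P, i < n -> P %% L = h i -> P < q -> P + arc_len i <= var s' 5) &
  forall j, j < L -> L + j < q -> good (arr s' best j) (L + j)].
suff r : run_ok B (scan H T own best) s
    (2 + (n.+1 * 14 + (8 + (2 * L).+1 * 70))) (I (2 * L)).
  apply: run_post r _ _ => [|s' [_ b [o k] _ g]]; first by lia.
  split=> // j jL; have gj : good (arr s' best j) (L + j) by apply: g => //; lia.
  by split; [case: gj|exact: good_best].
apply: (run_seq (Q1 := fun s' => [/\ var s' 2 = 0, base s' & arr s' = arr s])).
  by apply: run_wp_le => //=; rewrite ?store_simp /=; do ![split=> //].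
move=> s1 [e2 b1 k1]; apply: run_seq.
  by apply: owners_ok => // *; rewrite k1; auto.
move=> s2 [[b20 b21] o2 k2].
apply: (run_seq (Q1 := I 0)).
  apply: run_wp_le => //=; rewrite ?store_simp /=.
  do ![split=> //]; rewrite ?store_simp /= ?mod0n //; try lia.
  by move=> a j ao ab; rewrite k2 // k1.
move=> {s1 s2 e2 b1 k1 b20 b21 o2 k2} s1 I0.
apply: (run_for (K := 40 + 20)); first by lia.
- move=> q s' [[-> _ _ _] [e0 e1] _ _ _]; rewrite /= !e1; do ![split=> //]; lia.
- move=> q s' qL [[e3 e4 e6 e5] [e0 e1] [[oa ob'] keep] [att mx] gd].
  have L0 : 0 < L by lia.
  have jL : q %% L < L by rewrite ltn_mod.
  have kH i : i < n -> arr s' H i = h i by move=> ?; rewrite keep 1?eq_sym // sH.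
  have kT i : i < n -> arr s' T i = t i by move=> ?; rewrite keep 1?eq_sym // sT.
  pose J s'' := [/\ [/\ var s'' 3 = q, var s'' 4 = q %% L, var s'' 6 < n &
      var s'' 5 < 3 * L],
    base s'', arr s'' = arr s',
    (var s'' 5 = 0 \/ exists P, [/\ P %% L = h (var s'' 6), P <= q &
       P + arc_len (var s'' 6) = var s'' 5]) &
    (forall i P, i < n -> P %% L = h i -> P <= q -> P + arc_len i <= var s'' 5)].
  apply: (run_seq (K1 := 40) (K2 := 20) (Q1 := J)).
    have eq_q i P : i < n -> P %% L = h i -> P <= q -> P <> q -> P + arc_len i <= var s' 5.
      by move=> ilt mP Pq Pne; apply: mx => //; lia.
    apply: run_wp_le => //=; rewrite e4.
    case: (ob' _ jL) => [z|[u [un hu ou]]].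
      rewrite z /=; split; first by split=> //; lia.
      split=> //; first by case: att => [|[P [? ? ?]]]; [left|right; exists P; split=> //; lia].
      move=> i P ilt mP Pq; apply: eq_q => // e; have := oa i ilt.
      by rewrite -mP e z.
    have lu := arc_len_lt u; rewrite ou /= subn1 /=.
    split; first by split=> //; lia.
    split; first by do ![split=> //]; lia.
    have hL' := hL un; have tL' := tL un.
    apply: wp_put_cw; rewrite /= ?store_simp /= ?e1 ?kH ?kT //.
    - by do ![split=> //]; lia.
    - by do ![split=> //]; lia.
    - by lia.
    rewrite -/(arc_len u) e3.
    split; first by do ![split=> //]; case: (ltnP (var s' 5) (q + arc_len u)); lia.
    case: (ltnP (var s' 5) (q + arc_len u)) => cmp /=.
      split; first by do ![split=> //]; lia.
      split; first by lia.
      split; rewrite ?store_simp /=; [split=> //; lia|by split|by []| |].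
        by right; exists q; split=> //; rewrite hu.
      move=> i P ilt mP Pq; case: (P =P q) => [e|ne]; last first.
        by have := eq_q i P ilt mP Pq ne; lia.
      by rewrite (h_inj ilt un) ?e // -mP e hu.
    split; rewrite ?store_simp /=; [split=> //; lia|by split|by []| |].
      by case: att => [|[P [? ? ?]]]; [left|right; exists P; split=> //; lia].
    move=> i P ilt mP Pq; case: (P =P q) => [e|ne]; last by exact: eq_q.
    by rewrite (h_inj ilt un) ?e // -mP e hu.
  move=> s'' [[j3 j4 j6 j5] [j0 j1] ja jatt jmx]; apply: run_wp_le => //=.
  rewrite ?store_simp /= j4 j1.
  have jq : var s'' 3 = q by [].
  set b := var s'' 6 in j6 jatt *.
  have fin s4 : base s4 -> var s4 3 = q -> var s4 4 = q.+1 %% L -> var s4 6 = b ->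
      var s4 5 = var s'' 5 -> arr s4 = arr (set_arr s'' best (q %% L) b) ->
      var s4 3 = q /\ I q.+1 (set_var s4 3 q.+1).
    move=> [b0 b1] v3 v4 v6 v5 a4; split; first by [].
    split; rewrite ?store_simp /= ?v6 ?v5; [by split|by split| | |].
    - split; [split=> i iltn; rewrite a4 arr_set_arr (negPf ob) /= ja|].
      + exact: oa.
      + exact: ob'.
      by move=> a j ao ab; rewrite a4 arr_set_arr (negPf ab) /= ja keep.
    - split; last by move=> i P ilt mP Pq; apply: jmx.
      by case: jatt => [|[P [? ? ?]]]; [left|right; exists P].
    move=> j jl jq1; rewrite a4 arr_set_arr eqxx /=.
    have mq : q < L /\ q %% L = q \/ L <= q /\ q %% L = q - L.
      case: (ltnP q L) => ql; [left|right]; first by rewrite modn_small.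
  by rewrite -{1}(subnK ql) modnDr modn_small //; arith.
    case: eqP => [ej|nj]; last by rewrite ja; apply: gd => //; lia.
    have jq2 : q = L + j by lia.
    (* A positive record means that variable 6 holds the arc attaining it and not just its initial
       0. *)
    have Mpos : 0 < var s'' 5.
      have l0 := arc_len_gt0 n0; have h0 := hL n0.
      have h0L : h 0 <= q by arith.
      by have h' := jmx 0 (h 0) n0 (modn_small h0) h0L; arith.
    case: jatt => [|[P [mP Pq eP]]]; first by lia.
    apply: (good_step (P := P)) => //; first by rewrite -jq2.
    by move=> i P' ilt mP' P'q; rewrite eP; apply: jmx => //; arith.
  have L1 : 1 < L by arith.
  have := succ_mod q L1; rewrite /succ_label addn1 => sm.
  split; [by arith|by arith|split; first by do ![split=> //]; arith].
  split; first by do ![split=> //]; [arith|arith|case: eqP; arith].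
  pose s4 := set_var (set_arr s'' best (q %% L) b) 4 (q %% L).+1.
  case: eqP sm => [e|ne] sm /=; last exact: (fin s4).
  by split; [|exact: (fin (set_var s4 4 0))].
exact: I0.
Qed.
End Scan.

(** * Partner table and measurement of one greedy step *)

Definition put_owner x e :=
  If (Get 5 e) (SetVar x (Op OpSub (Get 5 e) (Cst 1)))
    (SetVar x (Op OpSub (Get 9 (mirror e)) (Cst 1))).

Definition put_pred x e :=
  If e (SetVar x (Op OpSub e (Cst 1))) (SetVar x (Op OpSub (Var 1) (Cst 1))).

Definition put_succ x e :=
  If (Op OpEq (Op OpAdd e (Cst 1)) (Var 1)) (SetVar x (Cst 0))
    (SetVar x (Op OpAdd e (Cst 1))).

Definition partners :=
  SetVar 2 (Cst 0) ;;
  for_ 2 (Var 0)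
    (SetVar 3 (Get 6 (Get 1 (Var 2))) ;;
     If (Op OpEq (Var 3) (Var 2))
       (put_pred 4 (Get 1 (Var 2)) ;; put_owner 3 (Var 4)) Skip ;;
     SetArr 11 (Var 2) (Var 3)).

(* For the label [Var 3] of a position [G]: the vertices (4, 5, 6) and the
   distances from [G] (7, 8, 9) of [near G], [far (near G)] and [advance G]. *)
Definition measure_advance :=
  SetVar 4 (Get 8 (mirror (Var 3))) ;;
  SetVar 5 (Get 6 (Get 1 (Var 4))) ;;
  SetVar 6 (Get 6 (Get 1 (Var 5))) ;;
  put_cw 7 (Var 3) (Get 0 (Var 4)) ;;
  put_cw 10 (Get 0 (Var 4)) (Get 1 (Var 4)) ;;
  SetVar 7 (Op OpAdd (Var 7) (Var 10)) ;;
  put_cw 10 (Get 1 (Var 4)) (Get 1 (Var 5)) ;;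
  SetVar 8 (Op OpAdd (Var 7) (Var 10)) ;;
  put_cw 10 (Get 1 (Var 5)) (Get 1 (Var 6)) ;;
  SetVar 9 (Op OpAdd (Var 8) (Var 10)).

Section Program.
Variables (n B : nat) (F : arc_model n).
Local Notation L := n.*2.
Local Notation copy := (copy F).
Local Notation len := (len F).
Local Notation far := (far F).
Local Notation near := (near F).
Local Notation advance := (advance F).
Hypotheses (LB : 8 * L <= B).
Implicit Types (s : store) (u v w x y : 'I_n).

Lemma n_gt0 : 0 < n. Proof. by have := L_gt0 F; rewrite double_gt0. Qed.

Section Tables.
Variables (bf bn bb ow : nat -> 'I_n).

Record tables s : Prop := Tables {
  t_base : base n s;
  t_hd : forall v, arr s 0 v = hd F v;
  t_tl : forall v, arr s 1 v = tl F v;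
  t_far : forall j, j < L -> arr s 6 j = bf j /\ far_label F j (bf j);
  t_near : forall j, j < L -> arr s 8 (L.-1 - j) = bn j /\ near_label F j (bn j);
  t_back : forall j, j < L -> arr s 10 (L.-1 - j) = bb j /\ back_label F j (bb j);
  t_own : forall j, j < L -> owns F j (ow j) /\
    (arr s 5 j = (ow j).+1 \/ arr s 5 j = 0 /\ arr s 9 (L.-1 - j) = (ow j).+1);
  t_tail : forall v, arr s 9 (L.-1 - tl F v) = v.+1 }.

Lemma tables_ext s s' : base n s' ->
  (forall a i, a != 2 -> a < 11 -> arr s' a i = arr s a i) -> tables s -> tables s'.
Proof.
move=> b e [_ t0 t1 t6 t8 t10 t5 t9]; split=> //.
- by move=> v; rewrite e.
- by move=> v; rewrite e.
- by move=> j /t6; rewrite e.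
- by move=> j /t8; rewrite e.
- by move=> j /t10; rewrite e.
- by move=> j /t5; rewrite !e.
by move=> v; rewrite e.
Qed.

Lemma put_owner_ok (x : nat) e Q s : tables s -> fits B s e -> den s e < L ->
  Q (set_var s x (ow (den s e))) -> wp B (put_owner x e) Q s.
Proof.
move=> ts fe eL q; have [_ t1] := t_base ts; have [_ h] := t_own ts eL.
have oL := ltn_ord (ow (den s e)).
rewrite /put_owner /= t1 ?subn1.
case: h => [h|[h1 h2]]; first by rewrite h; do ![split=> //]; lia.
by rewrite h1 h2; do ![split=> //]; lia.
Qed.

Lemma put_pred_ok (x : nat) e Q s : base n s -> fits B s e -> den s e < L ->
  Q (set_var s x (pred_label n (den s e))) -> wp B (put_pred x e) Q s.
Proof.
move=> [_ t1] fe eL; rewrite /put_pred /pred_label /= t1 !subn1.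
by case: eqP => e0 /= q; do ![split=> //]; lia.
Qed.

Lemma put_succ_ok (x : nat) e Q s : base n s -> fits B s e -> den s e < L ->
  Q (set_var s x (succ_label n (den s e))) -> wp B (put_succ x e) Q s.
Proof.
move=> [_ t1] fe eL; rewrite /put_succ /succ_label /= t1 addn1.
by case: eqP => e0 /= q; do ![split=> //]; lia.
Qed.

Definition tail_partner_of v :=
  if bf (tl F v) == v then ow (pred_label n (tl F v)) else bf (tl F v).

Definition head_partner_of v :=
  if bb (hd F v) == v then ow (succ_label n (hd F v)) else bb (hd F v).


Opaque put_owner put_pred put_succ.

Lemma partners_ok s : tables s -> run_ok B partners s (500 * n + 500) (fun s' =>
  [/\ base n s', forall a i, a != 11 -> arr s' a i = arr s a i &
      forall v, arr s' 11 v = tail_partner_of v]).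
Proof.
move=> ts; have n0 := n_gt0.
pose I i s' := [/\ var s' 2 = i, base n s',
  forall a j, a != 11 -> arr s' a j = arr s a j &
  forall v, v < i -> arr s' 11 v = tail_partner_of v].
suff r : run_ok B partners s (2 + n.+1 * (1 + 60 + 7)) (I n).
  by apply: run_post r _ _ => [|s' [_ b k h]]; [lia|split=> // v; apply: h].
have [t0 t1] := t_base ts.
apply: (run_seq (Q1 := I 0)); first by apply: run_wp_le => //=; do ![split=> //].
move=> s1; apply: run_for; first by lia.
  by move=> i s' [-> [e0 e1] _ _]; rewrite /= e0; split=> //; lia.
move=> i s' ilt [e2 b' k h]; have [e0 e1] := b'; apply: run_wp_le; first by vm_compute.
rewrite /=.
have ts' : tables s' by apply: tables_ext ts => // a j a2 a11; apply: k; lia.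
pose v := Ordinal ilt; have ei : i = v by [].
have tL := tl_lt F v; have [bE _] := t_far ts' tL; have bL := ltn_ord (bf (tl F v)).
rewrite e2 ei (t_tl ts') bE.
split; first by do ![split=> //]; lia.
rewrite ?store_simp /= ?e2 ?ei.
have fin s2 z : base n s2 -> var s2 2 = v -> var s2 3 = z -> z < n -> arr s2 = arr s' ->
    z = tail_partner_of v ->
    [/\ var s2 2 <= B, var s2 3 <= B &
      var s2 2 = v /\ I v.+1 (set_var (set_arr s2 11 (var s2 2) (var s2 3)) 2 v.+1)].
  move=> b2 v2 v3 zn a2 ez; rewrite v2 v3; split; [lia|lia|split; first by []].
  split; rewrite ?store_simp //=.
    by move=> a j ane; rewrite ?store_simp (negPf ane) /= a2 k.
  move=> u; rewrite ltnS => uv; rewrite /= ?v2 ?v3.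
  have [e|ne] := eqVneq (nat_of_ord u) v.
    by rewrite ez; congr (nat_of_ord (tail_partner_of _)); apply: val_inj.
  by rewrite a2; apply: h; rewrite ei; lia.
split; first by do ![split=> //]; try (apply: leq_trans (leq_b1 _) _); lia.
have [e|ne] /= := eqVneq (nat_of_ord (bf (tl F v))) v; last first.
  have f := fin (set_var s' 3 (bf (tl F v))) (bf (tl F v)).
  rewrite /= e2 ei in f; apply: f => //.
  by rewrite /tail_partner_of; case: eqP => // e; case/eqP: ne; rewrite e.
apply: put_pred_ok => //=; rewrite ?store_simp /= ?e2 ?ei ?(t_tl ts') //.
  by do ![split=> //]; lia.
have pL : pred_label n (tl F v) < L by rewrite /pred_label; case: eqP; lia.
set p := pred_label n (tl F v) in pL *.
have ts2 : tables (set_var (set_var s' 3 (bf (tl F v))) 4 p) by apply: tables_ext ts'.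
apply: (put_owner_ok ts2) => //=; first by lia.
have f := fin (set_var (set_var (set_var s' 3 (bf (tl F v))) 4 p) 3 (ow p)) (ow p).
apply: f => //; rewrite /tail_partner_of.
by have -> : bf (tl F v) = v by [apply: val_inj]; rewrite eqxx.
Qed.

Definition measured s g := let v := bn g in
  let a := bf (tl F v) in let b := bf (tl F a) in
  [/\ var s 4 = v, var s 5 = a, var s 6 = b &
   [/\ var s 7 = cw L g (hd F v) + len v,
       var s 8 = cw L g (hd F v) + len v + cw L (tl F v) (tl F a) &
       var s 9 = cw L g (hd F v) + len v + cw L (tl F v) (tl F a) + cw L (tl F a) (tl F b)]].

Lemma measure_ok g Q s : tables s -> var s 3 = g -> g < L ->
  (forall s', arr s' = arr s -> (forall y : nat, (y <= 3) || (10 < y) -> var s' y = var s y) ->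
     measured s' g -> Q s') -> wp B measure_advance Q s.
Proof.
move=> ts v3 gL q; have [t0 t1] := t_base ts.
have [nE _] := t_near ts gL; set v := bn g in nE.
have vL := tl_lt F v; have vH := hd_lt F v; have vn := ltn_ord v.
have [aE _] := t_far ts vL; set a := bf _ in aE.
have aL := tl_lt F a; have an := ltn_ord a.
have [bE _] := t_far ts aL; set b := bf _ in bE.
have bL := tl_lt F b; have bn' := ltn_ord b.
have lv := len_lt F v; have L0 := L_gt0 F.
have l1 := cw_lt g (hd F v) L0; have l2 := cw_lt (tl F v) (tl F a) L0.
have l3 := cw_lt (tl F a) (tl F b) L0.
have h0 := t_hd ts; have h1 := t_tl ts.
rewrite /measure_advance /= v3 t1 subn1 nE.
split; first by do ![split=> //]; lia.
rewrite ?store_simp /= h1 aE; split; first by do ![split=> //]; lia.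
rewrite ?store_simp /= h1 bE; split; first by do ![split=> //]; lia.
apply: wp_put_cw; rewrite /= ?store_simp /= ?v3 ?t1 ?h0 ?h1 //; try (do ?[split=> //]; lia).
apply: wp_put_cw; rewrite /= ?store_simp /= ?v3 ?t1 ?h0 ?h1 //; try (do ?[split=> //]; lia).
rewrite -/(len v); split; first by do ![split=> //]; lia.
apply: wp_put_cw; rewrite /= ?store_simp /= ?v3 ?t1 ?h0 ?h1 //; try (do ?[split=> //]; lia).
split; first by do ![split=> //]; lia.
apply: wp_put_cw; rewrite /= ?store_simp /= ?v3 ?t1 ?h0 ?h1 //; try (do ?[split=> //]; lia).
split; first by do ![split=> //]; lia.
apply: q => //.
by move=> y; do 11 (case: y => [|y] //=).
Qed.
End Tables.
End Program.
Global Opaque measure_advance put_owner put_pred put_succ.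

(* Reversing the circle turns the label j into L - 1 - j, heads into tails and
   the search for the first head into the search for the last tail; reversing
   it without exchanging heads and tails gives the complementary arcs, for which
   the last tail is the first tail of the arcs that start after the label.
   Array 6 is thus indexed by labels, arrays 8, 9 and 10 by reversed labels. *)
Definition prepare :=
  SetVar 1 (Op OpAdd (Var 0) (Var 0)) ;;
  mirror_table 0 3 ;; mirror_table 1 4 ;;
  scan 0 1 5 6 ;; scan 3 4 7 8 ;; scan 4 3 9 10.

Lemma cw_mirror m x y : x < m -> y < m -> cw m (m.-1 - x) (m.-1 - y) = cw m y x.
Proof.
move=> xm ym; rewrite !cw_if; try lia.
by case: (leqP (m.-1 - x) (m.-1 - y)); case: (leqP y x); lia.
Qed.

Lemma cw_compl m x y : x < m -> y < m -> x != y -> cw m y x = m - cw m x y.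
Proof.
by move=> xm ym xy; rewrite !cw_if //; case: (leqP x y); case: (leqP y x); lia.
Qed.

Section Prepare.
Variables (n B : nat) (F : arc_model n).
Local Notation L := n.*2.
Local Notation len := (len F).
Hypothesis LB : 8 * L <= B.
Implicit Types (s : store) (u v w : 'I_n).

Lemma prepare_ok : run_ok B prepare (input_store F) (1600 * n + 1600) (fun s =>
  (exists bf bn bb ow, tables F bf bn bb ow s) /\
  forall a i, (a == 2) || (10 < a) -> arr s a i = 0).
Proof.
have n0 := n_gt0 F.
pose h := arr (input_store F) 0; pose t := arr (input_store F) 1.
have hE v : h v = hd F v by rewrite /h /= valK.
have tE v : t v = tl F v by rewrite /t /= valK.
have ordE i : i < n -> exists v : 'I_n, i = v by move=> ilt; exists (Ordinal ilt).
have hL i : i < n -> h i < L by move=> /ordE[v ->]; rewrite hE hd_lt.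
have tL i : i < n -> t i < L by move=> /ordE[v ->]; rewrite tE tl_lt.
have h_inj i j : i < n -> j < n -> h i = h j -> i = j.
  by move=> /ordE[v ->] /ordE[w ->]; rewrite !hE => /ord_inj/(@hd_inj _ F) ->.
have t_inj i j : i < n -> j < n -> t i = t j -> i = j.
  by move=> /ordE[v ->] /ordE[w ->]; rewrite !tE => /ord_inj/(@tl_inj _ F) ->.
have ht i j : i < n -> j < n -> h i != t j.
  by move=> /ordE[v ->] /ordE[w ->]; rewrite hE tE; exact: hd_neq_tl.
pose rh i := L.-1 - h i; pose rt i := L.-1 - t i.
have rhL i : i < n -> rh i < L by move=> ilt; rewrite /rh; lia.
have rtL i : i < n -> rt i < L by move=> ilt; rewrite /rt; lia.
have rh_inj i j : i < n -> j < n -> rh i = rh j -> i = j.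
  move=> il jl e; apply: h_inj => //.
  by have := hL i il; have := hL j jl; move: e; rewrite /rh; lia.
have rt_inj i j : i < n -> j < n -> rt i = rt j -> i = j.
  move=> il jl e; apply: t_inj => //.
  by have := tL i il; have := tL j jl; move: e; rewrite /rt; lia.
have rht i : i < n -> rh i != rt i.
  by move=> il; have := ht i i il il; have := hL i il; have := tL i il; rewrite /rh /rt; lia.
pose zero s b := forall a i, (a == 2) || (b < a) -> arr s a i = 0.
suff r : run_ok B prepare (input_store F) (4 + ((20 * n + 20) + ((20 * n + 20) +
    ((500 * n + 500) + ((500 * n + 500) + (500 * n + 500)))))) (fun s =>
    (exists bf bn bb ow, tables F bf bn bb ow s) /\ zero s 10).
  by apply: run_post r _ _ => //; lia.
apply: (run_seq (Q1 := fun s => base n s /\ arr s = arr (input_store F))).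
  by apply: run_wp_le => //=; do ![split=> //]; rewrite /= ?addnn //; lia.
move=> s1 [b1 e1]; apply: run_seq.
  by apply: (@mirror_table_ok _ _ n0 LB 0 3) => // i ilt; rewrite e1; exact: hL.
move=> s2 [b2 k2 v2]; apply: run_seq.
  by apply: (@mirror_table_ok _ _ n0 LB 1 4) => // i ilt; rewrite k2 // e1; exact: tL.
move=> s3 [b3 k3 v3].
have sh i : arr s3 0 i = h i by rewrite k3 // k2 // e1.
have st i : arr s3 1 i = t i by rewrite k3 // k2 // e1.
have srh i : i < n -> arr s3 3 i = rh i by move=> il; rewrite k3 // v2 // e1.
have srt i : i < n -> arr s3 4 i = rt i by move=> il; rewrite v3 // k2 // e1.
have z3 : zero s3 4.
  move=> a i ha; rewrite k3 ?k2 ?e1; try by apply: contraTneq ha => ->.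
  by rewrite /=; case: a ha => [|[|[|a]]].
apply: run_seq.
  apply: (scan_ok n0 LB _ _ _ _ _ hL tL h_inj (fun i il => ht i i il il) b3) => //.
  by move=> j _; rewrite z3.
move=> s4 [b4 o4 k4 f4]; apply: run_seq.
  apply: (scan_ok n0 LB _ _ _ _ _ rhL rtL rh_inj rht b4) => //.
  - by move=> i il; rewrite k4 // srh.
  - by move=> i il; rewrite k4 // srt.
  by move=> j _; rewrite k4 // z3.
move=> s5 [b5 _ k5 f5].
have rth i : i < n -> rt i != rh i by move=> il; rewrite eq_sym rht.
apply: run_post; [apply: (scan_ok n0 LB _ _ _ _ _ rtL rhL rt_inj rth b5) => //| |].
- by move=> i il; rewrite k5 // k4 // srt.
- by move=> i il; rewrite k5 // k4 // srh.
- by move=> j _; rewrite k5 // k4 // z3.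
- exact: leqnn.
move=> s [b [o1 o2] k f]; split; last first.
  move=> a i ha.
  have ne c : c <= 10 -> c != 2 -> a != c by move=> c1 c2; apply: contraTneq ha => ->; lia.
  by rewrite k ?k5 ?k4 ?z3 ?ne //; lia.
have kk a i : a <= 6 -> arr s a i = arr s4 a i by move=> ha; rewrite k ?k5; lia.
pose vx i : 'I_n := insubd (vfirst F) i.
have vxE i : i < n -> i = vx i by move=> il; rewrite /vx val_insubd il.
have vxK v : vx v = v by rewrite /vx valKd.
have lenE v : arc_len n h t v = len v by rewrite /arc_len hE tE.
have jr j : j < L -> L.-1 - j < L by lia.
have own9 v : arr s 9 (L.-1 - tl F v) = v.+1.
  by rewrite -tE; apply: o1.
exists (fun j => vx (arr s 6 j)), (fun j => vx (arr s 8 (L.-1 - j))),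
  (fun j => vx (arr s 10 (L.-1 - j))),
  (fun j => if arr s 5 j == 0 then vx (arr s 9 (L.-1 - j)).-1 else vx (arr s 5 j).-1).
split=> //.
- by move=> v; rewrite kk // k4 // sh hE.
- by move=> v; rewrite kk // k4 // st tE.
- move=> j jL; have [fn fm] := f4 j jL; rewrite kk //; split; first exact: vxE.
  move=> i; have := fm i (ltn_ord i); have [b' ->] := ordE _ fn.
  by rewrite vxK !lenE !hE.
- move=> j jL; have [fn fm] := f5 _ (jr j jL).
  have -> : arr s 8 (L.-1 - j) = arr s5 8 (L.-1 - j) by rewrite k.
  split; first exact: vxE.
  move=> i; have := fm i (ltn_ord i); have [b' ->] := ordE _ fn; rewrite vxK.
  have rl v : arc_len n rh rt v = L - len v.
    rewrite /arc_len /rh /rt cw_mirror ?hL ?tL // hE tE cw_compl ?hd_lt ?tl_lt //.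
    exact: hd_neq_tl.
  rewrite !rl /rh !cw_mirror ?hL // !hE.
  by have := len_lt F i; have := len_lt F b'; lia.
- move=> j jL; have [fn fm] := f _ (jr j jL); split; first exact: vxE.
  move=> i; have := fm i (ltn_ord i); have [b' ->] := ordE _ fn; rewrite vxK.
  have rl v : arc_len n rt rh v = len v.
    by rewrite /arc_len /rh /rt cw_mirror ?hL ?tL // hE tE.
  by rewrite !rl /rt !cw_mirror ?tL // !tE.
move=> j jL; have [oa ob] := o4.
have e5 i : arr s 5 i = arr s4 5 i by rewrite kk.
rewrite e5; case: (ob j jL) => [z|[i [il hi ei]]].
  rewrite z eqxx; have [u [hu|hu]] := label_owner F jL.
    by have := oa u (ltn_ord u); rewrite hE hu z.
  rewrite -hu own9 /= -(vxE u (ltn_ord u)); split.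
    by right; congr (nat_of_ord (tl F _)); apply: val_inj; rewrite /= -vxE.
  by right.
by rewrite ei /= -(vxE i il); split; [left; rewrite -hE -vxE|left].
Qed.
End Prepare.

(** * Following the orbit and choosing the starting arc *)

Definition settle :=
  (SetVar 3 (Get 1 (Cst 0)) ;; SetVar 2 (Cst 0)) ;;
  for_ 2 (Op OpAdd (Var 0) (Cst 1))
    (measure_advance ;; SetVar 3 (Get 1 (Var 6))).

(* [Var 11] is the distance from the current position to the next tail of the
   first vertex. *)
Definition cross :=
  (put_cw 11 (Var 3) (Get 1 (Cst 0)) ;;
   If (Var 11) Skip (SetVar 11 (Var 1)) ;; measure_advance) ;;
  While (Op OpLt (Var 9) (Var 11))
    (SetVar 11 (Op OpSub (Var 11) (Var 9)) ;; SetVar 3 (Get 1 (Var 6)) ;;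
     measure_advance).

(** Array 9 yields the vertex whose tail is the current frontier. The last assignment passes from
    the crossing arc to the arc reaching farthest from its head, which is the maximal one. *)
Definition select :=
  If (Op OpLt (Var 11) (Var 7))
    (SetVar 12 (Op OpSub (Get 9 (mirror (Var 3))) (Cst 1)))
    (If (Op OpLt (Var 8) (Var 11)) (SetVar 12 (Var 6)) (SetVar 12 (Var 5))) ;;
  SetVar 12 (Get 6 (Get 0 (Var 12))).

Section Select.
Variables (n B : nat) (F : arc_model n).
Local Notation L := n.*2.
Local Notation copy := (copy F).
Local Notation len := (len F).
Local Notation far := (far F).
Local Notation near := (near F).
Local Notation advance := (advance F).
Hypothesis LB : 8 * L <= B.
Variables (bf bn bb ow : nat -> 'I_n).
Local Notation tables := (tables F bf bn bb ow).
Local Notation measured := (measured F bf bn).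
Implicit Types (s : store) (u v w : 'I_n).

(** Four turns up, as [crossing_candidate] requires, so that no backward shift falls below 0. *)
Definition start_pos := 4 * L + tl F (vfirst F).
Local Notation pos i := (iter i advance start_pos).

Definition selected w R c := exists l x P, [/\ n <= l,
  c %% L = tl F (vfirst F), pos l.+1 < c <= advance (pos l.+1),
  copy x P & [/\ P + len x = crossing_tail F (pos l.+1) c,
  copy w R, R <= P & R + len w = far P]].

Lemma start_posL : L <= start_pos.
Proof. by rewrite /start_pos; lia. Qed.

Lemma start_pos_tail : is_tail F start_pos.
Proof.
have [|P cP eP] := @tail_copy n F (vfirst F) start_pos _ start_posL; last first.
  by exists (vfirst F), P.
by rewrite /start_pos modnMDl modn_small ?tl_lt.
Qed.

Lemma posL i : L <= pos i.
Proof. exact: leq_trans start_posL (iter_advance_ge _ _ start_posL). Qed.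

Lemma pos_tail i : is_tail F (pos i).
Proof. exact: iter_advance_tail start_posL start_pos_tail. Qed.

Lemma measured_advance s G : tables s -> L <= G -> is_tail F G ->
  measured s (G %% L) ->
  [/\ near G = G + var s 7, far (near G) = G + var s 8, advance G = G + var s 9 &
    [/\ exists (v : 'I_n) P, [/\ var s 4 = v, copy v P, G < P & P + len v = near G],
        exists (a : 'I_n) P, [/\ var s 5 = a, copy a P & P + len a = far (near G)] &
        exists (b : 'I_n) P, [/\ var s 6 = b, copy b P & P + len b = advance G]]].
Proof.
move=> ts LG tG [e4 e5 e6 [e7 e8 e9]]; have L0 := L_gt0 F.
have gL : G %% L < L by rewrite ltn_mod.
have [_ hn] := t_near ts gL.
have hf j : j < L -> far_label F j (bf j) by move=> jL; have [] := t_far ts jL.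
have [[P [cP GP eP]] eN [Q cQ eQ] eF [[R cR eR] eA]] := measure LG tG hn hf.
rewrite e7 e8 e9 eA eF eN !addnA; split=> //; split.
- by exists (bn (G %% L)), P; split=> //; rewrite eP eN !addnA.
- by eexists; exists Q; split; [exact: e5|exact: cQ|rewrite eQ eF eN !addnA].
by eexists; exists R; split; [exact: e6|exact: cR|rewrite eR eA eF eN !addnA].
Qed.

Lemma measured_bound s g : measured s g ->
  var s 7 <= var s 8 <= var s 9 /\ var s 9 < 4 * L.
Proof.
case=> _ _ _ [-> -> ->]; have L0 := L_gt0 F; set v := bn g; set a := bf _.
have := cw_lt g (hd F v) L0; have := len_lt F v.
have := cw_lt (tl F v) (tl F a) L0; have := cw_lt (tl F a) (tl F (bf (tl F a))) L0.
by move: (cw _ _ _) (len v) (cw _ _ _) (cw _ _ _) => *; split; lia.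
Qed.

Lemma settle_ok s : tables s -> run_ok B settle s (500 * n + 500) (fun s' =>
  [/\ tables s', arr s' = arr s & var s' 3 = pos n.+1 %% L]).
Proof.
move=> ts; have n0 := n_gt0 F; have L0 := L_gt0 F; have [t0 t1] := t_base ts.
have s10 : arr s 1 0 = tl F (vfirst F) by rewrite -(t_tl ts) vfirst0.
pose I i s' := [/\ var s' 2 = i, tables s', arr s' = arr s & var s' 3 = pos i %% L].
suff r : run_ok B settle s (5 + n.+2 * (3 + 150 + 7)) (I n.+1).
  by apply: run_post r _ _ => [|s' [_ t' a' v3]]; [lia|split].
apply: (run_seq (Q1 := I 0)).
  have tL := tl_lt F (vfirst F).
  apply: run_wp_le; rewrite //= s10; split; first by split; lia.
  split; first by [].
  split; [by []|by apply: tables_ext ts|by []|].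
  by rewrite /= /start_pos modnMDl modn_small ?tl_lt.
move=> s1; apply: run_for; first by lia.
  by move=> i s' [-> ts' _ _]; have [e0 _] := t_base ts'; rewrite /= e0; do ![split=> //]; lia.
move=> i s' ilt [e2 ts' a' e3]; apply: run_wp_le; first by vm_compute.
have gL : pos i %% L < L by rewrite ltn_mod.
rewrite /=; apply: (measure_ok LB ts' e3) => // s2 a2 v2 m2.
have ts2 : tables s2.
  have [e0 e1] := t_base ts'.
  by apply: tables_ext ts' => [|a j _ _]; [split; rewrite v2|rewrite a2].
have [_ _ _ [_ _ [b [P [eb cP eP]]]]] := measured_advance ts2 (posL i) (pos_tail i) m2.
have tL := tl_lt F b; have bn' := ltn_ord b.
rewrite /= eb (t_tl ts2); split; first by do ![split=> //]; lia.
split; first by rewrite v2.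
split=> //; [by apply: tables_ext (ts2); have [] := t_base ts2|by rewrite /= a2|].
by rewrite /= -(copy_tl cP) eP.
Qed.

(** The next tail of the first vertex is at most [L] ahead and each round reduces this distance, so
    the number of rounds is linear. *)
Lemma cross_ok s : tables s -> var s 3 = pos n.+1 %% L ->
  run_ok B cross s (1000 * n + 1000) (fun s' => [/\ tables s', arr s' = arr s &
    exists l c, [/\ n <= l, c %% L = tl F (vfirst F), pos l.+1 < c <= advance (pos l.+1) &
      [/\ var s' 3 = pos l.+1 %% L, measured s' (pos l.+1 %% L) & c = pos l.+1 + var s' 11]]]).
Proof.
move=> ts e3; have n0 := n_gt0 F; have L0 := L_gt0 F; have [t0 t1] := t_base ts.
have s10 : arr s 1 0 = tl F (vfirst F) by rewrite -(t_tl ts) vfirst0.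
have tL := tl_lt F (vfirst F).
have [c /andP[Tc cT] cmod] := mod_pos F (pos n.+1).+1 tL.
have Tc' : advance (pos n) < c by [].
pose I m s' := exists l, [/\ tables s', arr s' = arr s, n <= l,
  pos l.+1 < c & [/\ var s' 3 = pos l.+1 %% L, measured s' (pos l.+1 %% L),
  c = pos l.+1 + var s' 11, m = var s' 11 & m <= L]].
suff r : run_ok B cross s (200 + L.+1 * (4 + 150)) (fun s' => [/\ tables s', arr s' = arr s &
    exists l c, [/\ n <= l, c %% L = tl F (vfirst F), pos l.+1 < c <= advance (pos l.+1) &
      [/\ var s' 3 = pos l.+1 %% L, measured s' (pos l.+1 %% L) & c = pos l.+1 + var s' 11]]]).
  by apply: run_post r _ _ => //; lia.
pose m0 := c - pos n.+1; have m0L : m0 <= L by rewrite /m0; arith.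
have gL : pos n.+1 %% L < L by rewrite ltn_mod.
have remeasure l s2 : tables s2 -> arr s2 = arr s -> n <= l -> pos l.+1 < c ->
    var s2 3 = pos l.+1 %% L -> c = pos l.+1 + var s2 11 -> var s2 11 <= L ->
    wp B measure_advance (I (var s2 11)) s2.
  move=> ts2 a2 nl lc v3 ce v11.
  have glL : pos l.+1 %% L < L by rewrite ltn_mod.
  apply: (measure_ok LB ts2 v3) => // s' a' v' m'.
  have [b0 b1] := t_base ts2.
  exists l; rewrite !v' // a'; split=> //.
  by apply: tables_ext ts2 => [|a j _ _]; [split; rewrite v'|rewrite a'].
apply: (@run_seq _ _ _ _ _ _ (I m0)).
  apply: run_wp_le; first by vm_compute.
  rewrite /=; apply: wp_put_cw; rewrite /= ?e3 ?s10 ?t1 //; try (do ?[split=> //]; arith).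
  set d := cw _ _ _; have dm : d = (c - pos n.+1) %% L by rewrite /d -cmod cw_mod //; arith.
  have dL : d < L by rewrite dm ltn_mod.
  split; first by arith.
  (* The distance modulo [L] is 0 when the frontier sits on a tail of the first vertex; [c], being
     strictly ahead, is then a full turn away, whence the reset to [L]. *)
  have [lt|ge] := ltnP (c - pos n.+1) L.
    have d0 : d = m0 by rewrite dm modn_small.
    have dpos : d != 0 by rewrite d0 /m0; arith.
    rewrite dpos.
    have := @remeasure n (set_var s 11 d).
    rewrite /= d0; apply => //; [by apply: tables_ext ts|by rewrite /m0 /=; arith].
  have eL : m0 = L by rewrite /m0; arith.
  have -> : d = 0 by rewrite dm (_ : c - pos n.+1 = L) ?modnn; arith.
  rewrite /= ?t1; split; first by arith.
  have := @remeasure n (set_var (set_var s 11 0) 11 L).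
  rewrite /= eL; apply => //; [by apply: tables_ext ts|by move: eL; rewrite /m0 /=; arith].
move=> s1 I1; apply: run_post; [apply: (run_while (I := I) (K := 150) _ I1)| |]; last 1 first.
- by move=> s' q; exact: q.
- move=> m s' [l [ts' a' nl lc [v3 ms ce em mL]]].
  have [eN eF eA [_ _ [b [P [eb cP eP]]]]] := measured_advance ts' (posL _) (pos_tail _) ms.
  have [b0 b1] := t_base ts'; have tLb := tl_lt F b; have bn' := ltn_ord b.
  have near_lt := near_gt F (pos l.+1).
  split.
    have [c1 c2 c3] : [/\ var s' 9 <= B, var s' 11 <= B & 0 < B].
      by have [_ h] := measured_bound ms; split; arith.
    by rewrite /=; do ![split=> //]; apply: leq_trans (leq_b1 _) _.
  rewrite /=; case: (ltnP (var s' 9) (var s' 11)) => h /=; last first.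
    split=> //; exists l, c; split=> //; rewrite lc /=; move: h; rewrite {1}ce eA leq_add2l //.
  apply: run_wp_le; first by vm_compute.
  rewrite /= eb (t_tl ts'); split; first by do ![split=> //]; arith.
  split; first by do ![split=> //]; arith.
  apply: wp_mono (@remeasure l.+1 _ _ _ _ _ _ _ _) => [s2 I2|||||||].
  - exists (var s' 11 - var s' 9); last exact: I2.
    have := far_advance F (posL l.+1); have := near_far F (posL l.+1); arith.
  - by apply: tables_ext ts'.
  - exact: a'.
  - by arith.
  - by rewrite iterS eA; arith.
  - by rewrite iterS -eP (copy_tl cP).
  - by rewrite /= eA; arith.
  by rewrite /=; arith.
by rewrite /=; nia.
Qed.

Lemma select_ok s l c : tables s -> n <= l -> c %% L = tl F (vfirst F) ->
  pos l.+1 < c <= advance (pos l.+1) -> var s 3 = pos l.+1 %% L ->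
  measured s (pos l.+1 %% L) -> c = pos l.+1 + var s 11 ->
  run_ok B select s 100 (fun s' => [/\ tables s', arr s' = arr s &
    exists w R, var s' 12 = w /\ selected w R c]).
Proof.
move=> ts nl cmod cT e3 ms ce; have L0 := L_gt0 F.
have [t0 t1] := t_base ts; have LT := posL l.+1.
have [eN eF eA [_ [a [Pa [ea cPa ePa]]] [b [Pb [eb cPb ePb]]]]] :=
  measured_advance ts LT (pos_tail l.+1) ms.
have [u [Pu [cPu ePu]]] := pos_tail l.+1.
have eu : pos l.+1 %% L = tl F u by rewrite -(copy_tl cPu) ePu.
have [hm hB] := measured_bound ms.
have LT4 : 4 * L <= pos l.+1.
  by apply: leq_trans (iter_advance_ge F l.+1 start_posL); rewrite /start_pos leq_addr.
have cA : var s 11 <= var s 9 by move: cT; rewrite ce eA leq_add2l => /andP[].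
have fin (x : 'I_n) P s' : copy x P -> P + len x = crossing_tail F (pos l.+1) c ->
    pos l.+1 <= P + len x -> tables s' -> arr s' = arr s -> var s' 12 = x ->
    wp B (SetVar 12 (Get 6 (Get 0 (Var 12)))) (fun s' => [/\ tables s', arr s' = arr s &
      exists w R, var s' 12 = w /\ selected w R c]) s'.
  move=> cP eP TP ts' a' v12; have hx := hd_lt F x; have lx := len_lt F x.
  have [fE fl] := t_far ts' hx; have xn := ltn_ord x; have fn := ltn_ord (bf (hd F x)).
  have LP : L <= P by arith.
  have [R [cR /andP[RP _] eR]] : exists R, [/\ copy (bf (hd F x)) R, R <= P < R + L &
      R + len (bf (hd F x)) = far P].
    by apply: far_labelP => //; rewrite (eqP cP).
  rewrite /= v12 (t_hd ts') fE; split; first by do ![split=> //]; arith.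
  split; [by apply: tables_ext (ts'); have [] := t_base ts'|by rewrite /= a'|].
  exists (bf (hd F x)), R; split=> //.
  by exists l, x, P; split.
have T1 := near_gt F (pos l.+1).
apply: run_wp_le; first by vm_compute.
have ut := ltn_ord u; have ua := ltn_ord a; have ub := ltn_ord b.
have tu := tl_lt F u.
rewrite /select; change (wp B (If (Op OpLt (Var 11) (Var 7))
    (SetVar 12 (Op OpSub (Get 9 (mirror (Var 3))) (Cst 1)))
    (If (Op OpLt (Var 8) (Var 11)) (SetVar 12 (Var 6)) (SetVar 12 (Var 5))))
  (wp B (SetVar 12 (Get 6 (Get 0 (Var 12)))) (fun s' => [/\ tables s', arr s' = arr s &
    exists w R, var s' 12 = w /\ selected w R c])) s).
set Q := wp B (SetVar 12 _) _.
have ext x : tables (set_var s 12 x) by apply: tables_ext (ts).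
rewrite /= e3 eu t1 subn1 (t_tail ts) subn1 /= ea eb.
split; first by split; [arith|arith|apply: leq_trans (leq_b1 _) _; arith].
case: (ltnP (var s 11) (var s 7)) => h /=.
  split; first by do ![split=> //]; arith.
  apply: (fin u Pu) => //; last by rewrite ePu.
  have hN : c < near (pos l.+1) by rewrite eN {1}ce ltn_add2l.
  by rewrite ePu /crossing_tail hN.
have hN : (c < near (pos l.+1)) = false by rewrite eN {1}ce ltn_add2l ltnNge h.
split; first by split; [arith|arith|apply: leq_trans (leq_b1 _) _; arith].
case: (ltnP (var s 8) (var s 11)) => h2 /=.
  split; first by arith.
  apply: (fin b Pb) => //; last by rewrite ePb; arith.
  by rewrite /crossing_tail hN eF {1}ce leq_add2l leqNgt h2.
split; first by arith.
apply: (fin a Pa) => //; last by rewrite ePa; arith.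
have hF : c <= far (near (pos l.+1)) by rewrite eF {1}ce leq_add2l.
by rewrite /crossing_tail hN hF.
Qed.

Lemma selected_facts S w R c : paired_dominating (adj F) S -> selected w R c ->
  [/\ w \in start_vertices F, R <= c, c < near (R + len w), c %% L = tl F (vfirst F) &
  [/\ 3 * L <= R, copy w R,
    forall u P, copy u P -> P <= R -> R + len w <= P + len u -> u = w &
    forall pt ph, (forall v, tail_partner F v (pt v)) ->
      (forall v, head_partner F v (ph v)) ->
      forall Z, candidate F pt ph w Z -> #|Z| <= #|S|]].
Proof.
move=> pS [l [x [P [nl cmod cT cP [eP cR RP eR]]]]]; have L0 := L_gt0 F.
have LT := start_posL; have tT := start_pos_tail.
have LT4 : 4 * L <= start_pos by rewrite /start_pos leq_addr.
have [k0 hG] := paired_turn pS LT tT nl.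
have [_ hT] := paired_turn pS LT tT (leqW nl).
have LG : 4 * L <= pos l := leq_trans LT4 (iter_advance_ge F l LT).
have LG2 : 2 * L <= pos l by arith.
have [wW /andP[Rc _] cN _] := crossing LG2 cmod cT k0 hG hT cP eP cR RP eR.
have lw := len_lt F w; have lx := len_lt F x.
have LT1 : 4 * L <= pos l.+1 := leq_trans LT4 (iter_advance_ge F l.+1 LT).
have TP : pos l.+1 <= P + len x.
  have := near_gt F (pos l.+1); have := near_far F (posL l.+1).
  have := far_advance F (posL l.+1).
  by rewrite eP /crossing_tail; case: ifP => _; [|case: ifP => _]; arith.
have LP : L <= P by arith.
have far_P := far_max LP cP (leqnn P).
split=> //; split=> //; first by arith.
  move=> u Q cQ QR h; have QP : Q <= P by arith.
  have := far_max LP cQ QP => h2.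
  by apply: (tail_inj cQ cR); congr modn; arith.
move=> pt ph ptP phP Z cZ.
have [_ h] := crossing_candidate ptP phP LT4 tT nl cmod cT cP eP cR RP eR pS.
exact: h.
Qed.
End Select.

(** * Executing one run of the procedure *)

Definition choose_var x e e1 e2 := If e (SetVar x e1) (SetVar x e2).

Lemma wp_choose_var B (x : nat) e e1 e2 Q s : fits B s e -> fits B s e1 -> fits B s e2 ->
  Q (set_var s x (if den s e != 0 then den s e1 else den s e2)) ->
  wp B (choose_var x e e1 e2) Q s.
Proof. by move=> f f1 f2; rewrite /choose_var /=; case: ifP. Qed.

Global Opaque choose_var.

(* Algorithm 2 from the pair [Var 12, Var 15], leaving the set in the array
   [inX] and the number of rounds in [Var 20].  [Var 11] is the room left
   between the frontier, whose label is [Var 3], and the next copy of the heads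
   of the starting pair. *)
Definition simulate_init :=
  put_cw 16 (Get 0 (Var 15)) (Get 0 (Var 12)) ;;
  put_cw 17 (Get 0 (Var 15)) (Get 1 (Var 15)) ;;
  put_cw 18 (Get 0 (Var 15)) (Get 1 (Var 12)) ;;
  put_cw 19 (Get 1 (Var 12)) (Get 1 (Var 15)) ;;
  put_cw 22 (Get 0 (Var 12)) (Get 1 (Var 12)) ;;
  choose_var 16 (Op OpLt (Var 17) (Var 16)) (Cst 0) (Var 16) ;;
  choose_var 19 (Op OpLt (Var 17) (Var 18)) (Cst 0) (Var 19) ;;
  SetVar 11 (Op OpSub (Op OpSub (Op OpSub (Var 1) (Var 16)) (Var 22)) (Var 19)) ;;
  choose_var 3 (Var 19) (Get 1 (Var 15)) (Get 1 (Var 12)) ;;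
  SetVar 20 (Cst 0) ;;
  measure_advance.

(** Both branches of the procedure add [pt v], so the test only decides which other vertex is
    marked; it is made before any write. *)
Definition simulate_mark inX :=
  SetVar 16 (Get 11 (Var 4)) ;; SetVar 17 (Get 11 (Var 16)) ;;
  If (Get inX (Var 17)) (SetArr inX (Var 4) (Cst 1)) (SetArr inX (Var 17) (Cst 1)) ;;
  SetArr inX (Var 16) (Cst 1).

Definition simulate_next :=
  inc 20 ;; SetVar 11 (Op OpSub (Var 11) (Var 9)) ;; SetVar 3 (Get 1 (Var 6)) ;;
  measure_advance.

Definition simulate inX :=
  (SetArr inX (Var 12) (Cst 1) ;; SetArr inX (Var 15) (Cst 1)) ;;
  simulate_init ;;
  While (Op OpLt (Var 7) (Var 11)) (simulate_mark inX ;; simulate_next).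

Section Simulate.
Variables (n B : nat) (F : arc_model n).
Local Notation L := n.*2.
Local Notation copy := (copy F).
Local Notation len := (len F).
Local Notation far := (far F).
Local Notation near := (near F).
Local Notation advance := (advance F).
Hypothesis LB : 8 * L <= B.
Variables (bf bn bb ow : nat -> 'I_n).
Local Notation tables := (tables F bf bn bb ow).
Local Notation measured := (measured F bf bn).
Local Notation pt := (tail_partner_of F bf ow).
Implicit Types (s : store) (u v w q : 'I_n) (X Y : {set 'I_n}).
Hypothesis ptP : forall v, tail_partner F v (pt v).
Hypothesis ptI : forall v P, copy v P -> L <= P -> far (P + len v) = P + len v ->
  exists2 Q, copy (pt v) Q & (Q + len (pt v)).+1 = P + len v.

Variables (w q : 'I_n) (R c : nat) (inX : nat).
Hypotheses (inX11 : 11 < inX) (wq : adj F w q) (cR : copy w R) (LR : 3 * L <= R).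
Hypothesis maxw : forall u P, copy u P -> P <= R -> R + len w <= P + len u -> u = w.
Hypotheses (cmod : c %% L = tl F (vfirst F)) (Rc : R <= c) (cN : c < near (R + len w)).

Let oA := if cw L (hd F q) (hd F w) <= len q then cw L (hd F q) (hd F w) else 0.
Let oB := if cw L (hd F q) (tl F w) <= len q then cw L (tl F w) (tl F q) else 0.
Let A := R - oA.
Let E := R + len w + oB.

(** What must survive a simulation: the other arrays, the start in variable 12 and the round count
    of the first run in variable 21. *)
Definition kept s s' := (forall a i, a != inX -> arr s' a i = arr s a i) /\
  (forall y : nat, (11 < y < 15) || (y == 21) -> var s' y = var s y).

Definition represents s X := (forall v, arr s inX v = (v \in X)) /\
  #|X| = (var s 20).*2 + 2.

(** The room [A + L - G] is truncated: it is 0 once the circle is closed, and then the loop stops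
    without any need for [inside]. *)
Definition sim_inv s0 m s := exists G X,
  [/\ tables s, kept s0 s, represents s X,
      [/\ forall v, arr s 11 v = pt v, E <= G, is_tail F G & var s 3 = G %% L] &
  [/\ measured s (G %% L), var s 11 = A + L - G, m = var s 11, m <= L &
  [/\ confined F X A G, A + L <= G \/ inside F X A G &
      forall Y, complete F pt X Y -> complete F pt [set w; q] Y]]].

Lemma cw_addm (a y : nat) : y < L -> (a + cw L (a %% L) y) %% L = y.
Proof.
move=> yL; have L0 := L_gt0 F; have aL : a %% L < L by rewrite ltn_mod.
rewrite cw_if // -modnDml; case: (leqP (a %% L) y) => h.
  by rewrite subnKC // modn_small.
by rewrite addnBCA ?subnn ?addn0 ?modnDr ?(@modn_small y) //; arith.
Qed.

Lemma offsets : [/\ oA < L, oB < L, A <= R & R < A + L].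
Proof.
have L0 := L_gt0 F; rewrite /A.
have h1 : oA < L by rewrite /oA; case: ifP => _ //; rewrite cw_lt.
have h2 : oB < L by rewrite /oB; case: ifP => _ //; rewrite cw_lt.
by split=> //; arith.
Qed.

Lemma end_label : E %% L = if oB != 0 then tl F q else tl F w.
Proof.
rewrite /E; case: eqP => [->|ne] /=; first by rewrite addn0 (copy_tl cR).
move: ne; rewrite /oB; case: ifP => // _ _.
by rewrite -(copy_tl cR) cw_addm // tl_lt.
Qed.

Lemma end_tail : is_tail F E.
Proof.
have L0 := L_gt0 F; have LE : L <= E by rewrite /E; arith.
have := end_label; case: ifP => _ e; have [P cP eP] := tail_copy e LE.
  by exists q, P.
by exists w, P.
Qed.

Lemma simulate_init_ok s0 s : tables s -> kept s0 s ->
  (forall v, arr s inX v = (v \in [set w; q])) -> (forall v, arr s 11 v = pt v) ->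
  var s 12 = w -> var s 15 = q -> wp B simulate_init (sim_inv s0 (A + L - E)) s.
Proof.
move=> ts [ka kv] char p11 v12 v15; have L0 := L_gt0 F; have [t0 t1] := t_base ts.
have h0 := t_hd ts; have h1 := t_tl ts.
have wn := ltn_ord w; have qn := ltn_ord q.
have hw := hd_lt F w; have hq := hd_lt F q; have tw := tl_lt F w; have tq := tl_lt F q.
have l1 := cw_lt (hd F q) (hd F w) L0; have l2 := len_lt F q.
have l3 := cw_lt (hd F q) (tl F w) L0; have l4 := cw_lt (tl F w) (tl F q) L0.
have l5 := len_lt F w; have [oAL oBL AR RA] := offsets.
rewrite /simulate_init /=.
do 5 (apply: wp_put_cw; rewrite /= ?v12 ?v15 ?t1 ?h0 ?h1 //; try (do ?[split=> //]; lia)).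
rewrite -/(len q) -/(len w).
apply: wp_choose_var; rewrite /= //; try by (do ?[split=> //]; try (apply: leq_trans (leq_b1 _) _); lia).
rewrite (_ : (if _ != 0 then _ else _) = oA); last first.
  by rewrite /oA; case: (leqP (cw L (hd F q) (hd F w)) (len q)).
apply: wp_choose_var; rewrite /= //; try by (do ?[split=> //]; try (apply: leq_trans (leq_b1 _) _); lia).
rewrite (_ : (if _ != 0 then _ else _) = oB); last first.
  by rewrite /oB; case: (leqP (cw L (hd F q) (tl F w)) (len q)).
rewrite ?t1; split; first by do ![split=> //]; lia.
apply: wp_choose_var; rewrite /= ?v12 ?v15 ?h1 //; try by (do ?[split=> //]; lia).
rewrite (_ : (if _ != 0 then _ else _) = E %% L); last by rewrite end_label; case: ifP.
split; first by [].
set s1 := set_var _ 20 0.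
have ts1 : tables s1 by apply: tables_ext (ts).
have EL : E %% L < L by rewrite ltn_mod.
apply: (measure_ok LB ts1 (erefl _) EL) => s' a' v' m'.
have ts' : tables s'.
  by apply: tables_ext ts1 => [|a i _ _]; [split; rewrite v'|rewrite a'].
exists E, [set w; q]; split=> //.
- split=> [a i ne|y hy]; first by rewrite a' ka.
  rewrite v'; last by clear -hy; lia.
  rewrite -kv //= ; move: hy; do 22 (case: y => [|y] //=).
- split; first by move=> v; rewrite a'; exact: char.
  by rewrite v' //= cards2 (andP wq).1.
- by split=> //; [move=> v; rewrite a'; exact: p11|exact: end_tail|rewrite v'].
have e11 : var s' 11 = A + L - E.
  by rewrite v' //= /E /A; arith.
have [conf ins] : confined F [set w; q] A E /\ (A + L <= E \/ inside F [set w; q] A E).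
  by apply: start_exact cR _ maxw wq _ _ => //; rewrite /A; arith.
by split=> //; rewrite /E; arith.
Qed.

Lemma simulate_round_ok s0 m s : sim_inv s0 m s -> var s 7 < var s 11 ->
  wp B (simulate_mark inX ;; simulate_next) (fun s' => exists2 m', m' < m & sim_inv s0 m' s') s.
Proof.
move=> [G [X [ts [ka kv] [char cX] [p11 EG tG v3] [ms v11 em mL [conf ins sub]]]]] lt.
have L0 := L_gt0 F; have [t0 t1] := t_base ts; have [oAL oBL AR RA] := offsets.
have LG : L <= G by rewrite /E in EG; arith.
have [eN eF eA [[v [P [ev cP GP eP]]] _ [b [Pb [eb cPb ePb]]]]] :=
  measured_advance ts LG tG ms.
have NA : near G < A + L by rewrite eN; arith.
have insG : inside F X A G.
  by case: ins => // h; have := near_gt F G; arith.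
have LA : 2 * L <= A by arith.
have wG : R + len w <= G by rewrite /E in EG; arith.
have Ac : A <= c by arith.
have cNG : c <= near G by apply: leq_trans (ltnW cN) (near_mono _ wG).
have [nv nd conf' ins'] :=
  exact_step ptP ptI LA AR maxw cmod Ac conf insG wG cNG cP GP eP NA.
have [_ _ _ cX' _] := stepP ptP nv.1.
have [hm hB] := measured_bound LB ms.
have Xn : #|X| <= n by rewrite -[X in _ <= X]card_ord max_card.
have ne a : a < 12 -> (a == inX) = false by move=> ha; apply/eqP; arith.
have an := ltn_ord (pt v); have bn' := ltn_ord (pt (pt v)); have vn := ltn_ord v.
have b'n := ltn_ord b; have tb := tl_lt F b.
have fin s1 : (forall y : nat, y != 16 -> y != 17 -> var s1 y = var s y) ->
    (forall a i, a != inX -> arr s1 a i = arr s a i) ->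
    (forall u, arr s1 inX u = (u \in step pt X v)) ->
    wp B simulate_next (fun s' => exists2 m', m' < m & sim_inv s0 m' s') s1.
  move=> kv1 ka1 char1.
  have ts1 : tables s1.
    apply: tables_ext ts => [|a i _ a11]; first by split; rewrite kv1.
    by apply: ka1; rewrite ne //; arith.
  rewrite /simulate_next /= !kv1 // addn1; split; first by do ![split=> //]; arith.
  split; first by do ![split=> //]; arith.
  rewrite /= ?kv1 // eb (t_tl ts1); split; first by do ![split=> //]; arith.
  set s2 := set_var _ 3 _.
  have ts2 : tables s2 by apply: tables_ext (ts1); have [] := t_base ts1.
  have Ga : advance G %% L = tl F b by rewrite -ePb (copy_tl cPb).
  apply: (measure_ok LB ts2 (g := advance G %% L)); [by rewrite Ga|by rewrite ltn_mod|].
  move=> s' a' v' m'; exists (var s 11 - var s 9).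
    by rewrite em; have := near_gt F G; arith.
  exists (advance G), (step pt X v); split.
  - have [b0 b1] := t_base ts2.
    by apply: tables_ext ts2 => [|a i _ _]; [split; rewrite v'|rewrite a'].
  - split=> [a i ane|y hy]; first by rewrite a' /= ka1 // ka.
    rewrite v'; last by clear -hy; lia.
    by rewrite -kv // -kv1; move: hy; do 22 (case: y => [|y] //=).
  - split; first by move=> u; rewrite a' /= char1.
    by rewrite v' //= cX' cX doubleS; arith.
  - split; [|by apply: leq_trans EG (ltnW (advance_gt F LG))|exact: advance_tail|by rewrite v' // Ga].
    by move=> u; rewrite a' /= ka1 ?ne // p11.
  have e11 : var s' 11 = A + L - advance G by rewrite v' //= eA; arith.
  split=> //; [by rewrite v'|by arith|split=> //; first by right].
  by move=> Y cY; apply: sub; apply: complete_step nd nv cY.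
pose Q1 s1 := [/\ forall y : nat, y != 16 -> y != 17 -> var s1 y = var s y,
  forall a i, a != inX -> arr s1 a i = arr s a i &
  forall u, arr s1 inX u = (u \in step pt X v)].
have mark : wp B (simulate_mark inX) Q1 s.
  rewrite /simulate_mark /= ev p11; split; first by do ![split=> //]; arith.
  rewrite p11; split; first by do ![split=> //]; arith.
  have in_b : arr s inX (pt (pt v)) = (pt (pt v) \in X) by exact: char.
  rewrite in_b; split; first by split; [arith|apply: leq_trans (leq_b1 _) _; arith].
  have bit (z : 'I_n) u : (if (inX == inX) && (nat_of_ord u == pt v) then 1 else
      if (inX == inX) && (nat_of_ord u == z) then 1 else arr s inX u) =
      (u \in X :|: [set z; pt v]) :> nat.
    rewrite eqxx /= char !inE -!val_eqE /=.
    by case: (nat_of_ord u == pt v); case: (nat_of_ord u == z); case: (u \in X).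
  have vars z y : y != 16 -> y != 17 ->
      (if y == 17 then z else if y == 16 then nat_of_ord (pt v) else var s y) = var s y.
    by move=> /negPf -> /negPf ->.
  have arrs z a i : a != inX -> (if (a == inX) && (i == nat_of_ord (pt v)) then 1
      else if (a == inX) && (i == z) then 1 else arr s a i) = arr s a i.
    by move=> /negPf ->.
  rewrite /Q1 /step; case: (boolP (pt (pt v) \in X)) => bX /=.
    by split; [arith|arith|split; [arith|arith|split; [exact: vars|exact: arrs|exact: bit]]].
  rewrite (setUC [set pt v]).
  by split; [arith|arith|split; [arith|arith|split; [exact: vars|exact: arrs|exact: bit]]].
change (wp B (simulate_mark inX) (wp B simulate_next
  (fun s' => exists2 m', m' < m & sim_inv s0 m' s')) s).
by apply: (wp_mono _ mark) => s1 [k1 a1 c1]; exact: fin.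
Qed.

Lemma simulate_ok s : tables s -> (forall v, arr s 11 v = pt v) ->
  (forall v, arr s inX v = 0) -> var s 12 = w -> var s 15 = q ->
  run_ok B (simulate inX) s (1000 * n + 1000) (fun s' => [/\ tables s', kept s s' &
    exists Y, complete F pt [set w; q] Y /\ represents s' Y]).
Proof.
move=> ts p11 z v12 v15; have n0 := n_gt0 F; have L0 := L_gt0 F.
have [oAL oBL AR RA] := offsets.
have ne a : a < 12 -> (a == inX) = false by move=> ha; apply/eqP; arith.
suff r : run_ok B (simulate inX) s (10 + (300 + L.+1 * (4 + 200)))
    (fun s' => [/\ tables s', kept s s' &
    exists Y, complete F pt [set w; q] Y /\ represents s' Y]).
  by apply: run_post r _ _ => //; arith.
have wn := ltn_ord w; have qn := ltn_ord q.
apply: (run_seq (Q1 := fun s' => [/\ tables s', kept s s',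
  forall v, arr s' inX v = (v \in [set w; q]), forall v, arr s' 11 v = pt v &
  var s' 12 = w /\ var s' 15 = q])).
  apply: run_wp_le => //=; rewrite v12 v15.
  split; [by arith|by arith|split; [by arith|by arith|split]].
  - by apply: tables_ext (ts) => [|a i _ a11]; [have [] := t_base ts|rewrite /= ne //; arith].
  - by split=> // a i ane; rewrite /= (negPf ane).
  - move=> v; rewrite /= eqxx /= !inE -!val_eqE /= z.
    by do 2 (case: eqP => _; rewrite ?orbT ?orbF //).
  - by move=> v; rewrite /= ne // p11.
  by [].
move=> s1 [ts1 k1 ch1 p1 [w1 q1]]; apply: (run_seq (Q1 := sim_inv s (A + L - E))).
  by apply: run_wp_le; [vm_compute|exact: simulate_init_ok].
move=> s2 I2; have mL : A + L - E <= L by case: I2 => G [X [_ _ _ _ [_ _ _ h _]]].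
apply: run_post; [apply: (run_while (I := sim_inv s) (K := 200) _ I2)| |]; last 1 first.
- by move=> s' h; exact: h.
- move=> m s3 I3; split.
    case: I3 => G [X [ts3 _ _ _ [ms v11 em mL3 _]]]; have [hm hB] := measured_bound LB ms.
    by rewrite /=; split; [arith|arith|apply: leq_trans (leq_b1 _) _; arith].
  rewrite /=; case: (ltnP (var s3 7) (var s3 11)) => h /=.
    by apply: run_wp_le; [vm_compute|exact: simulate_round_ok].
  case: I3 => G [X [ts3 k3 rep [_ EG tG _] [ms v11 em mL3 [conf _ sub]]]]; split=> //.
  exists X; split=> //; apply: sub; apply: complete_stop.
  have LG : L <= G by rewrite /E in EG; arith.
  have [eN _ _ _] := measured_advance ts3 LG tG ms.
  have AN : A + L <= near G by rewrite eN; arith.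
  exact: exact_stop conf AN.
rewrite /= leq_mul //; arith.
Qed.
End Simulate.

(** * The complete program *)

Definition head_side :=
  SetVar 21 (Var 20) ;;
  SetVar 15 (Get 10 (mirror (Get 0 (Var 12)))) ;;
  If (Op OpEq (Var 15) (Var 12))
    (put_succ 16 (Get 0 (Var 12)) ;; put_owner 15 (Var 16)) Skip.

(** Both sets have twice their number of rounds plus two elements, so comparing rounds compares
    sizes; a tie goes to the tail start, as in [candidate]. *)
Definition write_output :=
  SetVar 2 (Cst 0) ;;
  for_ 2 (Var 0)
    (If (Op OpLt (Var 20) (Var 21)) (SetArr 2 (Var 2) (Get 13 (Var 2)))
       (SetArr 2 (Var 2) (Get 12 (Var 2)))).

Definition program :=
  prepare ;; partners ;; settle ;; cross ;; select ;;
  SetVar 15 (Get 11 (Var 12)) ;; simulate 12 ;;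
  head_side ;; simulate 13 ;; write_output.

Section Main.
Variables (n B : nat) (F : arc_model n).
Local Notation L := n.*2.
Hypothesis LB : 8 * L <= B.
Implicit Types (s : store) (u v w : 'I_n) (S Y : {set 'I_n}).

Lemma head_side_ok bf bn bb ow s w : tables F bf bn bb ow s -> var s 12 = w ->
  var s 20 <= n ->
  wp B head_side (fun s' => [/\ arr s' = arr s, base n s', var s' 12 = w,
    var s' 15 = head_partner_of F bb ow w & var s' 21 = var s 20]) s.
Proof.
move=> ts v12 cn; have [t0 t1] := t_base ts; have hw := hd_lt F w.
have [bE _] := t_back ts hw; have bL := ltn_ord (bb (hd F w)); have wn := ltn_ord w.
rewrite /head_side /= ?v12 (t_hd ts) t1 subn1 bE.
split; first by arith.
split; first by do ![split=> //]; arith.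
split; first by split; [arith|arith|apply: leq_trans (leq_b1 _) _; arith].
have [e|ne] /= := eqVneq (nat_of_ord (bb (hd F w))) w; last first.
  split=> //; rewrite /= /head_partner_of; case: eqP => // e; case/eqP: ne; by rewrite e.
apply: (put_succ_ok LB) => //=; rewrite ?v12 ?(t_hd ts) //.
  by do ![split=> //]; arith.
have pL : succ_label n (hd F w) < L.
  by rewrite /succ_label; have [e'|/eqP ne'] /= := eqVneq (hd F w).+1 L; lia.
set p := succ_label n _ in pL *.
set s1 := set_var _ 16 p.
have ts1 : tables F bf bn bb ow s1 by apply: tables_ext (ts).
apply: (put_owner_ok LB ts1) => //=; first by arith.
split=> //; rewrite /= /head_partner_of.
by have -> : bb (hd F w) = w by [apply: val_inj]; rewrite eqxx.
Qed.

Lemma write_output_ok s Y1 Y2 : base n s ->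
  (forall v, arr s 12 v = (v \in Y1)) -> (forall v, arr s 13 v = (v \in Y2)) ->
  #|Y1| = (var s 21).*2 + 2 -> #|Y2| = (var s 20).*2 + 2 ->
  run_ok B write_output s (100 * n + 100) (fun s' =>
    outputs s' (if #|Y1| <= #|Y2| then Y1 else Y2)).
Proof.
move=> [b0 b1] r1 r2 c1 c2; have n0 := n_gt0 F.
have m1 : #|Y1| <= n by rewrite -[X in _ <= X]card_ord max_card.
have m2 : #|Y2| <= n by rewrite -[X in _ <= X]card_ord max_card.
set Y := if _ then _ else _.
pose I i s' := [/\ var s' 2 = i, var s' 0 = n, (var s' 20 = var s 20) /\ (var s' 21 = var s 21),
  forall a j, a != 2 -> arr s' a j = arr s a j &
  forall v, v < i -> arr s' 2 v = (v \in Y)].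
suff r : run_ok B write_output s (2 + n.+1 * (1 + 20 + 7)) (I n).
  by apply: run_post r _ _ => [|s' [_ _ _ _ h] v]; [arith|exact: h].
apply: (run_seq (Q1 := I 0)); first by apply: run_wp_le => //=; split.
move=> s1; apply: run_for; first by arith.
  by move=> i s' [-> e0 _ _ _]; rewrite /= e0; split=> //; arith.
move=> i s' ilt [e2 e0 [e20 e21] ka h]; apply: run_wp_le; first by vm_compute.
pose v := Ordinal ilt; have ei : i = v by [].
have a12 : arr s' 12 i = (v \in Y1) by rewrite ka // ei r1.
have a13 : arr s' 13 i = (v \in Y2) by rewrite ka // ei r2.
have fin (b : bool) : b = (v \in Y) -> I i.+1 (set_var (set_arr s' 2 i b) 2 i.+1).
  move=> eb; split=> //= [a j ane|u].
    by rewrite (negPf ane) /= ka.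
  rewrite ltnS => ui; have [e|ne] := eqVneq (nat_of_ord u) i.
    by have -> : u = v by [exact: val_inj]; rewrite -eb.
  by apply: h; clear -ui ne; lia.
rewrite /= e20 e21 e2 a12 a13.
split; first by split; [arith|arith|apply: leq_trans (leq_b1 _) _; arith].
have B1 (b : bool) : b <= B by apply: leq_trans (leq_b1 _) _; arith.
case: (ltnP (var s 20) (var s 21)) => cmp /=.
  split; [by arith|by split; [arith|]|split=> //].
  by apply: fin; rewrite /Y ifF //; apply/negbTE; rewrite -ltnNge; arith.
split; [by arith|by split; [arith|]|split=> //].
by apply: fin; rewrite /Y ifT //; arith.
Qed.

Lemma program_ok S0 : paired_dominating (adj F) S0 ->
  run_ok B program (input_store F) (4 * (2000 * n + 2000)) (fun s =>
    exists pt ph S, [/\ forall v, tail_partner F v (pt v),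
      forall v, head_partner F v (ph v), algorithm_output F pt ph S & outputs s S]).
Proof.
move=> pS0; have n0 := n_gt0 F; have L0 := L_gt0 F.
suff r : run_ok B program (input_store F) ((1600 * n + 1600) + ((500 * n + 500) +
    ((500 * n + 500) + ((1000 * n + 1000) + (100 + (20 + ((1000 * n + 1000) +
    (200 + ((1000 * n + 1000) + (100 * n + 100)))))))))) (fun s =>
    exists pt ph S, [/\ forall v, tail_partner F v (pt v),
      forall v, head_partner F v (ph v), algorithm_output F pt ph S & outputs s S]).
  by apply: run_post r _ _ => //; arith.
apply: run_seq (prepare_ok F LB) _ => s1 [[bf [bn [bb [ow ts1]]]] z1].
have nbr v := paired_neighbour v pS0.
set pt := tail_partner_of F bf ow; set ph := head_partner_of F bb ow.
have pL v : pred_label n (tl F v) < L.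
  by have := tl_lt F v; rewrite /pred_label; case: eqP; lia.
have sL v : succ_label n (hd F v) < L.
  by have := hd_lt F v; rewrite /succ_label; have [e|/eqP e] /= := eqVneq (hd F v).+1 L; lia.
have ptQ v := far_partner nbr (t_far ts1 (tl_lt F v)).2 (t_own ts1 (pL v)).1 erefl.
have ptP v : tail_partner F v (pt v) := (ptQ v).1.
have ptI v := (ptQ v).2.
have phP v : head_partner F v (ph v) :=
  back_partner nbr (t_back ts1 (hd_lt F v)).2 (t_own ts1 (sL v)).1 erefl.
apply: run_seq (partners_ok LB ts1) _ => s2 [b2 k2 p2'].
have p2 v : arr s2 11 v = pt v := p2' v.
have ts2 : tables F bf bn bb ow s2.
  by apply: tables_ext ts1 => // a i _ a11; apply: k2; apply/eqP; arith.
apply: run_seq (settle_ok LB ts2) _ => s3 [ts3 a3 v3].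
apply: run_seq (cross_ok LB ts3 v3) _ => s4 [ts4 a4 [l [c [nl cmod cT [v4 m4 ce]]]]].
apply: run_seq (select_ok LB ts4 nl cmod cT v4 m4 ce) _ => s5 [ts5 a5 [w [R [v12 sel]]]].
have [wW Rc cN _ [LR cR maxw _]] := selected_facts LB pS0 sel.
have e5 : arr s5 = arr s2 by rewrite a5 a4 a3.
have wn := ltn_ord w; have pwn := ltn_ord (pt w).
apply: (run_seq (Q1 := fun s6 => [/\ arr s6 = arr s2, tables F bf bn bb ow s6,
    var s6 12 = w & var s6 15 = pt w])).
  apply: run_wp_le => //=; rewrite v12 e5 p2; split; first by split; arith.
  by split=> //; apply: tables_ext (ts5); have [] := t_base ts5.
move=> s6 [a6 ts6 w6 q6].
have wq := pt_adj ptP w; have wh := ph_adj phP w.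
have p6 v : arr s6 11 v = pt v by rewrite a6 p2.
have z6 a v : a \in [:: 12; 13] -> arr s6 a v = 0.
  by move=> ha; rewrite a6 k2 ?z1 //; move: ha; rewrite !inE => /orP[] /eqP ->.
apply: run_seq (simulate_ok LB ptP ptI (isT : 11 < 12) wq cR LR maxw cmod Rc cN
  ts6 p6 (fun v => z6 12 v isT) w6 q6) _ => s7 [ts7 [ka7 kv7] [Y1 [cY1 [r7 c7]]]].
have m7 : #|Y1| <= n by rewrite -[X in _ <= X]card_ord max_card.
have w7 : var s7 12 = w by rewrite kv7.
apply: (run_seq (Q1 := fun s8 => [/\ arr s8 = arr s7, base n s8, var s8 12 = w,
    var s8 15 = ph w & var s8 21 = var s7 20])).
  by apply: run_wp_le; [vm_compute|apply: (head_side_ok ts7 w7); arith].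
move=> s8 [a8 b8 w8 q8 c8].
have ts8 : tables F bf bn bb ow s8 by apply: tables_ext ts7 => // a i _ _; rewrite a8.
have p8 v : arr s8 11 v = pt v by rewrite a8 ka7 // p6.
have z8 v : arr s8 13 v = 0 by rewrite a8 ka7 // z6.
apply: run_seq (simulate_ok LB ptP ptI (isT : 11 < 13) wh cR LR maxw cmod Rc cN
  ts8 p8 z8 w8 q8) _ => s9 [ts9 [ka9 kv9] [Y2 [cY2 [r9 c9]]]].
have r12 v : arr s9 12 v = (v \in Y1) by rewrite ka9 // a8 r7.
have c21 : #|Y1| = (var s9 21).*2 + 2 by rewrite kv9 // c8.
apply: run_post (write_output_ok (t_base ts9) r12 r9 c21 c9) _ _ => // s out.
exists pt, ph, (if #|Y1| <= #|Y2| then Y1 else Y2).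
have cand : candidate F pt ph w (if #|Y1| <= #|Y2| then Y1 else Y2) by exists Y1, Y2.
split=> //; apply: (candidate_output ptP phP wW cand) => S' pS'.
by have [_ _ _ _ [_ _ _ h]] := selected_facts LB pS' sel; exact: h cand.
Qed.
End Main.

(* First part: for every choice of the partner functions, the procedure halts
   and all it can output are minimum paired-dominating sets.  Second part: one
   program, on words of O(log n) bits, carries out the procedure in time
   O(n). *)
Theorem theorem2 :
  (forall (n : nat) (F : arc_model n) (pt ph : 'I_n -> 'I_n),
     3 <= n ->
     (exists S : {set 'I_n}, paired_dominating (adj F) S) ->
     (forall v : 'I_n, tail_partner F v (pt v)) ->
     (forall v : 'I_n, head_partner F v (ph v)) ->
     (exists S : {set 'I_n}, algorithm_output F pt ph S) /\
     (forall S : {set 'I_n},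
        algorithm_output F pt ph S -> min_paired_dominating (adj F) S))
  /\
  (exists (P : cmd) (b c : nat),
     forall (n : nat) (F : arc_model n),
       3 <= n ->
       (exists S : {set 'I_n}, paired_dominating (adj F) S) ->
       exists (pt ph : 'I_n -> 'I_n) (S : {set 'I_n}) (k : nat) (s : store),
         [/\ (forall v : 'I_n, tail_partner F v (pt v)) /\
             (forall v : 'I_n, head_partner F v (ph v)),
             algorithm_output F pt ph S,
             exec (n ^ b) P (input_store F) k s,
             outputs s S
           & k <= c * n]).
Proof.
split=> [n F pt ph _ [S pS] ptP phP|].
  by split; [exact: (output_exists ptP phP pS)|exact: (output_optimal ptP phP)].
(* Words must hold [8 * n.*2], that is [16 * n], which is at most [n ^ 4] because [n ^ 3 >= 27]. The
   time [4 * (2000 * n + 2000)] is at most [16000 * n]. *)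
exists program, 4, (4 * 4000) => n F n3 [S0 pS0].
have LB : 8 * n.*2 <= n ^ 4.
  have n27 : 3 ^ 3 <= n ^ 3 by rewrite leq_exp2r.
  by rewrite expnS mulnC -muln2 mulnA mulnC; nia.
have [k [s [ex kK [pt [ph [S [ptP phP out os]]]]]]] := program_ok LB pS0.
by exists pt, ph, S, k, s; split=> //; lia.
Qed.
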